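(* Let $f\colon\Gamma\to K$ be a harmonic map from an elastic graph $(\Gamma,\alpha)$ to a length graph $(K,\ell)$. Then there is a sequence of weighted curves $C_i$ in $\Gamma$ such that for all $\epsilon>0$ there is an $i$ with $$\ell[f_*C_i]^2\ge(1-\epsilon)\operatorname{Dir}[f]\,\operatorname{EL}[C_i].$$
   Context: A graph is a finite connected 1-complex (multiple edges, self-loops allowed); maps of graphs are continuous and need not take vertices to vertices. An elastic graph $(\Gamma,\alpha)$ has on each edge $e$ a positive measure absolutely continuous with respect to Lebesgue measure, of total mass $\alpha(e)>0$. A length graph $(K,\ell)$ has a non-negative length $\ell(e)$ on each edge (defining a pseudo-metric). A curve on a graph is a map from a closed, not necessarily connected 1-manifold, up to homotopy; a weighted curve is a positive linear combination of curves. $n_C(e)$ is the (weighted) number of times the taut (non-backtracking) representative of $C$ runs over $e$; $f_*C$ is the homotopy class of $f\circ C$ with the same weights. $\operatorname{EL}[C]=\sum_{e\in\operatorname{Edge}(\Gamma)}n_C(e)^2\alpha(e)$; for a weighted curve $D$ on $K$, $\ell[D]=\sum_{e\in\operatorname{Edge}(K)}n_D(e)\ell(e)$. For Lipschitz $f\colon\Gamma\to K$, $\operatorname{Dir}(f)=\int_\Gamma|f'(x)|^2dx$, with derivative taken with respect to the coordinates given by $\alpha$ and $\ell$, and $\operatorname{Dir}[f]=\inf_{g\in[f]}\operatorname{Dir}(g)$ over the homotopy class. A map is harmonic if it minimizes $\operatorname{Dir}$ in its homotopy class. *)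

(* Defs.v *)
From HB Require Import structures.
From mathcomp Require Import all_boot all_order all_algebra.
From mathcomp Require Import all_classical all_reals all_analysis.
Set Warnings "-redundant-canonical-projection".
Set Implicit Arguments.
Unset Strict Implicit.
Unset Printing Implicit Defensive.
Import Order.TTheory GRing.Theory Num.Theory.
Import numFieldNormedType.Exports.

Local Open Scope classical_set_scope.
Local Open Scope ring_scope.

(* Multiple edges and self-loops are allowed; connectedness is imposed
   separately because the domain of a curve is a disconnected 1-complex. *)
Record complex1 := Complex1 {
  vertex : finType;
  edge : finType;
  esrc : edge -> vertex;
  etgt : edge -> vertex }.

Definition adjacent (G : complex1) : rel (vertex G) := fun u v =>
  [exists e : edge G, ((esrc e == u) && (etgt e == v))
                   || ((esrc e == v) && (etgt e == u))].

Definition gconnected (G : complex1) : bool :=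
  [exists u : vertex G, forall v : vertex G, connect (@adjacent G) u v].

Inductive realization (R : realType) (G : complex1) : Type :=
| Vtx of vertex G
| Inn of edge G & {t : R | 0 < t < 1}.

Arguments Vtx {R G} _.
Arguments Inn {R G} _ _.

Section Realization.
Variables (R : realType) (G : complex1).

(* The closed edge e, parametrized by [0, 1]; outside of [0, 1] the parameter
   is clamped, so that chart e is total and factors through the retraction of
   R onto [0, 1]. *)
Definition chart (e : edge G) (t : R) : realization R G :=
  if insub t is Some u then Inn e u
  else if t <= 0 then Vtx (esrc e) else Vtx (etgt e).

HB.instance Definition _ := gen_eqMixin (realization R G).
HB.instance Definition _ := gen_choiceMixin (realization R G).

(* The quotient topology of the disjoint union of the vertices and of the
   closed edges. *)
Definition realization_open (U : set (realization R G)) : Prop :=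
  forall e : edge G, open (chart e @^-1` U).

Let realization_openT : realization_open setT.
Proof. by move=> e; rewrite preimage_setT; exact: openT. Qed.

Let realization_openI (A B : set (realization R G)) :
  realization_open A -> realization_open B -> realization_open (A `&` B).
Proof. by move=> oA oB e; rewrite preimage_setI; exact: openI. Qed.

Let realization_open_bigcup (I : Type) (F : I -> set (realization R G)) :
  (forall i, realization_open (F i)) -> realization_open (\bigcup_i F i).
Proof.
by move=> oF e; rewrite preimage_bigcup; apply: bigcup_open => i _; exact: oF.
Qed.

HB.instance Definition _ := isOpenTopological.Build (realization R G)
  realization_openT realization_openI realization_open_bigcup.

End Realization.

Definition gmap (R : realType) (G H : complex1) :=
  continuousType (realization R G) (realization R H).

Definition homotopic (R : realType) (G H : complex1) (f g : gmap R G H) : Prop :=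
  exists F : realization R G * R -> realization R H,
    [/\ {within setT `*` `[0%R, 1%R]%classic, continuous F},
        forall x, F (x, 0) = f x & forall x, F (x, 1) = g x].

(* A coordinate F e : [0, 1] -> R on each edge e induces a path pseudo-metric
   on the realization: the infimum of the lengths of the chains of edge
   segments (e, s, t), running from chart e s to chart e t. *)
Section PathMetric.
Variables (R : realType) (G : complex1) (F : edge G -> R -> R).

Fixpoint chain (x y : realization R G) (p : seq (edge G * R * R)) : Prop :=
  if p is (e, s, t) :: q then
    [/\ 0 <= s <= 1, 0 <= t <= 1, x = chart e s & chain (chart e t) y q]
  else x = y.

Definition chain_length (p : seq (edge G * R * R)) : R :=
  \sum_(a <- p) `|F a.1.1 a.2 - F a.1.1 a.1.2|.

Definition gdist (x y : realization R G) : R :=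
  inf [set chain_length p | p in [set p | chain x y p]].

End PathMetric.

(* The measure on e lives on the parameter interval [0, 1] of e; its values
   outside of [0, 1] are irrelevant.  Positivity is positivity on open
   subintervals: this is what makes t |-> emeas e [0, t] a coordinate on e. *)
Record elasticGraph (R : realType) := ElasticGraph {
  egraph :> complex1;
  egraph_connected : gconnected egraph;
  emeas : edge egraph -> {measure set R -> \bar R};
  emeas_ac : forall e, emeas e `<< lebesgue_measure;
  emeas_fin : forall e, (emeas e `[0%R, 1%R]%classic < +oo)%E;
  emeas_pos : forall e (a b : R), 0 <= a -> a < b -> b <= 1 ->
    (0 < emeas e `]a, b[%classic)%E }.

Record lengthGraph (R : realType) := LengthGraph {
  lgraph :> complex1;
  lgraph_connected : gconnected lgraph;
  elen : edge lgraph -> R;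
  elen_ge0 : forall e, 0 <= elen e }.

Section ElasticLength.
Variable R : realType.
Implicit Types (G : elasticGraph R) (K : lengthGraph R).

Definition ecoord G (e : edge G) (t : R) : R := fine (emeas e `[0%R, t]%classic).
Definition alpha G (e : edge G) : R := ecoord e 1.
Definition lcoord K (e : edge K) (t : R) : R := elen e * t.

Definition edist G : realization R G -> realization R G -> R :=
  gdist (@ecoord G).
Definition ldist K : realization R K -> realization R K -> R :=
  gdist (@lcoord K).

End ElasticLength.

Section Dirichlet.
Variables (R : realType) (G : elasticGraph R) (K : lengthGraph R).
Implicit Types f g : gmap R G K.

Definition lipschitz_map f : Prop :=
  exists L : R, forall x y, ldist (f x) (f y) <= L * edist x y.

(* |f'| at the point chart e t.  The upper limit of the difference quotients is
   their limit, i.e. the absolute value of the derivative in the coordinates of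
   G and K, wherever f is differentiable. *)
Definition speed f (e : edge G) (t : R) : \bar R :=
  limf_esup (fun s : R => (ldist (f (chart e s)) (f (chart e t))
                           / `|ecoord e s - ecoord e t|)%:E) t^'.

Definition Dir f : \bar R :=
  (\sum_(e : edge G) \int[emeas e]_(t in `[0%R, 1%R]%classic) (speed f e t ^+ 2))%E.

Definition DirClass f : \bar R :=
  ereal_inf [set Dir g | g in [set g | homotopic f g /\ lipschitz_map g]].

Definition harmonic_map f : Prop :=
  lipschitz_map f /\
  forall g, homotopic f g -> lipschitz_map g -> (Dir f <= Dir g)%E.

End Dirichlet.

(* The realization of circles n is a disjoint union of n circles: each one has
   one vertex and one edge. *)
Definition circles (n : nat) : complex1 :=
  @Complex1 'I_n 'I_n id id.

Record curve (R : realType) (G : complex1) := Curve {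
  ncomp : nat;
  cmap : gmap R (circles ncomp) G }.

Arguments cmap {R G} _.

(* A formal positive linear combination of curves. *)
Definition wcurve (R : realType) (G : complex1) :=
  seq ({posnum R} * curve R G).

(* (e, false) is the edge e run from source to target, (e, true) its reverse. *)
Definition dart (G : complex1) : finType := (edge G * bool)%type.
Definition dsrc G (d : dart G) := if d.2 then etgt d.1 else esrc d.1.
Definition dtgt G (d : dart G) := if d.2 then esrc d.1 else etgt d.1.
Definition drev G (d : dart G) : dart G := (d.1, ~~ d.2).

(* Closed edge path without backtracking, including at the base point; the
   empty word stands for a constant curve. *)
Definition reduced_cycle (G : complex1) (w : seq (dart G)) : bool :=
  cycle (fun a b : dart G => (dtgt a == dsrc b) && (b != drev a)) w.

Section Curves.
Variables (R : realType) (G : complex1).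
Implicit Types (c : curve R G) (C : wcurve R G).

Definition dchart (d : dart G) (t : R) : realization R G :=
  chart d.1 (if d.2 then 1 - t else t).

(* The i-th circle runs along the closed edge path w, spending the time
   1 / size w on each edge. *)
Definition runs_along n (c : gmap R (circles n) G) (i : 'I_n)
    (w : seq (dart G)) : Prop :=
  if w is [::] then
    exists v : vertex G, forall t : R, c (@chart R (circles n) i t) = Vtx v
  else
    forall (k : 'I_(size w)) (s : R), 0 <= s <= 1 ->
      c (@chart R (circles n) i ((k%:R + s) / (size w)%:R))
      = dchart (tnth (in_tuple w) k) s.

(* ws lists the edges run over by a taut representative of the curve c. *)
Definition taut_words c (ws : {ffun 'I_(ncomp c) -> seq (dart G)}) : Prop :=
  exists d : gmap R (circles (ncomp c)) G, homotopic (cmap c) d /\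
    forall i, reduced_cycle (ws i) /\ runs_along d i (ws i).

Definition taut_rep c : {ffun 'I_(ncomp c) -> seq (dart G)} :=
  xget [ffun=> [::]] [set ws | taut_words ws].

Definition ncross c (e : edge G) : nat :=
  (\sum_(i < ncomp c) count (fun d : dart G => d.1 == e) (taut_rep c i))%N.

Definition wncross C (e : edge G) : R :=
  \sum_(a <- C) a.1%:num * (ncross a.2 e)%:R.

End Curves.

Definition push_curve (R : realType) (G H : complex1) (f : gmap R G H)
    (c : curve R G) : curve R H :=
  Curve (f \o cmap c : gmap R (circles (ncomp c)) H).

Definition push (R : realType) (G H : complex1) (f : gmap R G H)
    (C : wcurve R G) : wcurve R H :=
  [seq (a.1, push_curve f a.2) | a <- C].

Definition EL (R : realType) (G : elasticGraph R) (C : wcurve R G) : R :=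
  \sum_(e : edge G) wncross C e ^+ 2 * alpha e.

Definition curve_length (R : realType) (K : lengthGraph R) (D : wcurve R K) : R :=
  \sum_(e : edge K) wncross D e * elen e.

(* Main.v *)
(* DirClass f is bounded by the energy of any Lipschitz map homotopic to f, and a
   map of small energy is found as follows.

   Let the weighted curve C range over the combinations of the finitely many
   reduced cycles i of G with at most as many darts as G, and let C almost
   maximize the concave function 2 l(C) - EL(C), where l(C) is the length of f_* C.
   Adding a small multiple of a cycle i to C hardly increases this function, which
   says that the edge lengths m(e) = n_C(e) alpha(e), slightly enlarged, satisfy
   l(i) <= m(i) for all i; and EL(C) = sum_e m(e)^2 / alpha(e) is almost the
   maximum, which is the supremum of l^2 / EL.

   It remains to find a map homotopic to f which stretches each edge e to a length
   of about m(e) at most, as its energy is then about EL(C).  Subdivide K finely,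
   and among the maps homotopic to f taking vertices to vertices and edges to edge
   paths choose one minimizing sum_e B^(size of e / m(e)).  If an edge is stretched
   too much, then one can leave its end along another edge which is stretched
   almost as much, without backtracking in the image, since otherwise moving the
   image of that vertex would decrease the energy.  By the pigeonhole principle
   this yields a cycle i of G with taut image, hence with l(i) > m(i).

   Cyclically reduced edge loops are shortest in their free homotopy class because
   a fine grid on a homotopy of loops makes their words conjugate in the free group
   on the edges. *)

Require Import Defs.
From HB Require Import structures.
From mathcomp Require Import all_boot all_order all_algebra.
From mathcomp Require Import all_classical all_reals all_analysis.
From mathcomp Require Import zify lra ring.
Set Implicit Arguments.
Unset Strict Implicit.
Unset Printing Implicit Defensive.
Import Order.TTheory GRing.Theory Num.Theory.
Import numFieldNormedType.Exports.
Local Open Scope classical_set_scope.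
Local Open Scope ring_scope.

(** * Near-maximizers of 2 l - EL *)

(** Length becomes a count of letters. In a fine subdivision each edge of [K], even one of length 0,
    is a word, and lengths are numbers of letters times the mesh, up to a controlled rounding error.
    Homotopies then reduce to cancelling backtracks and pushing vertices, and shortest loops to
    cyclically reduced words. Neither a maximizing curve nor a minimizing map has to exist. A curve
    is only required to come within t ^ 2 of the supremum of the gain, and the configuration is a
    minimum over natural numbers: the ratios size / m, with m rounded to the lattice, are multiplied
    by a common integer. The price of discreteness is a loss of at most [Q] in the exponent at each
    turn. Over a cycle this adds up to at most [Q] times the number of darts of [G], which is
    negligible for a small mesh. Crossing numbers are defined through a chosen taut word. Their
    independence of the choice comes from the comparison of conjugate words, which is therefore
    proved for arbitrary weights on the edges: the indicator of an edge gives crossing numbers, the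
    constant 1 gives lengths of words. *)

Section Duality.
Variables (R : realType) (E I : finType).
Variables (alpha : E -> R) (n : I -> E -> nat) (l : I -> R).
Hypothesis alpha_gt0 : forall e, 0 < alpha e.
Hypothesis l_ge0 : forall i, 0 <= l i.
Hypothesis n_gt0 : forall i, 1 <= \sum_e (n i e)%:R :> R.
Implicit Types C : seq ({posnum R} * I).

Definition wcount C e : R := \sum_(a <- C) a.1%:num * (n a.2 e)%:R.
Definition wlen C : R := \sum_(a <- C) a.1%:num * l a.2.
Definition wEL C : R := \sum_e wcount C e ^+ 2 * alpha e.
Definition gain C : R := 2 * wlen C - wEL C.

Let rescale (s : {posnum R}) C := [seq ((s%:num * a.1%:num)%:pos, a.2) | a <- C].

Lemma wcount_rescale s C e : wcount (rescale s C) e = s%:num * wcount C e.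
Proof.
rewrite /wcount big_map big_distrr /=.
by apply: eq_bigr => a _; rewrite mulrA.
Qed.

Lemma wlen_rescale s C : wlen (rescale s C) = s%:num * wlen C.
Proof.
rewrite /wlen big_map big_distrr /=.
by apply: eq_bigr => a _; rewrite mulrA.
Qed.

Lemma wEL_rescale s C : wEL (rescale s C) = s%:num ^+ 2 * wEL C.
Proof.
rewrite /wEL big_distrr /=.
by apply: eq_bigr => e _; rewrite wcount_rescale; ring.
Qed.

Lemma wcount_ge0 C e : 0 <= wcount C e.
Proof. by apply: sumr_ge0 => a _; rewrite mulr_ge0. Qed.

Lemma wEL_ge0 C : 0 <= wEL C.
Proof.
by apply: sumr_ge0 => e _; rewrite mulr_ge0 ?sqr_ge0 ?ltW.
Qed.

Let M : R := \sum_i l i.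

(** Every cycle makes at least one crossing, so its length, at most [M], is at most [M] times its
    number of crossings. *)
Lemma wlen_le C : wlen C <= M * \sum_e wcount C e.
Proof.
have -> : M * \sum_e wcount C e =
    \sum_(a <- C) a.1%:num * (M * \sum_e (n a.2 e)%:R).
  rewrite exchange_big /= big_distrr /=; apply: eq_bigr => a _.
  by rewrite -big_distrr /= mulrCA.
apply: ler_sum => a _; rewrite ler_pM2l//.
have lM : l a.2 <= M by rewrite /M (bigD1 a.2)//= lerDl sumr_ge0.
by rewrite (le_trans lM)// ler_peMr// sumr_ge0.
Qed.

(** Completing the square on each edge: 2 M N - N ^ 2 alpha is at most M ^ 2 / alpha. The supremum
    [sup S] is therefore finite. *)
Lemma gain_le C : gain C <= \sum_e M ^+ 2 / alpha e.
Proof.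
rewrite /gain /wEL.
apply: (@le_trans _ _ (2 * (M * \sum_e wcount C e)
                       - \sum_e wcount C e ^+ 2 * alpha e)).
  by rewrite lerD2r ler_pM2l// wlen_le.
rewrite mulrA big_distrr /= -sumrB; apply: ler_sum => e _.
set N := wcount C e; have a0 := alpha_gt0 e.
rewrite -subr_ge0.
have -> : M ^+ 2 / alpha e - (2 * M * N - N ^+ 2 * alpha e)
  = (M - N * alpha e) ^+ 2 / alpha e.
  by field; rewrite gt_eqF.
by rewrite divr_ge0 ?sqr_ge0// ltW.
Qed.

Let S : set R := [set gain C | C in setT].

Let S_sup : has_sup S.
Proof.
split; first by exists (gain [::]), [::].
by exists (\sum_e M ^+ 2 / alpha e) => _ [C _ <-]; exact: gain_le.
Qed.

Let gain_sup C : gain C <= sup S.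
Proof. by apply: (sup_ubound (proj2 S_sup)); exists C. Qed.

Let sup_ge0 : 0 <= sup S.
Proof.
apply: le_trans (gain_sup [::]).
rewrite /gain /wlen /wEL big_nil mulr0 sub0r oppr_ge0 big1// => e _.
by rewrite /wcount big_nil expr0n mul0r.
Qed.

Lemma wcount_cons a C e : wcount (a :: C) e = a.1%:num * (n a.2 e)%:R + wcount C e.
Proof. by rewrite /wcount big_cons. Qed.

(** Dominates 1 + EL of each single cycle. The EL is the second-order cost of adding the cycle, and
    the 1 pays for the gap t ^ 2 to the supremum. *)
Let kappa : R := 1 + \sum_i \sum_e (n i e)%:R ^+ 2 * alpha e.

Let ELi_ge0 i : 0 <= \sum_e (n i e)%:R ^+ 2 * alpha e.
Proof. by apply: sumr_ge0 => e _; rewrite mulr_ge0 ?sqr_ge0 ?ltW. Qed.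

Let kappa_ge i : 1 + \sum_e (n i e)%:R ^+ 2 * alpha e <= kappa.
Proof. by rewrite lerD2l (bigD1 i)//= lerDl sumr_ge0. Qed.

Let kappa_gt0 : 0 < kappa.
Proof. by rewrite ltr_pwDl// sumr_ge0. Qed.

(* Otherwise adding the curve i to C with weight t would increase the gain by
   more than t ^+ 2. *)
Lemma near_sup_len C (t : {posnum R}) i : sup S - t%:num ^+ 2 < gain C ->
  l i <= \sum_e (wcount C e * alpha e + t%:num * kappa) * (n i e)%:R.
Proof.
have T0 : 0 < t%:num by []. set T := t%:num in T0 *.
move=> nearC; have := gain_sup ((t, i) :: C).
have ELE : wEL ((t, i) :: C) =
   wEL C + 2 * T * (\sum_e wcount C e * alpha e * (n i e)%:R)
   + T ^+ 2 * \sum_e (n i e)%:R ^+ 2 * alpha e.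
  rewrite /wEL !big_distrr /= -!big_split /=; apply: eq_bigr => e _.
  by rewrite wcount_cons /= -/T; ring.
rewrite /gain ELE {1}/wlen big_cons /= -/(wlen C) -/T.
move: nearC; rewrite /gain => nearC leS.
under eq_bigr do rewrite mulrDl.
rewrite big_split /= -big_distrr /=.
set A := \sum_e _ * _ * _ in leS *; set B := \sum_e _ ^+ 2 * _ in leS *.
have kB : 1 + B <= kappa by exact: kappa_ge.
have B0 : 0 <= B by exact: ELi_ge0.
have n1 := n_gt0 i.
(* The gain of [(t, i) :: C] is at most [sup S], hence exceeds that of [C] by less than T ^ 2; one
   factor T is set aside to be cancelled. *)
have step : T * (2 * l i - 2 * A - T * B - T) < T * 0.
  by rewrite mulr0; nra.
rewrite ltr_pM2l// in step.
have : T * kappa <= T * kappa * \sum_e (n i e)%:R.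
  by rewrite ler_peMr// mulr_ge0 ?ltW.
have : T * (1 + B) <= T * kappa by rewrite ler_pM2l.
by nra.
Qed.

(** At an exact maximizer the derivative under scaling vanishes, so that l = EL = gain. The
    approximate version compares [C] with its multiple by 1 - t. *)
Lemma near_sup_EL C (t : {posnum R}) : t%:num < 1 ->
  sup S - t%:num ^+ 2 < gain C -> (1 - t%:num) * wEL C <= sup S + t%:num.
Proof.
have T0 : 0 < t%:num by []. set T := t%:num in T0 *. move=> T1.
have s0 : 0 < 1 - T by rewrite subr_gt0.
rewrite /gain => nearC; have := gain_sup (rescale (PosNum s0) C).
rewrite /gain wlen_rescale wEL_rescale /= => leS.
have step : T * ((1 - T) * wEL C) <= T * (sup S + T) by nra.
by rewrite ler_pM2l in step.
Qed.

(** [Dv] stands for the Dirichlet energy of the class of f. The hypothesis [Dv_le] is the geometric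
    input: edge lengths m for which no cycle is shorter than its image bound the energy. *)
Variable Dv : R.
Hypothesis Dv_le : forall m : E -> R, (forall e, 0 < m e) ->
  (forall i, l i <= \sum_e m e * (n i e)%:R) ->
  Dv <= \sum_e m e ^+ 2 / alpha e.

(** By [near_sup_len] the lengths n_C alpha + t kappa satisfy the hypothesis of [Dv_le]. Their
    energy is close to EL(C), which [near_sup_EL] bounds by about [sup S]; then t tends to 0. *)
Lemma Dv_le_sup : Dv <= sup S.
Proof.
set A := \sum_e (alpha e)^-1.
have A0 : 0 <= A by apply: sumr_ge0 => e _; rewrite invr_ge0 ltW.
have K0 : 0 <= 2 * kappa ^+ 2 * A.
  by apply: mulr_ge0 => //; apply: mulr_ge0 => //; exact: sqr_ge0.
have bound (t : {posnum R}) : t%:num < 1 ->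
  (1 - t%:num) * Dv <= (1 + t%:num) * (sup S + t%:num)
     + 2 * (t%:num * (kappa ^+ 2 * A)).
  have T0 : 0 < t%:num by []. set T := t%:num in T0 *. move=> T1.
  have [_ [C _ <-] nearC] := sup_adherent (exprn_gt0 2 T0) S_sup.
  have EL_le := near_sup_EL T1 nearC.
  have m_gt0 e : 0 < wcount C e * alpha e + T * kappa.
    by rewrite ltr_wpDl ?mulr_gt0// mulr_ge0 ?wcount_ge0// ltW.
  have := Dv_le m_gt0 (fun i => near_sup_len i nearC).
  have : \sum_e (wcount C e * alpha e + T * kappa) ^+ 2 / alpha e <=
      (1 + T) * wEL C + (T + T ^+ 2) * (kappa ^+ 2 * A).
    rewrite [leRHS](_ : _ = (1 + T) * wEL C + (T + T ^+ 2) * kappa ^+ 2 * A);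
      last by ring.
    rewrite /wEL /A !big_distrr -big_split /=; apply: ler_sum => e _.
    have a0 := alpha_gt0 e; rewrite -subr_ge0.
    set N := wcount C e.
    (* The cross term 2 T kappa N is split between N ^ 2 alpha and kappa ^ 2 / alpha with equal
       weights T, and what is left over is a square. *)
    have -> : (1 + T) * (N ^+ 2 * alpha e) + (T + T ^+ 2) * kappa ^+ 2 / alpha e
       - (N * alpha e + T * kappa) ^+ 2 / alpha e
       = T * (N * alpha e - kappa) ^+ 2 / alpha e.
      by field; rewrite gt_eqF.
    apply: divr_ge0; last exact: ltW. apply: mulr_ge0; [exact: ltW | exact: sqr_ge0].
  have k2A : 0 <= kappa ^+ 2 * A by rewrite mulr_ge0 ?sqr_ge0.
  have := wEL_ge0 C; rewrite -/T in EL_le *.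
  set W := wEL C in EL_le *; set K := kappa ^+ 2 * A in k2A *.
  set G := \sum_e _ => W0 h1 h2.
  have h3 : Dv <= (1 + T) * W + (T + T ^+ 2) * K.
    exact: le_trans h2 h1.
  have h4 : (1 - T) * Dv <= (1 - T) * ((1 + T) * W + (T + T ^+ 2) * K).
    by rewrite ler_pM2l// subr_gt0.
  have h5 : (1 + T) * ((1 - T) * W) <= (1 + T) * (sup S + T).
    by rewrite ler_pM2l// addr_gt0.
  have h6 : (1 - T) * ((T + T ^+ 2) * K) <= 2 * (T * K).
    have : 0 <= T * K by rewrite mulr_ge0// ltW.
    have : 0 <= T ^+ 2 * (T * K) by rewrite mulr_ge0 ?sqr_ge0 ?mulr_ge0// ltW.
    nra.
  nra.
rewrite leNgt; apply/negP => SD.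
have D0 : 0 < Dv by exact: le_lt_trans SD.
(* [Z] collects the coefficients of t in the error of [bound], with t ^ 2 estimated by t. The choice
   of [d] keeps this error below half of the supposed gap [Dv - sup S]. *)
pose Z := Dv + sup S + 2 + 2 * kappa ^+ 2 * A.
have Z2 : 2 <= Z.
  by move: sup_ge0 K0; rewrite /Z; lra.
have Z0 : 0 < Z by exact: lt_le_trans Z2.
pose d := Num.min (2^-1) ((Dv - sup S) / (2 * Z)).
have d0 : 0 < d.
  by rewrite lt_min invr_gt0 ltr0n /= divr_gt0 ?subr_gt0// mulr_gt0.
have d1 : d <= 2^-1 by rewrite ge_min lexx.
have d2 : d * (2 * Z) <= Dv - sup S.
  by rewrite -ler_pdivlMr ?mulr_gt0// ge_min lexx orbT.
have := bound (PosNum d0); rewrite /= => /(_ _).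
have dlt1 : d < 1 by lra.
move=> /(_ dlt1); have dd : d * d <= d * 1 by rewrite ler_pM2l// ltW.
have dZ : d * Z = d * Dv + d * sup S + d * 2 + d * (2 * kappa ^+ 2 * A).
  by rewrite /Z; ring.
have : 2 * (d * (kappa ^+ 2 * A)) = d * (2 * kappa ^+ 2 * A) by ring.
move: d2; rewrite mulrCA => d2 ->.
have dZ0 : 0 < d * Z by rewrite mulr_gt0.
nra.
Qed.

(** Since l ^ 2 - (2 l - EL) EL = (l - EL) ^ 2, the quotient l ^ 2 / EL is at least the gain, so any
    curve of nearly maximal gain will do. *)
Lemma duality eps : 0 < eps -> 0 < Dv ->
  exists C, 0 < wEL C /\ (1 - eps) * Dv * wEL C <= wlen C ^+ 2.
Proof.
move=> eps0 D0; have SD := Dv_le_sup.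
have S0 : 0 < sup S by exact: lt_le_trans SD.
pose d := Num.min eps (2^-1).
have d0 : 0 < d by rewrite lt_min eps0 invr_gt0 ltr0n.
have d1 : d <= 2^-1 by rewrite ge_min lexx orbT.
have de : d <= eps by rewrite ge_min lexx.
have [_ [C _ <-] nearC] := sup_adherent (mulr_gt0 d0 S0) S_sup.
have gain0 : 0 < gain C by apply: le_lt_trans nearC; nra.
have L0 : 0 < wlen C by have := wEL_ge0 C; rewrite /gain in gain0; lra.
have EL0 : 0 < wEL C.
  rewrite lt_neqAle wEL_ge0 andbT; apply/eqP => EL0.
  (* If EL vanished, the gain would be linear under scaling. This factor pushes it to 2 (sup S + 1),
     beyond the supremum. *)
  have s0 : 0 < (sup S + 1) / wlen C.
    by rewrite divr_gt0// addr_gt0.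
  have := gain_sup (rescale (PosNum s0) C).
  rewrite /gain wlen_rescale wEL_rescale /= -EL0 mulr0 subr0.
  by rewrite divfK ?gt_eqF//; lra.
exists C; split=> //.
have h1 : (1 - eps) * Dv <= gain C.
  apply: le_trans (ltW nearC).
  have : d * Dv <= eps * Dv by rewrite ler_pM2r.
  have : (1 - d) * Dv <= (1 - d) * sup S by rewrite ler_pM2l//; lra.
  lra.
apply: (@le_trans _ _ (gain C * wEL C)); first by rewrite ler_pM2r.
rewrite /gain -subr_ge0.
have -> : wlen C ^+ 2 - (2 * wlen C - wEL C) * wEL C = (wlen C - wEL C) ^+ 2.
  by ring.
exact: sqr_ge0.
Qed.

End Duality.

(** * Free reduction *)

Section FreeReduction.
Variable G : complex1.
Implicit Types (d : dart G) (u v w x : seq (dart G)).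

Lemma drevK d : drev (drev d) = d.
Proof. by case: d => e b; rewrite /drev /= negbK. Qed.

Lemma drev_neq d : drev d != d.
Proof. by case: d => e [] ; rewrite /drev xpair_eqE eqxx. Qed.

Lemma dsrc_drev d : dsrc (drev d) = dtgt d.
Proof. by rewrite /dsrc /dtgt /=; case: d.2. Qed.

Lemma dtgt_drev d : dtgt (drev d) = dsrc d.
Proof. by rewrite /dsrc /dtgt /=; case: d.2. Qed.

Definition nobt : rel (dart G) := fun a b => b != drev a.

Lemma nobt_drev d d' : nobt (drev d') (drev d) = nobt d d'.
Proof. by rewrite /nobt drevK eq_sym. Qed.

(** Left multiplication by a letter on the reduced words, which are the normal forms of the free
    group on the edges. By [dpush_drevK] it is a permutation of them with inverse [dpush (drev d)],
    so the free group acts and no confluence argument is needed. *)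
Definition dpush d x : seq (dart G) :=
  if x is a :: y then if a == drev d then y else d :: x else [:: d].

Definition reduced x := sorted nobt x.

Lemma reduced_dpush d x : reduced x -> reduced (dpush d x).
Proof.
case: x => //= a y red; case: ifPn => [_|ad]; first exact: path_sorted red.
by rewrite /= red andbT /nobt.
Qed.

Lemma dpush_drevK d x : reduced x -> dpush d (dpush (drev d) x) = x.
Proof.
case: x => [|a y] /= red; first by rewrite eqxx.
rewrite drevK; case: (eqVneq a d) => [<-|ad] /=; last by rewrite eqxx.
case: y red => //= b y /andP[+ _].
by rewrite /nobt => /negPf ->.
Qed.

Definition act w x := foldr dpush x w.

Lemma act_cat u v x : act (u ++ v) x = act u (act v x).
Proof. exact: foldr_cat. Qed.

Lemma reduced_act w x : reduced x -> reduced (act w x).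
Proof. by move=> red; elim: w => //= d w IH; exact: reduced_dpush. Qed.

Lemma act_reduced w x : reduced (w ++ x) -> act w x = w ++ x.
Proof.
elim: w => //= d w IH red; rewrite IH; last exact: path_sorted red.
case: (w ++ x) red => //= a y /andP[+ _].
by rewrite /nobt => /negPf ->.
Qed.

(** Equality in the free group, tested by the action on normal forms. Words need not be composable
    edge paths here. *)
Definition freeq u v := forall x, reduced x -> act u x = act v x.

Lemma freeq_refl u : freeq u u. Proof. by []. Qed.

Lemma freeq_sym u v : freeq u v -> freeq v u.
Proof. by move=> h x r; rewrite h. Qed.

Lemma freeq_trans v u w : freeq u v -> freeq v w -> freeq u w.
Proof. by move=> h h' x r; rewrite h// h'. Qed.

Lemma freeq_cat u u' v v' : freeq u u' -> freeq v v' -> freeq (u ++ v) (u' ++ v').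
Proof.
by move=> h h' x r; rewrite !act_cat h'// h//; exact: reduced_act.
Qed.

Lemma freeq_cancel d : freeq [:: d; drev d] [::].
Proof. by move=> x r /=; rewrite dpush_drevK. Qed.

Variable k : edge G -> nat.

Definition weight w := (\sum_(d <- w) k d.1)%N.

Lemma weight_cat u v : weight (u ++ v) = (weight u + weight v)%N.
Proof. by rewrite /weight big_cat. Qed.

Lemma weight_cons d v : weight (d :: v) = (k d.1 + weight v)%N.
Proof. by rewrite /weight big_cons. Qed.

Lemma weight_nil : weight [::] = 0%N. Proof. by rewrite /weight big_nil. Qed.

Lemma weight_dpush d x : (weight (dpush d x) <= k d.1 + weight x)%N
  /\ (weight x <= k d.1 + weight (dpush d x))%N.
Proof.
case: x => [|a y] /=; first by rewrite !weight_cons weight_nil addn0 leqnn leq0n.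
case: eqP => [->|_]; rewrite !weight_cons /=; split; lia.
Qed.

Lemma weight_act w x : (weight (act w x) <= weight w + weight x)%N
  /\ (weight x <= weight w + weight (act w x))%N.
Proof.
elim: w => [|d w [IH1 IH2]] /=; first by rewrite weight_nil add0n leqnn.
by have [h1 h2] := weight_dpush d (act w x); rewrite weight_cons; split; lia.
Qed.

Definition wpow u n := iter n (cat u) [::].

Lemma weight_pow u n : weight (wpow u n) = (n * weight u)%N.
Proof.
by elim: n => [|n IH] /=; rewrite ?weight_cat ?IH /weight ?big_nil// mulSn.
Qed.

Lemma freeq_pow u v c n : freeq (u ++ c) (c ++ v) ->
  freeq (wpow u n ++ c) (c ++ wpow v n).
Proof.
move=> h; elim: n => [|n IH] /=; first by rewrite cats0; exact: freeq_refl.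
rewrite -catA; apply: (@freeq_trans (u ++ c ++ wpow v n)).
  exact: freeq_cat.
by rewrite !catA; apply: freeq_cat.
Qed.

(** Cyclic reducedness means that nothing cancels at the seams between the copies of [v]. *)
Lemma reduced_pow v n : cycle nobt v -> reduced (wpow v n).
Proof.
case: v => [_|d v cyc]; first by elim: n.
have cyc' : path nobt d (rcons v d) by [].
elim: n => // n IH.
have -> : wpow (d :: v) n.+1 = d :: v ++ wpow (d :: v) n by [].
case: n IH => [_|n IH].
  by rewrite /= cats0; move: cyc'; rewrite rcons_path => /andP[].
by move: cyc'; rewrite /reduced /sorted cat_path /= rcons_path => /andP[-> ->].
Qed.

(* Compare the weights of the n-th powers, which differ by at most 2 weight c. *)
Lemma conj_weight u v c : cycle nobt v -> freeq (u ++ c) (c ++ v) ->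
  (weight v <= weight u)%N.
Proof.
move=> cyc /freeq_pow h; rewrite leqNgt; apply/negP => uv.
(* The n-th power of [v] would outweigh that of [u] by at least n, but conjugation by [c] permits a
   difference of at most 2 weight c. *)
have [n n_gt] : exists n, (2 * weight c < n)%N by exists (2 * weight c).+1.
have := h n [::] isT; rewrite !act_cat.
have -> : act (wpow v n) [::] = wpow v n.
  by rewrite act_reduced cats0 ?reduced_pow.
have [h1 _] := weight_act (wpow u n) (act c [::]).
have [h2 _] := weight_act c [::].
have [_ h3] := weight_act c (wpow v n).
move=> eq; rewrite eq in h1; move: h1 h2 h3; rewrite !weight_pow weight_nil.
by move: uv n_gt; nia.
Qed.

End FreeReduction.

(** * Continuous maps on realizations *)

Section ContinuousMaps.
Variable R : realType.

Lemma continuous_o (S T U : topologicalType) (g : T -> U) (f : S -> T) :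
  continuous g -> continuous f -> continuous (fun x => g (f x)).
Proof. by move=> cg cf x; apply: (@continuous_comp _ _ _ f g); [exact: cf | exact: cg]. Qed.

Variables (T : topologicalType).
Implicit Types f g : T -> R.

Lemma continuous_add f g :
  continuous f -> continuous g -> continuous (fun x => f x + g x).
Proof. by move=> cf cg x; apply: cvgD; [exact: cf | exact: cg]. Qed.

Lemma continuous_opp f : continuous f -> continuous (fun x => - f x).
Proof. by move=> cf x; apply: cvgN; exact: cf. Qed.

Lemma continuous_mul f g :
  continuous f -> continuous g -> continuous (fun x => f x * g x).
Proof. by move=> cf cg x; apply: cvgM; [exact: cf | exact: cg]. Qed.

Lemma continuous_minr f g :
  continuous f -> continuous g -> continuous (fun x => Num.min (f x) (g x)).
Proof. by move=> cf cg; apply: min_fun_continuous. Qed.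

Lemma continuous_maxr f g :
  continuous f -> continuous g -> continuous (fun x => Num.max (f x) (g x)).
Proof. by move=> cf cg; apply: max_fun_continuous. Qed.

Lemma continuous_normr f : continuous f -> continuous (fun x => `|f x|).
Proof. by move=> cf x; apply: cvg_norm; exact: cf. Qed.

Lemma continuous_pair (Y Z : topologicalType) (f : T -> Y) (g : T -> Z) :
  continuous f -> continuous g -> continuous (fun x => (f x, g x)).
Proof. by move=> cf cg x; apply: cvg_pair; [exact: cf | exact: cg]. Qed.

Lemma continuous_cst (Y : topologicalType) (y : Y) : continuous (fun _ : T => y).
Proof. by move=> x; apply: cvg_cst. Qed.

Lemma continuous_var : continuous (fun x : T => x).
Proof. by move=> x; exact: cvg_id. Qed.

Lemma continuous_fst (Y Z : topologicalType) (f : T -> Y * Z) :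
  continuous f -> continuous (fun x => (f x).1).
Proof.
move=> cf; apply: (@continuous_o _ _ _ fst f) => // x.
exact: cvg_fst.
Qed.

Lemma continuous_snd (Y Z : topologicalType) (f : T -> Y * Z) :
  continuous f -> continuous (fun x => (f x).2).
Proof.
move=> cf; apply: (@continuous_o _ _ _ snd f) => // x.
exact: cvg_snd.
Qed.

Lemma continuous_paste (Y : topologicalType) (f g : T -> Y) (h : T -> R) :
  continuous h -> continuous f -> continuous g ->
  (forall x, h x = 0 -> f x = g x) ->
  continuous (fun x => if h x <= 0 then f x else g x).
Proof.
move=> ch cf cg fg; pose k x := if h x <= 0 then f x else g x.
have cA : closed [set x | h x <= 0].
  exact: (proj1 (continuous_closedP h) ch _ (@closed_le _ 0)).
have cB : closed [set x | 0 <= h x].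
  exact: (proj1 (continuous_closedP h) ch _ (@closed_ge _ 0)).
have kf : {within [set x | h x <= 0], continuous k}.
  apply: (@subspace_eq_continuous _ _ _ f).
    by move=> x; rewrite inE /= => h0; change (f x = k x); rewrite /k h0.
  exact: continuous_subspaceT.
have kg : {within [set x | 0 <= h x], continuous k}.
  apply: (@subspace_eq_continuous _ _ _ g).
    move=> x; rewrite inE /= => h0; change (g x = k x); rewrite /k.
    case: ifPn => // h1.
    by apply/esym/fg/eqP; rewrite eq_le h0 h1.
  exact: continuous_subspaceT.
have := withinU_continuous cA cB kf kg.
rewrite (_ : _ `|` _ = setT); first by rewrite -continuous_subspace_setT.
by apply/seteqP; split=> // x _ /=; case: (leP (h x) 0) => [|/ltW]; [left|right].
Qed.

End ContinuousMaps.

Ltac cont := repeat first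
  [ assumption | exact: continuous_var | exact: continuous_cst
  | apply: continuous_add | apply: continuous_opp | apply: continuous_mul
  | apply: continuous_minr | apply: continuous_maxr | apply: continuous_normr
  | apply: continuous_pair | apply: continuous_fst | apply: continuous_snd ].

Section Clamp.
Variable R : realType.

Definition clamp (t : R) := Num.max 0 (Num.min 1 t).

Lemma continuous_clamp (T : topologicalType) (f : T -> R) :
  continuous f -> continuous (fun x => clamp (f x)).
Proof. by move=> cf; rewrite /clamp; cont. Qed.

Lemma clamp_id t : 0 <= t <= 1 -> clamp t = t.
Proof. by case/andP=> t0 t1; rewrite /clamp min_r// max_r. Qed.

Lemma clamp01 t : 0 <= clamp t <= 1.
Proof. by rewrite /clamp le_max lexx /= ge_max ler01 ge_min lexx. Qed.

Lemma clamp_le0 t : t <= 0 -> clamp t = 0.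
Proof. by move=> t0; rewrite /clamp max_l// ge_min t0 orbT. Qed.

Lemma clamp_ge1 t : 1 <= t -> clamp t = 1.
Proof. by move=> t1; rewrite /clamp min_l// max_r. Qed.

End Clamp.

Section Realization.
Variables (R : realType) (G : complex1).
Local Notation X := (realization R G).

Lemma chart_le0 e (t : R) : t <= 0 -> chart e t = Vtx (esrc e) :> X.
Proof.
by move=> t0; rewrite /chart insubF ?t0// ltNge t0.
Qed.

Lemma chart_ge1 e (t : R) : 1 <= t -> chart e t = Vtx (etgt e) :> X.
Proof.
move=> t1; rewrite /chart insubF; last by rewrite [t < 1]ltNge t1 andbF.
by rewrite leNgt (lt_le_trans ltr01 t1).
Qed.

Lemma chart_inn e (t : R) (t01 : 0 < t < 1) : chart e t = Inn e (exist _ t t01) :> X.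
Proof. by rewrite /chart (insubT (fun t : R => 0 < t < 1) t01). Qed.

Lemma Inn_chart e (u : {t : R | 0 < t < 1}) : Inn e u = chart e (val u) :> X.
Proof. by case: u => t t01; rewrite (chart_inn e t01). Qed.

Lemma chart_clamp e (t : R) : chart e (clamp t) = chart e t :> X.
Proof.
have [t0|t0] := leP t 0; first by rewrite clamp_le0// !chart_le0.
have [t1|t1] := leP 1 t; first by rewrite clamp_ge1// !chart_ge1.
by rewrite clamp_id// !ltW.
Qed.

Lemma open_realizationP (U : set X) :
  open U <-> forall e : edge G, open (chart e @^-1` U).
Proof. by []. Qed.

Lemma continuous_chart (e : edge G) : continuous (chart e : R -> X).
Proof. by apply/continuousP => A oA; exact: oA. Qed.

Lemma realization_ind (P : X -> Prop) :
  (forall v, P (Vtx v)) -> (forall e t, 0 < t < 1 -> P (chart e t)) ->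
  forall x, P x.
Proof.
move=> hv he [v|e u]; first exact: hv.
by rewrite Inn_chart; apply: he; case: u.
Qed.

Lemma continuous_realization (Y : topologicalType) (f : X -> Y) :
  (forall e, continuous (fun t => f (chart e t))) -> continuous f.
Proof.
move=> cf; apply/continuousP => A oA; apply/open_realizationP => e.
by have /continuousP/(_ A oA) := cf e.
Qed.

(* A tube lemma argument: the compactness of a segment makes the product of a
   quotient map with the real line a quotient map. *)
Lemma continuous_realizationM (Y : topologicalType) (F : X * R -> Y) :
  (forall v, continuous (fun s => F (Vtx v, s))) ->
  (forall e, continuous (fun p : R * R => F (chart e p.1, p.2))) ->
  continuous F.
Proof.
move=> cv ce [x s] W /=; rewrite nbhsE => -[W' [oW' W'F] sW].
have cx : continuous (fun s => F (x, s)).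
  elim/realization_ind: x {W'F} => [//|e t _].
  apply: (@continuous_o _ _ _ _ (fun s => (t, s)) (ce e)).
  by cont.
have : nbhs s [set s' | W' (F (x, s'))].
  by apply: (cx s); apply: open_nbhs_nbhs.
move=> /nbhs_closedballP[r rsub].
pose K := closed_ball s r%:num.
pose V := [set y | K `<=` [set s' | W' (F (y, s'))]].
have cK : compact K.
  exact: closed_ballR_compact.
have oV : open V.
  apply/open_realizationP => e; rewrite openE => t Vt.
  move/compact_near_coveringP: cK => /(_ R (nbhs t)
     (fun t' s' => W' (F (chart e t', s')))) /=; apply => s' Ks'.
  have : nbhs (t, s') [set p | W' (F (chart e p.1, p.2))].
    apply: (ce e (t, s')); apply: open_nbhs_nbhs; split=> //; exact: Vt.
  case=> -[A B] /= [At Bs'] AB; exists (B, A) => //= -[s1 t1] /= [Bs1 At1].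
  exact: (AB (t1, s1)).
have Vx : V x by exact: rsub.
exists (V, K) => /=.
  split; first exact: open_nbhs_nbhs.
  by apply/nbhs_closedballP; exists r.
move=> [y s'] /= [Vy Ks']; apply: sW; exact: Vy.
Qed.

Variables (Y : topologicalType) (vmap : vertex G -> Y) (p : edge G -> R -> Y).

Definition graph_fun (x : X) : Y :=
  match x with Vtx v => vmap v | Inn e u => p e (val u) end.

Hypothesis p_src : forall e, p e 0 = vmap (esrc e).
Hypothesis p_tgt : forall e, p e 1 = vmap (etgt e).

Lemma graph_fun_chart e t : graph_fun (chart e t) = p e (clamp t).
Proof.
have [t0|t0] := leP t 0; first by rewrite clamp_le0// chart_le0//= p_src.
have [t1|t1] := leP 1 t; first by rewrite clamp_ge1// chart_ge1//= p_tgt.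
have t01 : 0 < t < 1 by rewrite t0 t1.
by rewrite (chart_inn e t01) /= clamp_id// !ltW.
Qed.

Lemma continuous_graph_fun : (forall e, continuous (p e)) -> continuous graph_fun.
Proof.
move=> cp; apply: continuous_realization => e.
rewrite (_ : (fun _ => _) = (fun t => p e (clamp t))); last first.
  by apply/funext => t; rewrite graph_fun_chart.
by apply: (continuous_o (cp e)); apply: continuous_clamp; cont.
Qed.

End Realization.

(** * Homotopies and word paths *)

Lemma continuous_within_comp (S T U : topologicalType) (A : set T)
    (g : T -> U) (f : S -> T) :
  {within A, continuous g} -> continuous f -> (forall x, A (f x)) ->
  continuous (fun x => g (f x)).
Proof.
move=> /subspace_continuousP cg cf fA x W /(cg _ (fA x)) W'.
have := cf x _ W'; rewrite /nbhs /=; apply: filterS => y /=; apply.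
exact: fA.
Qed.

Section Homotopy.
Variables (R : realType).

Lemma continuous_gmap (T : topologicalType) (X Y : complex1) (f : gmap R X Y)
    (h : T -> realization R X) :
  continuous h -> continuous (fun x => f (h x) : realization R Y).
Proof.
move=> ch x; apply: (@continuous_comp _ _ _ h f); first exact: ch.
exact: cts_fun.
Qed.

(** Clamping the time extends a homotopy from [0, 1] to the whole line, so that continuity relative
    to a subspace is no longer needed. *)
Lemma homotopicP (X Y : complex1) (f g : gmap R X Y) :
  homotopic f g <-> exists F : realization R X * R -> realization R Y,
    [/\ continuous F, forall x, F (x, 0) = f x & forall x, F (x, 1) = g x].
Proof.
split=> [[F [cF F0 F1]]|[F [cF F0 F1]]].
  exists (fun p => F (p.1, clamp p.2)); split => [|x|x] /=.
  - apply: (continuous_within_comp (f := fun p => (p.1, clamp p.2)) cF).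
      apply: continuous_pair; first by cont.
      by apply: continuous_clamp; cont.
    by move=> p; split => //=; rewrite in_itv /= clamp01.
  - by rewrite clamp_le0.
  - by rewrite clamp_ge1.
by exists F; split => //; exact: continuous_subspaceT.
Qed.

Lemma eq_homotopic (X Y : complex1) (f g : gmap R X Y) : f =1 g -> homotopic f g.
Proof.
move=> fg; apply/homotopicP; exists (fun p => f p.1); split=> //.
by apply: continuous_gmap; cont.
Qed.

Lemma homotopic_sym (X Y : complex1) (f g : gmap R X Y) :
  homotopic f g -> homotopic g f.
Proof.
move=> /homotopicP[F [cF F0 F1]]; apply/homotopicP.
exists (fun p => F (p.1, 1 + - p.2)); split => [|x|x] /=.
- by apply: (continuous_o cF); cont.
- by rewrite subr0.
- by rewrite subrr.
Qed.

Lemma homotopic_trans (X Y : complex1) (g f h : gmap R X Y) :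
  homotopic f g -> homotopic g h -> homotopic f h.
Proof.
move=> /homotopicP[F [cF F0 F1]] /homotopicP[H [cH H0 H1]]; apply/homotopicP.
exists (fun p => if p.2 + - 2^-1 <= 0 then F (p.1, 2 * p.2)
                 else H (p.1, 2 * p.2 + - 1)); split => [|x|x] /=.
- apply: (@continuous_paste R (realization R X * R)%type (realization R Y)
     (fun p => F (p.1, 2 * p.2))
     (fun p => H (p.1, 2 * p.2 + - 1)) (fun p => p.2 + - 2^-1)); first by cont.
  + by apply: (continuous_o cF); cont.
  + by apply: (continuous_o cH); cont.
  + move=> p p2; have -> : p.2 = 2^-1 by lra.
    by rewrite divff// subrr F1 H0.
- by rewrite ifT ?mulr0 ?F0//; lra.
- rewrite ifF; last by apply/negbTE; lra.
  by rewrite mulr1 (_ : 2 + - 1 = 1) ?H1//; lra.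
Qed.

Lemma homotopic_comp (X Y Z : complex1) (f f' : gmap R X Y) (g g' : gmap R Y Z) :
  homotopic f f' -> homotopic g g' ->
  homotopic (g \o f : gmap R X Z) (g' \o f' : gmap R X Z).
Proof.
move=> /homotopicP[F [cF F0 F1]] /homotopicP[H [cH H0 H1]]; apply/homotopicP.
exists (fun p => H (F p, p.2)); split => [|x|x] /=.
- by apply: (continuous_o cH); cont.
- by rewrite F0 H0.
- by rewrite F1 H1.
Qed.

(** The tool for building all homotopies of graph maps: one family for each vertex and one for each
    edge, agreeing at the ends. Continuity rests on [continuous_realizationM]. *)
Lemma graph_homotopic (X Y : complex1) (f g : gmap R X Y)
    (Hv : vertex X -> R -> realization R Y)
    (He : edge X -> R * R -> realization R Y) :
  (forall v, continuous (Hv v)) -> (forall e, continuous (He e)) ->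
  (forall e s, 0 <= s <= 1 -> He e (0, s) = Hv (esrc e) s) ->
  (forall e s, 0 <= s <= 1 -> He e (1, s) = Hv (etgt e) s) ->
  (forall v, f (Vtx v) = Hv v 0) -> (forall v, g (Vtx v) = Hv v 1) ->
  (forall e t, 0 <= t <= 1 -> f (chart e t) = He e (t, 0)) ->
  (forall e t, 0 <= t <= 1 -> g (chart e t) = He e (t, 1)) ->
  homotopic f g.
Proof.
move=> cv ce Hs Ht fv gv fe ge; apply/homotopicP.
pose F (p : realization R X * R) := graph_fun (fun v => Hv v (clamp p.2))
  (fun e t => He e (t, clamp p.2)) p.1.
have Fchart e t s : F (chart e t, s) = He e (clamp t, clamp s).
  rewrite /F /= graph_fun_chart// => e'.
    by rewrite Hs// clamp01.
  by rewrite Ht// clamp01.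
exists F; split.
- apply: continuous_realizationM => [v|e].
    by apply: (continuous_o (cv v)); apply: continuous_clamp; cont.
  rewrite (_ : (fun _ => _) = (fun p => He e (clamp p.1, clamp p.2))); last first.
    by apply/funext => p; rewrite Fchart.
  apply: (continuous_o (ce e)).
  by apply: continuous_pair; apply: continuous_clamp; cont.
- elim/realization_ind => [v|e t /andP[t0 t1]].
    by rewrite /F /= clamp_le0// fv.
  by rewrite Fchart (@clamp_le0 _ 0)// clamp_id ?fe// !ltW.
- elim/realization_ind => [v|e t /andP[t0 t1]].
    by rewrite /F /= clamp_ge1// gv.
  by rewrite Fchart (@clamp_ge1 _ 1)// clamp_id ?ge// !ltW.
Qed.

End Homotopy.

Section WordPath.
Variables (R : realType) (Y : complex1).
Implicit Types (d : dart Y) (u v : seq (dart Y)) (x y z : vertex Y) (t : R).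

Lemma dchart_drev d t : dchart (drev d) t = dchart d (1 - t).
Proof. by rewrite /dchart /=; case: d.2 => //=; rewrite opprB addrC subrK. Qed.

Lemma dchart_le0 d t : t <= 0 -> dchart d t = Vtx (dsrc d).
Proof.
by rewrite /dchart /dsrc; case: d.2 => t0; [rewrite chart_ge1//; lra|rewrite chart_le0].
Qed.

Lemma dchart_ge1 d t : 1 <= t -> dchart d t = Vtx (dtgt d).
Proof.
by rewrite /dchart /dtgt; case: d.2 => t0; [rewrite chart_le0//; lra|rewrite chart_ge1].
Qed.

Lemma continuous_dchart (T : topologicalType) d (f : T -> R) :
  continuous f -> continuous (fun p => dchart d (f p)).
Proof.
by move=> cf; apply: (continuous_o (@continuous_chart R Y d.1)); case: d.2; cont.
Qed.

(** One unit of time per letter. Along a walk the path rests at its first vertex before time 0 and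
    at its last one after time [size u]; [x] only matters for the empty word. *)
Fixpoint wpath x u t : realization R Y :=
  if u is d :: u' then
    if t <= 1 then dchart d t else wpath (dtgt d) u' (t - 1)
  else Vtx x.

Fixpoint walk x u y : bool :=
  if u is d :: u' then (dsrc d == x) && walk (dtgt d) u' y else x == y.

Lemma walk_cat x u v z :
  walk x (u ++ v) z <-> exists2 y, walk x u y & walk y v z.
Proof.
elim: u x => [|d u IH] x /=; first by split=> [|[y /eqP <-]//]; exists x.
split=> [/andP[-> /IH[y h1 h2]]|[y /andP[-> h1] h2]]; first by exists y.
by apply/IH; exists y.
Qed.

Lemma walk_cat2 y x u v z : walk x u y -> walk y v z -> walk x (u ++ v) z.
Proof. by move=> h1 h2; apply/walk_cat; exists y. Qed.

Lemma wpath_le0 x u y t : walk x u y -> t <= 0 -> wpath x u t = Vtx x.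
Proof.
case: u => //= d u /andP[/eqP <- _] t0.
by rewrite (le_trans t0)// dchart_le0.
Qed.

Lemma wpath_ge x u y t : walk x u y -> (size u)%:R <= t -> wpath x u t = Vtx y.
Proof.
elim: u x t => [|d u IH] x t /=; first by move=> /eqP ->.
move=> /andP[_ w] ut; case: ifPn => t1.
  case: u w ut {IH} => [|a u]/= w ut; last first.
    by exfalso; move: ut t1; rewrite -!natr1; have := ler0n R (size u); lra.
  by rewrite dchart_ge1 ?(eqP w).
by apply: IH => //; rewrite -natr1 in ut; lra.
Qed.

Lemma continuous_wpath (T : topologicalType) x u y (f : T -> R) :
  walk x u y -> continuous f -> continuous (fun p => wpath x u (f p)).
Proof.
elim: u x f => [|d u IH] x f /=; first by move=> _ _; cont.
move=> /andP[_ w] cf.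
rewrite (_ : (fun _ => _) = (fun p => if f p + - 1 <= 0 then dchart d (f p)
    else wpath (dtgt d) u (f p - 1))); last first.
  by apply/funext => p; rewrite subr_le0.
apply: (@continuous_paste _ _ _ (fun p => dchart d (f p))
   (fun p => wpath (dtgt d) u (f p - 1))).
- by cont.
- exact: continuous_dchart.
- by apply: IH => //; cont.
- by move=> p fp; rewrite (wpath_le0 w) ?fp// dchart_ge1//; lra.
Qed.

Lemma wpath_cat x u y v z t : walk x u y -> walk y v z ->
  wpath x (u ++ v) t =
  if t <= (size u)%:R then wpath x u t else wpath y v (t - (size u)%:R).
Proof.
elim: u x t => [|d u IH] x t /=.
  move=> /eqP <- w; rewrite subr0; case: ifPn => // t0.
  exact: wpath_le0 w t0.
move=> /andP[_ w] w'; rewrite -natr1; case: ifPn => t1.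
  by rewrite ifT//; have := ler0n R (size u); lra.
rewrite IH// opprD addrA addrAC; congr (if _ then _ else _).
by rewrite lerBlDr.
Qed.

Definition winv u := [seq drev d | d <- rev u].

Lemma size_winv u : size (winv u) = size u.
Proof. by rewrite size_map size_rev. Qed.

Lemma winv_cons d u : winv (d :: u) = rcons (winv u) (drev d).
Proof. by rewrite /winv rev_cons map_rcons. Qed.

Lemma winv_rcons d u : winv (rcons u d) = drev d :: winv u.
Proof. by rewrite /winv rev_rcons. Qed.

Lemma winvK : involutive winv.
Proof.
by elim=> // d u IH; rewrite winv_cons winv_rcons IH drevK.
Qed.

Lemma walk_winv x u y : walk x u y -> walk y (winv u) x.
Proof.
elim: u x => [|d u IH] x /=; first by rewrite eq_sym.
move=> /andP[/eqP <- /IH w]; rewrite winv_cons -cats1.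
by apply: walk_cat2 w _; rewrite /= dsrc_drev dtgt_drev !eqxx.
Qed.

Lemma wpath_winv x u y t : walk x u y ->
  wpath y (winv u) t = wpath x u ((size u)%:R - t).
Proof.
elim: u x t => [|d u IH] x t /=; first by move=> /eqP ->.
move=> /andP[_ w]; rewrite winv_cons -cats1.
rewrite (wpath_cat (y := dtgt d) (z := dsrc d)); last first.
- by rewrite /= dsrc_drev dtgt_drev !eqxx.
- exact: walk_winv.
rewrite size_winv -natr1.
have [tu|tu] := leP t (size u)%:R.
  rewrite (IH _ _ w); case: ifPn => h; last by congr wpath; ring.
  rewrite dchart_ge1; last by lra.
  by rewrite (wpath_le0 w)//; lra.
rewrite ifT /=; last by lra.
case: ifPn => h.
  by rewrite dchart_drev; congr dchart; ring.
by rewrite [RHS]dchart_le0 ?dtgt_drev//; lra.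
Qed.

End WordPath.

(** * Maps running along words *)

Section Follows.
Variables (R : realType) (X Y : complex1).
Implicit Types (f g : gmap R X Y) (phi : vertex X -> vertex Y)
  (om : edge X -> seq (dart Y)).

Definition valid phi om := forall e, walk (phi (esrc e)) (om e) (phi (etgt e)).

Definition runs f phi om (rho : edge X -> R -> R) :=
  (forall v, f (Vtx v) = Vtx (phi v)) /\
  forall e t, 0 <= t <= 1 ->
    f (chart e t) = wpath (phi (esrc e)) (om e) (rho e t).

Definition clock om (rho : edge X -> R -> R) := forall e,
  [/\ continuous (rho e), rho e 0 <= 0 & (size (om e))%:R <= rho e 1].

(* The time change is only required to start before 0 and to end after the
   length of the word, which is harmless as wpath is constant there. *)
Definition follows f phi om := exists2 rho, clock om rho & runs f phi om rho.

Lemma runs_exists phi om rho : valid phi om -> clock om rho ->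
  exists f : gmap R X Y, runs f phi om rho.
Proof.
move=> w c.
pose p e t : realization R Y := wpath (phi (esrc e)) (om e) (rho e t).
have p0 e : p e 0 = Vtx (phi (esrc e)).
  by have [_ h _] := c e; rewrite /p (wpath_le0 (w e)).
have p1 e : p e 1 = Vtx (phi (etgt e)).
  by have [_ _ h] := c e; rewrite /p (wpath_ge (w e)).
have cp e : continuous (p e).
  by have [h _ _] := c e; exact: continuous_wpath (w e) h.
have cf := @continuous_graph_fun R X _ (fun v => Vtx (phi v)) p p0 p1 cp.
exists (mkcts cf : gmap R X Y); split=> // e t t01.
by apply: (etrans (graph_fun_chart p0 p1 e t)); rewrite clamp_id.
Qed.

(** The clocks are interpolated linearly, and the conditions on their end values are convex. *)
Lemma runs_homotopic f g phi om rho rho' : valid phi om ->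
  clock om rho -> clock om rho' ->
  runs f phi om rho -> runs g phi om rho' -> homotopic f g.
Proof.
move=> w c c' [fv fe] [gv ge].
pose sg e (p : R * R) := (1 + - p.2) * rho e p.1 + p.2 * rho' e p.1.
apply: (@graph_homotopic _ _ _ f g (fun v _ => Vtx (phi v))
  (fun e p => wpath (phi (esrc e)) (om e) (sg e p))) => //.
- by move=> v; cont.
- move=> e; apply: continuous_wpath (w e) _.
  have [h _ _] := c e; have [h' _ _] := c' e; rewrite /sg; cont.
    by apply: (continuous_o h); cont.
  by apply: (continuous_o h'); cont.
- move=> e s /andP[s0 s1]; rewrite (wpath_le0 (w e))// /sg /=.
  by have [_ h _] := c e; have [_ h' _] := c' e; nra.
- move=> e s /andP[s0 s1]; rewrite (wpath_ge (w e))// /sg /=.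
  by have [_ _ h] := c e; have [_ _ h'] := c' e; nra.
- by move=> e t t01; rewrite fe// /sg /= subr0 mul1r mul0r addr0.
- by move=> e t t01; rewrite ge// /sg /= subrr mul1r mul0r add0r.
Qed.

Lemma follows_homotopic f g phi om : valid phi om ->
  follows f phi om -> follows g phi om -> homotopic f g.
Proof.
by move=> w [rho c r] [rho' c' r']; exact: runs_homotopic w c c' r r'.
Qed.

Definition unit_clock om e t : R := (size (om e))%:R * t.

Lemma unit_clockP om : clock om (unit_clock om).
Proof.
by move=> e; rewrite /unit_clock; split; rewrite ?mulr0 ?mulr1//; cont.
Qed.

End Follows.

(** * Elementary homotopies: cancelling a backtrack, moving a vertex *)

Section Backtrack.
Variables (R : realType) (Y : complex1).
Implicit Types (d : dart Y) (a b u : seq (dart Y)) (x y : vertex Y).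

Definition cancel u u' :=
  exists a d b, u = a ++ d :: drev d :: b /\ u' = a ++ b.

Lemma walk_cancel x y u u' : cancel u u' -> walk x u y -> walk x u' y.
Proof.
move=> [a [d [b [-> ->]]]] /walk_cat[z w1 /= /and3P[/eqP dz _ w2]].
apply: walk_cat2 w1 _.
by rewrite dtgt_drev in w2; rewrite -dz.
Qed.

(* The tent formed by the two cancelling darts is pushed down linearly. *)
Lemma cancel_homotopy x y u u' : cancel u u' -> walk x u y ->
  exists (H : R * R -> realization R Y) (sg : R -> R),
  [/\ continuous H, continuous sg,
      (forall t, H (t, 0) = wpath x u t),
      (forall t, H (t, 1) = wpath x u' (sg t)) &
      [/\ forall t s, t <= 0 -> H (t, s) = Vtx x,
          forall t s, (size u)%:R <= t -> H (t, s) = Vtx y,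
          forall t, t <= 0 -> sg t <= 0 &
          forall t, (size u)%:R <= t -> (size u')%:R <= sg t]].
Proof.
move=> [a [d [b [ua ub]]]] w; have w0 := w.
rewrite ua in w0; have /walk_cat[z w1 w2] := w0; have /= /and3P[/eqP dz _ w3] := w2.
rewrite dtgt_drev dz in w3.
have wu' : walk x u' y by rewrite ub; exact: walk_cat2 w1 w3.
pose n : R := (size a)%:R; pose m : R := (size b)%:R.
have n0 : 0 <= n by exact: ler0n.
have m0 : 0 <= m by exact: ler0n.
have su : (size u)%:R = n + m + 2 :> R.
  by rewrite ua size_cat /= !addnS -!natr1 natrD; ring.
have su' : (size u')%:R = n + m :> R by rewrite ub size_cat natrD.
pose tent (p : R * R) := (1 + - p.2) * (1 + - `|p.1 + - n + - 1|).
pose H (p : R * R) : realization R Y :=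
  if p.1 + - n <= 0 then wpath x a p.1 else
  if p.1 + - n + - 2 <= 0 then dchart d (tent p) else wpath z b (p.1 + - n + - 2).
(* The clock of the shortened word stands still at [n] for the two units of the tent and runs two
   units late afterwards. *)
pose sg (t : R) := Num.min t n + Num.max 0 (t + - n + - 2).
have Hb (p : R * R) : p.1 + - n + - 2 = 0 -> dchart d (tent p) = wpath z b (p.1 + - n + - 2).
  move=> p0; rewrite (wpath_le0 w3) ?p0// dchart_le0 ?dz// /tent.
  have -> : p.1 + - n + - 1 = 1 by lra.
  by rewrite normr1 subrr mulr0.
have Ha (p : R * R) : p.1 + - n = 0 -> wpath x a p.1 =
  if p.1 + - n + - 2 <= 0 then dchart d (tent p) else wpath z b (p.1 + - n + - 2).
  move=> p0; rewrite (wpath_ge w1); last by rewrite -/n; lra.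
  rewrite ifT; last by lra.
  rewrite dchart_le0 ?dz// /tent p0 add0r normrN normr1 subrr mulr0//.
exists H, sg; split; last split.
- rewrite /H; apply: (@continuous_paste R (R * R)%type (realization R Y)
    (fun p => wpath x a p.1)
    (fun p => if p.1 + - n + - 2 <= 0 then dchart d (tent p)
              else wpath z b (p.1 + - n + - 2))
    (fun p => p.1 + - n)) => //.
  + by cont.
  + by apply: continuous_wpath w1 _; cont.
  + apply: (@continuous_paste R (R * R)%type (realization R Y)
      (fun p => dchart d (tent p)) (fun p => wpath z b (p.1 + - n + - 2))
      (fun p => p.1 + - n + - 2)) => //.
    * by cont.
    * by apply: continuous_dchart; rewrite /tent; cont.
    * by apply: continuous_wpath w3 _; cont.
- by rewrite /sg; cont.
- move=> t; rewrite ua (wpath_cat _ w1 w2) -/n /H /= subr_le0.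
  case: ifPn => // tn; rewrite /tent /= subr0 mul1r.
  case: (leP (t - n) 1) => t1.
    rewrite ifT; last by lra.
    by rewrite ler0_norm; [congr dchart; ring|lra].
  have [t2|t2] := leP (t - n - 2) 0.
    rewrite ifT; last by lra.
    rewrite dchart_drev ger0_norm; last by lra.
    by congr dchart; ring.
  rewrite ifF; last by apply/negbTE; rewrite -ltNge; lra.
  by rewrite dtgt_drev dz; congr wpath; ring.
- move=> t; rewrite ub (wpath_cat _ w1 w3) -/n /H /= /sg subr_le0.
  have [tn|tn] := leP t n.
    rewrite (max_idPl _); last by lra.
    by rewrite addr0 tn.
  have [t2|t2] := leP (t - n - 2) 0.
    rewrite addr0 lexx /tent subrr mul0r dchart_le0// (wpath_ge w1) ?dz//.
  rewrite ifF; last by apply/negbTE; rewrite -ltNge; lra.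
  by congr wpath; ring.
- move=> t s t0; rewrite /H /= ifT; last by lra.
  exact: wpath_le0 w1 t0.
- move=> t s; rewrite su => tu; rewrite /H /=.
  rewrite ifF; last by apply/negbTE; rewrite -ltNge; lra.
  have [t2|t2] := leP (t - n - 2) 0; last by rewrite (wpath_ge w3)// -/m; lra.
  have m00 : m = 0 by lra.
  have /= := Hb (t, s); rewrite /H /= => ->; last by lra.
  by rewrite (wpath_ge w3)// -/m; lra.
- move=> t t0; rewrite /sg min_l; last by lra.
  by rewrite max_l; lra.
- move=> t; rewrite su su' => tu; rewrite /sg min_r; last by lra.
  by rewrite max_r; lra.
Qed.

End Backtrack.

Section Moves.
Variables (R : realType) (X Y : complex1).
Implicit Types (f g : gmap R X Y) (phi : vertex X -> vertex Y)
  (om : edge X -> seq (dart Y)).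

Lemma follows_cancel f phi om om' : valid phi om ->
  (forall e, om' e = om e \/ cancel (om e) (om' e)) -> follows f phi om ->
  exists g, homotopic f g /\ follows g phi om'.
Proof.
move=> w h [rho c [fv fe]].
have w' : valid phi om'.
  by move=> e; case: (h e) => [->//|cc]; exact: walk_cancel cc (w e).
have /choice[HS HSP] : forall e, exists HS : (R * R -> realization R Y) * (R -> R),
  [/\ continuous HS.1, continuous HS.2,
      (forall t, HS.1 (t, 0) = wpath (phi (esrc e)) (om e) t),
      (forall t, HS.1 (t, 1) = wpath (phi (esrc e)) (om' e) (HS.2 t)) &
      [/\ forall t s, t <= 0 -> HS.1 (t, s) = Vtx (phi (esrc e)),
          forall t s, (size (om e))%:R <= t -> HS.1 (t, s) = Vtx (phi (etgt e)),
          forall t, t <= 0 -> HS.2 t <= 0 &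
          forall t, (size (om e))%:R <= t -> (size (om' e))%:R <= HS.2 t]].
  move=> e; case: (h e) => [->|cc].
    exists (fun p => wpath (phi (esrc e)) (om e) p.1, id); split => //=.
    - by apply: continuous_wpath (w e) _; cont.
    - by cont.
    - split=> // t s ts; first by rewrite (wpath_le0 (w e)).
      by rewrite (wpath_ge (w e)).
  by have [H [sg ?]] := cancel_homotopy R cc (w e); exists (H, sg).
have c' : clock om' (fun e t => (HS e).2 (rho e t)).
  move=> e; have [h1 h2 _ _ [_ _ h3 h4]] := HSP e; have [r1 r2 r3] := c e.
  by split; [exact: continuous_o h2 r1 | exact: h3 | exact: h4].
have [g [gv ge]] := runs_exists w' c'.
exists g; split; last by exists (fun e t => (HS e).2 (rho e t)).
apply: (@graph_homotopic _ _ _ f g (fun v _ => Vtx (phi v))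
  (fun e p => (HS e).1 (rho e p.1, p.2))) => //.
- by move=> v; cont.
- move=> e; have [h1 _ _ _ _] := HSP e; have [r1 _ _] := c e.
  apply: (continuous_o h1); cont.
  by apply: (continuous_o r1); cont.
- by move=> e s _ /=; have [_ _ _ _ [-> //]] := HSP e; have [] := c e.
- by move=> e s _ /=; have [_ _ _ _ [_ -> //]] := HSP e; have [] := c e.
- by move=> e t t01 /=; have [_ _ -> _ _] := HSP e; rewrite fe.
- by move=> e t t01 /=; have [_ _ _ -> _] := HSP e; rewrite ge.
Qed.

(** When the image of [v] moves along [d], an edge leaving [v] first has to come back along [drev d]
    and an edge arriving at [v] continues along [d]. A self-loop at [v] receives both letters. *)
Definition pre (v : vertex X) (d : dart Y) (e : edge X) :=
  if esrc e == v then [:: drev d] else [::].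
Definition post (v : vertex X) (d : dart Y) (e : edge X) :=
  if etgt e == v then [:: d] else [::].

Lemma walk_move phi om v d e : valid phi om -> dsrc d = phi v ->
  walk ([eta phi with v |-> dtgt d] (esrc e)) (pre v d e ++ om e ++ post v d e)
       ([eta phi with v |-> dtgt d] (etgt e)).
Proof.
move=> w dv; rewrite /pre /post /=.
apply: (@walk_cat2 _ (phi (esrc e))).
  by case: eqP => [->|] /=; rewrite ?dsrc_drev ?dtgt_drev ?dv ?eqxx.
apply: walk_cat2 (w e) _.
by case: eqP => [->|] /=; rewrite ?dv ?eqxx.
Qed.

(** At stage s the image of [v] is the point [dchart d s], and each end of an edge at [v] is
    prolonged by the part of [d] covered so far. *)
Lemma follows_move f phi om v d : valid phi om -> dsrc d = phi v ->
  follows f phi om ->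
  exists g, homotopic f g /\ follows g [eta phi with v |-> dtgt d]
     (fun e => pre v d e ++ om e ++ post v d e).
Proof.
move=> w dv ff; pose n e : R := (size (om e))%:R.
have n0 e : 0 <= n e by exact: ler0n.
(* This clock runs from -1 to n + 1, which leaves one spare unit at each end for the legs along
   [d]. *)
pose rho e t : R := (n e + 2) * t + - 1.
have c : clock om rho by move=> e; rewrite /rho; split; [cont| |rewrite -/(n e)]; lra.
have [f1 r1] := runs_exists w c.
have ff1 : homotopic f f1.
  by apply: follows_homotopic w ff _; exists rho.
set phi' := [eta phi with v |-> dtgt d].
set om' := fun e => pre v d e ++ om e ++ post v d e.
have w' : valid phi' om' by move=> e; exact: walk_move.
pose k e : R := (size (pre v d e))%:R.
have kE e : k e = (esrc e == v)%:R by rewrite /k /pre; case: eqP.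
have k'E e : (size (post v d e))%:R = (etgt e == v)%:R :> R by rewrite /post; case: eqP.
have n'E e : (size (om' e))%:R = k e + n e + (etgt e == v)%:R.
  by rewrite /om' !size_cat !natrD k'E addrA.
(* Shifts by the number of prefixed letters. Where none is prefixed, the spare unit is spent at
   rest. *)
pose rho' e t : R := rho e t + k e.
have c' : clock om' rho'.
  move=> e; rewrite /rho' /rho n'E kE; split; first by cont.
    by case: (esrc e == v) => /=; lra.
  by case: (etgt e == v) => /=; lra.
have [g r'] := runs_exists w' c'.
exists g; split; last by exists rho'.
apply: homotopic_trans ff1 _.
have [f1v f1e] := r1; have [gv ge] := r'.
pose Hv u (s : R) : realization R Y :=
  if u == v then dchart d s else Vtx (phi u).
pose pre_leg e (p : R * R) : realization R Y :=
  if esrc e == v then dchart d (p.2 * clamp (- p.1)) else Vtx (phi (esrc e)).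
pose post_leg e (p : R * R) : realization R Y :=
  if etgt e == v then dchart d (p.2 * clamp (p.1 + - n e)) else Vtx (phi (etgt e)).
pose H e (p : R * R) : realization R Y :=
  if p.1 <= 0 then pre_leg e p else
  if p.1 + - n e <= 0 then wpath (phi (esrc e)) (om e) p.1 else post_leg e p.
have pre0 e (p : R * R) : 0 <= p.1 -> pre_leg e p = Vtx (phi (esrc e)).
  move=> p0; rewrite /pre_leg; case: eqP => // ->.
  by rewrite clamp_le0 ?mulr0 ?dchart_le0 ?dv//; lra.
have post0 e (p : R * R) : p.1 <= n e -> post_leg e p = Vtx (phi (etgt e)).
  move=> p0; rewrite /post_leg; case: eqP => // ->.
  by rewrite clamp_le0 ?mulr0 ?dchart_le0 ?dv//; lra.
have H2 e (p : R * R) : p.1 + - n e = 0 ->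
    wpath (phi (esrc e)) (om e) p.1 = post_leg e p.
  move=> p0; rewrite post0 ?(wpath_ge (w e))// -/(n e); lra.
have cH e : continuous (H e).
  rewrite /H; apply: (@continuous_paste R (R * R)%type (realization R Y)
    (pre_leg e) (fun p => if p.1 + - n e <= 0 then wpath (phi (esrc e)) (om e) p.1
        else post_leg e p) (fun p => p.1)).
  - by cont.
  - rewrite /pre_leg; case: eqP => _; last by cont.
    by apply: continuous_dchart; cont; apply: continuous_clamp; cont.
  - apply: (@continuous_paste R (R * R)%type (realization R Y)
      (fun p => wpath (phi (esrc e)) (om e) p.1) (post_leg e)
      (fun p => p.1 + - n e)) => //.
    + by cont.
    + by apply: continuous_wpath (w e) _; cont.
    + rewrite /post_leg; case: eqP => _; last by cont.
      by apply: continuous_dchart; cont; apply: continuous_clamp; cont.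
    + exact: H2.
  - move=> p p0; rewrite pre0 ?p0//.
    case: ifPn => h; first by rewrite (wpath_le0 (w e)).
    by exfalso; have := n0 e; lra.
apply: (@graph_homotopic _ _ _ f1 g Hv (fun e p => H e (rho e p.1, p.2))).
- by move=> u; rewrite /Hv; case: eqP => _; [apply: continuous_dchart|]; cont.
- by move=> e; apply: (continuous_o (cH e)); rewrite /rho; cont.
- move=> e s _; rewrite /H /rho /= mulr0 add0r ifT; last by lra.
  by rewrite /pre_leg /Hv /= clamp_ge1 ?mulr1//; lra.
- move=> e s _; rewrite /H /rho /= mulr1.
  rewrite ifF; last by apply/negbTE; rewrite -ltNge; have := n0 e; lra.
  rewrite ifF; last by apply/negbTE; rewrite -ltNge; lra.
  by rewrite /post_leg /Hv /= clamp_ge1 ?mulr1//; lra.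
- move=> u; rewrite f1v /Hv; case: eqP => // ->.
  by rewrite dchart_le0 ?dv.
- move=> u; rewrite gv /Hv /phi' /=; case: eqP => // _.
  by rewrite dchart_ge1.
- move=> e t t01; rewrite f1e//= /H /=.
  have [t0|t0] := leP (rho e t) 0.
    rewrite (wpath_le0 (w e))// /pre_leg /=; case: eqP => // ->.
    by rewrite mul0r dchart_le0 ?dv.
  case: ifPn => // t1; rewrite (wpath_ge (w e)); last by rewrite -/(n e); lra.
  by rewrite /post_leg /=; case: eqP => // ->; rewrite mul0r dchart_le0 ?dv.
- move=> e t t01; rewrite ge//= /om'.
  have rho_ge : -1 <= rho e t.
    by rewrite /rho; have := n0 e; case/andP: t01; nra.
  have wpre : walk (phi' (esrc e)) (pre v d e) (phi (esrc e)).
    rewrite /pre /phi' /=; case: eqP => [->|] /=;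
    by rewrite ?dsrc_drev ?dtgt_drev ?dv ?eqxx.
  have wpost : walk (phi (etgt e)) (post v d e) (phi' (etgt e)).
    by rewrite /post /phi' /=; case: eqP => [->|] /=; rewrite ?dv ?eqxx.
  rewrite (wpath_cat _ wpre (walk_cat2 (w e) wpost)) -/(k e) /rho' gerDr.
  rewrite addrK (wpath_cat _ (w e) wpost) /H /= -/(n e) (subr_le0 (n e)).
  case: ifPn => h.
    rewrite /pre /k /phi' /pre_leg /pre /=; case: eqP => //= _.
    rewrite mul1r; case: ifPn => h1.
      rewrite dchart_drev clamp_id; first by congr dchart; ring.
      by apply/andP; split; lra.
    rewrite dtgt_drev clamp_le0; last by lra.
    by rewrite dchart_le0.
  case: ifPn => h1 //.
  rewrite /post /post_leg /=; case: eqP => //= _; rewrite mul1r.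
  case: ifPn => h2; first by rewrite clamp_id//; apply/andP; split; lra.
  by rewrite clamp_ge1 ?dchart_ge1//; lra.
Qed.

End Moves.

(** * Images of words under maps running along words *)

Section WordImage.
Variables (Y Z : complex1) (psi : vertex Y -> vertex Z)
  (chi : edge Y -> seq (dart Z)).

Definition dimage (d : dart Y) := if d.2 then winv (chi d.1) else chi d.1.
Definition wimage (u : seq (dart Y)) := flatten [seq dimage d | d <- u].

Lemma dimage_drev d : dimage (drev d) = winv (dimage d).
Proof. by rewrite /dimage /=; case: d.2 => //=; rewrite winvK. Qed.

Lemma size_dimage d : size (dimage d) = size (chi d.1).
Proof. by rewrite /dimage; case: d.2; rewrite ?size_winv. Qed.

Hypothesis w : valid psi chi.

Lemma walk_dimage d : walk (psi (dsrc d)) (dimage d) (psi (dtgt d)).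
Proof.
by rewrite /dimage /dsrc /dtgt; case: d.2; [apply: walk_winv|]; exact: w.
Qed.

Lemma walk_wimage x u y : walk x u y -> walk (psi x) (wimage u) (psi y).
Proof.
elim: u x => [|d u IH] x /=; first by move=> /eqP ->.
move=> /andP[/eqP <- /IH]; rewrite /wimage /=.
exact: walk_cat2 (walk_dimage d).
Qed.

Variable R : realType.
Variables (g : gmap R Y Z) (rho : edge Y -> R -> R).
Hypotheses (c : clock chi rho) (r : runs g psi chi rho).

Lemma wpath_clip x u y (t : R) : walk x u y ->
  wpath x u (Num.max 0 (Num.min (size u)%:R t)) = wpath x u t :> realization R Z.
Proof.
move=> wu; have [t0|t0] := leP t 0.
  by rewrite (wpath_le0 wu t0) max_l ?(wpath_le0 wu)// ge_min t0 orbT.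
have [tu|tu] := leP (size u)%:R t.
  by rewrite max_r ?ler0n// (wpath_ge wu)// (wpath_ge wu).
by rewrite max_r// ltW.
Qed.

(** Clocks may overshoot the word; clipping them to its length, which by [wpath_clip] does not
    change the path, lets the pieces be concatenated. For a reversed dart the clock is read
    backwards. *)
Lemma run_dimage d : exists sg : R -> R,
  [/\ continuous sg, forall t, t <= 0 -> sg t = 0,
      forall t, 1 <= t -> sg t = (size (dimage d))%:R,
      forall t, 0 <= sg t <= (size (dimage d))%:R &
      forall t, g (dchart d t) = wpath (psi (dsrc d)) (dimage d) (sg t)].
Proof.
set n : R := (size (dimage d))%:R; have n0 : 0 <= n by exact: ler0n.
have [cr r0 r1] := c d.1; have [_ ge] := r.
have nE : (size (chi d.1))%:R = n by rewrite /n size_dimage.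
rewrite nE in r1.
pose s t := if d.2 then n + - rho d.1 (1 + - clamp t) else rho d.1 (clamp t).
have cs : continuous s.
  have cc (T : topologicalType) (f : T -> R) : continuous f ->
    continuous (fun x => rho d.1 (f x)) by exact: continuous_o.
  have ccl := @continuous_clamp R R _ (@continuous_var R).
  rewrite /s; case: d.2; last exact: cc.
  apply: continuous_add; first exact: continuous_cst.
  apply/continuous_opp/cc; apply: continuous_add; first exact: continuous_cst.
  exact: continuous_opp.
exists (fun t => Num.max 0 (Num.min n (s t))); split.
- by cont.
- move=> t t0; rewrite /s clamp_le0// subr0 max_l// ge_min.
  by apply/orP; right; case: d.2 => //; lra.
- move=> t t1; rewrite /s clamp_ge1// subrr min_l ?max_r//.
  by case: d.2 => //; lra.
- by move=> t; rewrite le_max lexx /= ge_max n0 ge_min lexx.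
- move=> t; rewrite (wpath_clip _ (walk_dimage d)).
  have -> : dchart d t = dchart d (clamp t) :> realization R Y.
    have [t0|t0] := leP t 0; first by rewrite clamp_le0// !dchart_le0.
    have [t1|t1] := leP 1 t; first by rewrite clamp_ge1// !dchart_ge1.
    by rewrite clamp_id// !ltW.
  have /andP[c0 c1] := clamp01 t.
  rewrite /dchart /s /dimage /dsrc; case: d.2; last by rewrite ge// c0 c1.
  rewrite ge; last by apply/andP; split; lra.
  rewrite (wpath_winv _ (w d.1)) nE; congr wpath; ring.
Qed.

Lemma run_wimage x u y : walk x u y -> exists sg : R -> R,
  [/\ continuous sg, forall t, t <= 0 -> sg t = 0,
      forall t, (size u)%:R <= t -> sg t = (size (wimage u))%:R,
      forall t, 0 <= sg t <= (size (wimage u))%:R &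
      forall t, g (wpath x u t) = wpath (psi x) (wimage u) (sg t)].
Proof.
elim: u x => [|d u IH] x /=.
  move=> _; exists (fun=> 0); split=> //; first by cont.
    by move=> t; rewrite lexx.
  by have [gv _] := r; move=> t; rewrite gv.
move=> /andP[/eqP dx wu]; have [s [cs s0 s1 sb sg]] := IH _ wu.
have [sd [cd d0 d1 db dg]] := run_dimage d.
set n : R := (size (dimage d))%:R; have n0 : 0 <= n by exact: ler0n.
have szE : (size (wimage (d :: u)))%:R = n + (size (wimage u))%:R :> R.
  by rewrite /wimage /= size_cat natrD.
exists (fun t => if t + - 1 <= 0 then sd t else n + s (t + - 1)); split.
- apply: (@continuous_paste R R R sd (fun t => n + s (t + - 1)) (fun t => t + - 1)) => //.
  + by cont.
  + by cont; apply: (continuous_o cs); cont.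
  + by move=> t t0; rewrite t0 s0// addr0 d1//; lra.
- by move=> t t0; rewrite ifT ?d0//; lra.
- move=> t; rewrite -natr1 => ut; rewrite szE; case: ifPn => t1; last first.
    by rewrite s1//; lra.
  have u0 := ler0n R (size u).
  have u00 : (size u)%:R <= 0 :> R by lra.
  have w0 : (size (wimage u))%:R = 0 :> R by rewrite -(s1 0 u00) s0.
  by rewrite w0 addr0 d1//; lra.
- move=> t; rewrite szE; have m0 := ler0n R (size (wimage u)).
  have /andP[h1 h2] := sb (t + - 1); have /andP[h3 h4] := db t.
  rewrite -/n in h4; case: ifPn => _; apply/andP; split; lra.
- move=> t; rewrite -[wimage (d :: u)]/(dimage d ++ wimage u).
  have w1 : walk (psi x) (dimage d) (psi (dtgt d)) by rewrite -dx; exact: walk_dimage.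
  rewrite (wpath_cat _ w1 (walk_wimage wu)) -/n subr_le0.
  case: ifPn => t1.
    have /andP[_ h] := db t; rewrite -/n in h.
    by rewrite dg dx h.
  rewrite sg; have /andP[h _] := sb (t - 1).
  case: ifPn => h'.
    have s00 : s (t - 1) = 0 by lra.
    rewrite s00 addr0 (wpath_le0 (walk_wimage wu))//.
    by rewrite (wpath_ge w1).
  by congr wpath; ring.
Qed.

End WordImage.

Lemma follows_comp (R : realType) (X Y Z : complex1) (f : gmap R X Y)
    (g : gmap R Y Z) phi om psi chi :
  valid phi om -> valid psi chi -> follows f phi om -> follows g psi chi ->
  follows (g \o f : gmap R X Z) (psi \o phi) (fun e => wimage chi (om e)).
Proof.
move=> wo wc [rho c [fv fe]] [rho' c' r'].
have /choice[sg sgP] e := run_wimage wc c' r' (wo e).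
exists (fun e t => sg e (rho e t)).
  move=> e; have [h1 h2 h3 _ _] := sgP e; have [r1 r2 r3] := c e.
  by split; [exact: continuous_o h1 r1 | rewrite h2 | rewrite h3].
split=> [v|e t t01] /=.
  by have [gv _] := r'; rewrite fv gv.
by rewrite fe//; have [_ _ _ _ ->] := sgP e.
Qed.

(** * Cellular approximation *)

(** The Lebesgue number lemma on [0, 1], for a property of intervals that is inherited by
    subintervals. *)
Lemma segment_lebesgue (R : realType) (Q : R -> R -> Prop) :
  (forall a b a' b', a <= a' -> b' <= b -> Q a b -> Q a' b') ->
  (forall t : R, 0 <= t <= 1 -> exists2 r : R, 0 < r & Q (t - r) (t + r)) ->
  exists N : nat, forall t, 0 <= t <= 1 -> Q (t - N.+1%:R^-1) (t + N.+1%:R^-1).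
Proof.
move=> mono loc; have := @segment_compact R 0 1.
move=> /compact_near_coveringP/(_ _ \oo
  (fun (n : nat) t => Q (t - n.+1%:R^-1) (t + n.+1%:R^-1))) /=.
move=> /(_ _)[|N _ h].
  move=> t; rewrite /= in_itv /= => /loc[r r0 Qr].
  have r20 : 0 < r / 2 by rewrite divr_gt0.
  exists (ball t (r / 2), [set n : nat | n.+1%:R^-1 < r / 2]) => /=.
    by split; [exact: nbhsx_ballx | exact: (near_infty_natSinv_lt (PosNum r20))].
  move=> [t' n] /= [tt' nr]; rewrite /ball /= in tt'.
  move: tt'; rewrite ltr_distlC => /andP[h1 h2]. move: nr.
  by set x := n.+1%:R^-1 => nr; apply: mono Qr; lra.
by exists N => t t01; apply: (h N) => //=; rewrite in_itv.
Qed.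

Section Collapse.
Variables (R : realType) (Y : complex1).
Local Notation "|Y|" := (realization R Y).
Implicit Types (e : edge Y) (v : vertex Y) (t : R).

(** Collapses the outer thirds of an edge and stretches the middle third over all of it. The
    resulting map [collapse] is homotopic to the identity and constant near each vertex, so after it
    a short piece of a path is constant at a vertex or stays in one closed edge. *)
Definition squeeze t := clamp (3 * t + - 1).

Definition in_edge e (x : |Y|) := if x is Inn e' _ then e' = e else False.
Definition param (x : |Y|) : R := if x is Inn _ u then val u else 0.

Lemma collapse_exists : exists k : gmap R Y Y,
  (forall v, k (Vtx v) = Vtx v) /\
  forall e t, 0 <= t <= 1 -> k (chart e t) = chart e (squeeze t).
Proof.
pose p e t : |Y| := chart e (squeeze t).
have p0 e : p e 0 = Vtx (esrc e).
  by rewrite /p /squeeze clamp_le0 ?chart_le0//; lra.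
have p1 e : p e 1 = Vtx (etgt e).
  by rewrite /p /squeeze clamp_ge1 ?chart_ge1//; lra.
have cp e : continuous (p e).
  apply: (continuous_o (@continuous_chart R Y e)).
  by apply: continuous_clamp; cont.
have ck := @continuous_graph_fun R Y _ (fun v => Vtx v) p p0 p1 cp.
exists (mkcts ck : gmap R Y Y); split=> // e t t01.
by apply: (etrans (graph_fun_chart p0 p1 e t)); rewrite clamp_id.
Qed.

Definition collapse : gmap R Y Y := projT1 (cid collapse_exists).

Lemma collapse_vtx v : collapse (Vtx v) = Vtx v.
Proof. exact: (projT2 (cid collapse_exists)).1. Qed.

Lemma collapse_chart e t : 0 <= t <= 1 ->
  collapse (chart e t) = chart e (squeeze t).
Proof. exact: (projT2 (cid collapse_exists)).2. Qed.

Lemma homotopic_collapse (X : complex1) (f : gmap R X Y) :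
  homotopic f (collapse \o f : gmap R X Y).
Proof.
have hk : homotopic (idfun : gmap R Y Y) collapse.
  apply: (@graph_homotopic _ _ _ (idfun : gmap R Y Y) collapse (fun v _ => Vtx v)
    (fun e p => chart e ((1 + - p.2) * p.1 + p.2 * squeeze p.1))) => //.
  - by move=> v; cont.
  - move=> e; apply: (continuous_o (@continuous_chart R Y e)); rewrite /squeeze.
    by cont; apply: continuous_clamp; cont.
  - move=> e s _ /=; rewrite mulr0 add0r /squeeze clamp_le0 ?mulr0 ?chart_le0//.
  - move=> e s _ /=; rewrite mulr1 /squeeze clamp_ge1 ?mulr1 ?chart_ge1//; lra.
  - by move=> v; rewrite collapse_vtx.
  - by move=> e t _ /=; rewrite subr0 mul1r mul0r addr0.
  - by move=> e t t01 /=; rewrite subrr mul1r mul0r add0r collapse_chart.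
apply: (@homotopic_trans _ _ _ (idfun \o f : gmap R X Y)).
  exact: eq_homotopic.
apply: homotopic_comp hk.
exact: eq_homotopic.
Qed.

Lemma in_edge_chart e x : in_edge e x -> x = chart e (param x) /\ 0 < param x < 1.
Proof.
case: x => //= e' u ->; split; last by case: u.
exact: Inn_chart.
Qed.

Lemma open_in_edge e (O : set R) : open O ->
  open [set x : |Y| | in_edge e x /\ O (param x)].
Proof.
move=> oO; apply/open_realizationP => e'.
have [->|ee] := eqVneq e' e; last first.
  rewrite (_ : _ @^-1` _ = set0); first exact: open0.
  apply/seteqP; split=> // t /=; rewrite /chart.
  case: insubP => [u _ _ /=|_]; last by case: ifP => _ [].
  by case=> /eqP; rewrite (negPf ee).
rewrite (_ : _ @^-1` _ = `]0, 1[%classic `&` O); last first.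
  apply/seteqP; split=> t /=; rewrite in_itv /chart /=.
    case: insubP => [u u01 ut /=|_]; first by rewrite ut => -[_ Ou]; split.
    by case: ifP => _ [].
  by move=> [t01 Ot]; rewrite (insubT (fun t => 0 < t < 1) t01).
by apply: openI => //; exact: interval_open.
Qed.

Lemma continuous_param (T : topologicalType) e (h : T -> |Y|) :
  continuous h -> (forall p, in_edge e (h p)) -> continuous (fun p => param (h p)).
Proof.
move=> ch he; apply/continuousP => O oO; have {}oO := @open_in_edge e O oO.
rewrite (_ : _ @^-1` _ = h @^-1` [set x | in_edge e x /\ O (param x)]).
  by move/continuousP: ch; apply.
by apply/seteqP; split=> p /=; [split | case].
Qed.

Lemma collapse_star v :
  nbhs (Vtx v : |Y|) [set x | collapse x = Vtx v].
Proof.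
rewrite nbhsE; exists [set x : |Y| | match x with Vtx v' => v' = v
  | Inn e u => (val u < 3^-1 /\ esrc e = v) \/ (2 / 3 < val u /\ etgt e = v) end].
  split=> //; apply/open_realizationP => e.
  rewrite (_ : _ @^-1` _ = [set t | t < 3^-1 /\ esrc e = v] `|`
                           [set t | 2 / 3 < t /\ etgt e = v]).
    apply: openU.
      have [ev|ev] := pselect (esrc e = v).
        rewrite (_ : [set _ | _] = [set t | t < 3^-1]); first exact: open_lt.
        by apply/seteqP; split=> t /=; [case | split].
      rewrite (_ : [set _ | _] = set0); first exact: open0.
      by apply/seteqP; split=> t //= [].
    have [ev|ev] := pselect (etgt e = v).
      rewrite (_ : [set _ | _] = [set t | 2 / 3 < t]); first exact: open_gt.
      by apply/seteqP; split=> t /=; [case | split].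
    rewrite (_ : [set _ | _] = set0); first exact: open0.
    by apply/seteqP; split=> t //= [].
  apply/seteqP; split=> t /=; rewrite /chart.
    case: insubP => [u u01 <- //|u01]; case: ifPn => t0.
      by move=> ev; left; split=> //; lra.
    by move=> ev; right; split=> //; move: t0 u01; case: (ltP t 1); lra.
  case: insubP => [u u01 <- //|]; case: ifPn => t0 t01.
    by case=> [[_ //]|[h _]]; exfalso; lra.
  case=> [[h _]|[_ //]]; exfalso; move: t0 t01; case: (ltP t 1); lra.
move=> [v' /= ->|e u /= h]; first exact: collapse_vtx.
rewrite Inn_chart /=; have : 0 < sval u < 1 by case: u {h}.
move: (sval u) h => x h /andP[u0 u1].
rewrite collapse_chart; last by rewrite !ltW.
case: h => -[hu <-]; rewrite /squeeze.
  by rewrite clamp_le0 ?chart_le0//; lra.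
by rewrite clamp_ge1 ?chart_ge1//; lra.
Qed.

End Collapse.

(** * Deforming a path to a word path *)

Section Strip.
Variables (R : realType) (Y : complex1).
Local Notation "|Y|" := (realization R Y).
Implicit Types (e : edge Y) (v : vertex Y) (t s : R) (ga : R -> |Y|).

Definition rnd t : R := if t < 2^-1 then 0 else 1.

Definition nearest (x : |Y|) : vertex Y :=
  match x with Vtx v => v | Inn e u => if val u < 2^-1 then esrc e else etgt e end.

Definition track (x : |Y|) s : |Y| :=
  match x with
  | Vtx v => Vtx v
  | Inn e u => chart e ((1 + - s) * val u + s * rnd (val u))
  end.

Lemma track0 x : track x 0 = x.
Proof.
by case: x => //= e u; rewrite subr0 mul1r mul0r addr0 -Inn_chart.
Qed.

Lemma continuous_track x : continuous (track x).
Proof.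
case: x => [v|e u] /=; first by cont.
by apply: (continuous_o (@continuous_chart R Y e)); cont.
Qed.

Lemma track_chart e t s : 0 <= t <= 1 ->
  track (chart e t) s = chart e ((1 + - s) * t + s * rnd t).
Proof.
case/andP=> t0 t1; have [t00|tn0] := eqVneq t 0.
  by rewrite t00 /rnd invr_gt0 ltr0n !mulr0 addr0 !chart_le0.
have [t11|tn1] := eqVneq t 1.
  rewrite t11 /rnd ifF; last by apply/negbTE; rewrite -leNgt; lra.
  by rewrite !mulr1 subrK !chart_ge1.
have t01 : 0 < t < 1 by rewrite !lt_neqAle eq_sym tn0 t0 tn1 t1.
by rewrite (chart_inn e t01).
Qed.

Lemma nearest_chart e t : 0 <= t <= 1 ->
  nearest (chart e t) = if t < 2^-1 then esrc e else etgt e.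
Proof.
case/andP=> t0 t1; have [t00|tn0] := eqVneq t 0.
  by rewrite t00 chart_le0//= invr_gt0 ltr0n.
have [t11|tn1] := eqVneq t 1.
  rewrite t11 ifF; last by apply/negbTE; rewrite -leNgt; lra.
  by rewrite chart_ge1.
have t01 : 0 < t < 1 by rewrite !lt_neqAle eq_sym tn0 t0 tn1 t1.
by rewrite (chart_inn e t01).
Qed.

(* A homotopy from the restriction of ga to [a, b] to a word path, whose ends
   move along the tracks of ga a and ga b. *)
Definition strip ga (a b : R) := exists u (H : R * R -> |Y|) (sg : R -> R),
  [/\ walk (nearest (ga a)) u (nearest (ga b)), continuous H, continuous sg,
      [/\ sg a = 0, sg b = (size u)%:R &
          forall t, a <= t <= b -> 0 <= sg t <= (size u)%:R] &
      [/\ forall t, a <= t <= b -> H (t, 0) = ga t,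
          forall t, a <= t <= b -> H (t, 1) = wpath (nearest (ga a)) u (sg t),
          forall s, H (a, s) = track (ga a) s &
          forall s, H (b, s) = track (ga b) s]].

Lemma strip_glue ga (a b c : R) : a <= b -> b <= c ->
  strip ga a b -> strip ga b c -> strip ga a c.
Proof.
move=> ab bc [u [H [sg [w cH cs [sa sb sab] [H0 H1 Ha Hb]]]]].
move=> [u' [H' [sg' [w' cH' cs' [sb' sc' sbc'] [H0' H1' Hb' Hc']]]]].
exists (u ++ u'), (fun p => if p.1 + - b <= 0 then H p else H' p),
  (fun t => if t + - b <= 0 then sg t else (size u)%:R + sg' t); split.
- exact: walk_cat2 w w'.
- apply: (@continuous_paste R (R * R)%type |Y| H H' (fun p => p.1 + - b)) => //.
    by cont.
  by move=> [t s] /= /eqP; rewrite subr_eq0 => /eqP ->; rewrite Hb Hb'.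
- apply: (@continuous_paste R R R sg (fun t => (size u)%:R + sg' t) (fun t => t + - b)) => //.
  + by cont.
  + by cont; exact: cs'.
  + by move=> t /eqP; rewrite subr_eq0 => /eqP ->; rewrite sb sb' addr0.
- split.
  + by rewrite ifT ?sa//; lra.
  + rewrite size_cat natrD; case: ifPn => cb; last by rewrite sc'.
    have cbE : c = b by lra.
    by move: sc' sb'; rewrite cbE sb => <- ->; rewrite addr0.
  + move=> t /andP[at_ tc]; rewrite size_cat natrD.
    have u0 := ler0n R (size u); have u0' := ler0n R (size u').
    case: ifPn => tb.
      have /andP[h1 h2] : 0 <= sg t <= (size u)%:R by apply: sab; apply/andP; split; lra.
      by apply/andP; split; lra.
    have /andP[h1 h2] : 0 <= sg' t <= (size u')%:R.
      by apply: sbc'; apply/andP; split; lra.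
    by apply/andP; split; lra.
- split => [t /andP[ta tc]|t /andP[ta tc]|s|s] /=.
  + by case: ifPn => tb; [rewrite H0|rewrite H0']=> //; apply/andP; split; lra.
  + rewrite (wpath_cat _ w w'); case: ifPn => tb.
      have tab : a <= t <= b by apply/andP; split; lra.
      by have /andP[_ ->] := sab _ tab; rewrite H1.
    have tbc : b <= t <= c by apply/andP; split; lra.
    have /andP[s0 _] := sbc' _ tbc; rewrite H1'//.
    case: ifPn => h.
      have -> : sg' t = 0 by lra.
      by rewrite addr0 (wpath_ge w)// (wpath_le0 w').
    by congr wpath; ring.
  + by rewrite ifT ?Ha//; lra.
  + case: ifPn => cb; last exact: Hc'.
    have -> : c = b by lra.
    exact: Hb.
Qed.

Lemma strip_const ga (a b : R) v : a <= b ->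
  (forall t, a <= t <= b -> ga t = Vtx v) -> strip ga a b.
Proof.
move=> ab h; exists [::], (fun=> Vtx v), (fun=> 0).
rewrite (h a) ?(h b) ?lexx ?ab//; split.
- by rewrite /= eqxx.
- by cont.
- by cont.
- by split=> // t _; rewrite lexx.
- by split=> // t /h ->.
Qed.

Lemma strip_edge ga (a b : R) e (w : R -> R) : a < b ->
  continuous w -> (forall t, 0 <= w t <= 1) ->
  (forall t, a <= t <= b -> ga t = chart e (w t)) -> strip ga a b.
Proof.
move=> ab cw w01 gaE.
(* Within one edge the coordinate is deformed linearly to the affine path between the rounded ends.
   That path is constant or runs over the edge once, whence the word [u]. *)
pose lin t := rnd (w a) + (rnd (w b) + - rnd (w a)) * ((t + - a) * (b - a)^-1).
have ba0 : b - a != 0 by rewrite subr_eq0 gt_eqF.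
have lina : lin a = rnd (w a) by rewrite /lin subrr mul0r mulr0 addr0.
have linb : lin b = rnd (w b) by rewrite /lin divff// mulr1 addrC subrK.
pose H (p : R * R) : |Y| := chart e ((1 + - p.2) * w p.1 + p.2 * lin p.1).
pose u := if w a < 2^-1 then (if w b < 2^-1 then [::] else [:: (e, false)])
   else if w b < 2^-1 then [:: (e, true)] else [::].
pose sg t : R := (size u)%:R * ((t + - a) * (b - a)^-1).
exists u, H, sg.
have fa : nearest (ga a) = if w a < 2^-1 then esrc e else etgt e.
  by rewrite gaE ?lexx ?(ltW ab)// nearest_chart.
have fb : nearest (ga b) = if w b < 2^-1 then esrc e else etgt e.
  by rewrite gaE ?lexx ?(ltW ab)// nearest_chart.
split.
- rewrite fa fb /u; case: (w a < 2^-1); case: (w b < 2^-1) => /=;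
  by rewrite /dsrc /dtgt /= ?eqxx.
- rewrite /H /lin; apply: (continuous_o (@continuous_chart R Y e)); cont.
  by apply: (continuous_o cw); cont.
- by rewrite /sg; cont.
- rewrite /sg; split.
  + by rewrite subrr mul0r mulr0.
  + by rewrite divff// mulr1.
  + move=> t /andP[at_ tb].
    have h1 : 0 <= (t - a) / (b - a) by rewrite divr_ge0 ?subr_ge0// ltW.
    have h2 : (t - a) / (b - a) <= 1 by rewrite ler_pdivrMr ?subr_gt0// mul1r lerD2r.
    by have := ler0n R (size u) => u0; apply/andP; split; nra.
- split.
  + by move=> t tab; rewrite /H /= subr0 mul1r mul0r addr0 gaE.
  + move=> t tab; rewrite /H /= subrr mul0r mul1r add0r fa.
    rewrite /sg /u /lin /rnd; set q := (t + - a) / (b - a).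
    have h1 : 0 <= q by case/andP: tab => h h'; rewrite divr_ge0 ?subr_ge0// ltW.
    have h2 : q <= 1.
      by case/andP: tab => h h'; rewrite ler_pdivrMr ?subr_gt0// mul1r lerD2r.
    case: (w a < 2^-1); case: (w b < 2^-1) => /=.
    * by rewrite subrr mul0r addr0 chart_le0.
    * by rewrite subr0 add0r !mul1r h2.
    * by rewrite !mul1r h2 /dchart /=; congr chart; ring.
    * by rewrite subrr mul0r addr0 chart_ge1.
  + by move=> s; rewrite /H /= lina gaE ?lexx ?(ltW ab)// track_chart.
  + by move=> s; rewrite /H /= linb gaE ?lexx ?(ltW ab)// track_chart.
Qed.

End Strip.

Section Cellular.
Variables (R : realType) (Y : complex1).
Local Notation "|Y|" := (realization R Y).

(** By the Lebesgue number lemma equal short pieces of the path are constant after [collapse] or lie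
    in an open edge before it. Each piece has a strip, and the strips are glued. *)
Lemma path_strip (ga : R -> |Y|) : continuous ga ->
  strip (fun t => collapse R Y (ga t)) 0 1.
Proof.
move=> cga.
pose Q (a b : R) := (exists v, forall t, a <= t <= b -> collapse R Y (ga t) = Vtx v) \/
  (exists e, forall t, a <= t <= b -> in_edge e (ga t)).
have [N QN] : exists N : nat, forall t : R, 0 <= t <= 1 ->
    Q (t - N.+1%:R^-1) (t + N.+1%:R^-1).
  apply: segment_lebesgue => [a b a' b' aa bb|t _].
    have sub t : a' <= t <= b' -> a <= t <= b.
      by case/andP=> h1 h2; rewrite (le_trans aa)// (le_trans h2).
    by case=> -[c h]; [left|right]; exists c => t /sub; exact: h.
  suff /nbhs_ballP[r /= r0 rQ] : nbhs t [set t' | (fun t' =>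
      match ga t with Vtx v => collapse R Y (ga t') = Vtx v
                    | Inn e _ => in_edge e (ga t') end) t'].
    exists (r / 2); first by rewrite divr_gt0.
    have sub t' : t - r / 2 <= t' <= t + r / 2 -> ball t r t'.
      by case/andP=> h1 h2; rewrite /ball /= ltr_distlC; apply/andP; split; lra.
    move: rQ; case: (ga t) => [v|e u] rQ.
      by left; exists v => t' /sub; exact: rQ.
    by right; exists e => t' /sub; exact: rQ.
  have := cga t; rewrite /continuous_at; case E: (ga t) => [v|e u] ct.
    exact: (ct _ (@collapse_star R Y v)).
  have : open [set x : |Y| | in_edge e x /\ [set: R] (param x)].
    by apply: open_in_edge; exact: openT.
  move=> oU; have /ct : nbhs (Inn e u : |Y|) [set x : |Y| | in_edge e x /\ [set: R] (param x)].
    by apply: open_nbhs_nbhs; split.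
  by apply: (@filterS R (nbhs t)) => t' /= [].
set n : R := N.+1%:R; have n0 : 0 < n by rewrite ltr0n.
suff h : forall i, (i <= N)%N ->
    strip (fun t => collapse R Y (ga t)) 0 (i.+1%:R / n).
  by have := h N (leqnn N); rewrite divff// gt_eqF.
have loc i : (i <= N)%N ->
    strip (fun t => collapse R Y (ga t)) (i%:R / n) (i.+1%:R / n).
  move=> iN; have lt_ab : i%:R / n < i.+1%:R / n by rewrite ltr_pM2r ?invr_gt0// ltr_nat.
  have bE : i.+1%:R / n = i%:R / n + n^-1 by rewrite -natr1 mulrDl mul1r.
  have i01 : 0 <= i%:R / n <= 1.
    apply/andP; split; first by rewrite divr_ge0 ?ler0n// ltW.
    by rewrite ler_pdivrMr// mul1r ler_nat leqW.
  have ninv : 0 < n^-1 by rewrite invr_gt0.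
  case: (QN _ i01); rewrite -/n -bE => -[c h].
    apply: (@strip_const _ _ _ _ _ c); first exact: ltW.
    by move=> t /andP[h1 h2]; apply: h; rewrite h2 andbT (le_trans _ h1)// gerBl ltW.
  (* Clamping the time to the piece gives a path that stays in the open edge for all times, so its
     coordinate is continuous on the whole line. *)
  pose cl t : R := Num.max (i%:R / n) (Num.min (i.+1%:R / n) t).
  have clP t : i%:R / n <= cl t <= i.+1%:R / n.
    by rewrite /cl le_max lexx /= ge_max (ltW lt_ab) ge_min lexx.
  have in_e t : in_edge c (ga (cl t)).
    by apply: h; have /andP[h1 h2] := clP t; rewrite h2 andbT (le_trans _ h1)// gerBl ltW.
  apply: (@strip_edge _ _ _ _ _ c (fun t => squeeze (param (ga (cl t))))) => //.
  - apply: continuous_clamp; cont.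
    apply: (continuous_param _ in_e); apply: (continuous_o cga).
    by rewrite /cl; cont.
  - by move=> t; exact: clamp01.
  - move=> t /andP[h1 h2]; have tE : cl t = t by rewrite /cl min_r// max_r.
    have [E /andP[p0 p1]] := in_edge_chart (in_e t).
    by rewrite tE in E p0 p1 *; rewrite {1}E collapse_chart// !ltW.
elim=> [|i IH] iN; first by have := loc 0%N iN; rewrite mul0r.
apply: (@strip_glue _ _ _ _ (i.+1%:R / n)).
- by rewrite divr_ge0 ?ler0n// ltW.
- by rewrite ler_pM2r ?invr_gt0// ler_nat.
- exact: IH (ltnW iN).
- exact: loc.
Qed.

(** The strips of all edges at a vertex move its image along the same track, so they fit together to
    a homotopy of the whole map. *)
Lemma cellular (X : complex1) (f : gmap R X Y) :
  exists phi om g, [/\ valid phi om, homotopic f g & @follows R X Y g phi om].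
Proof.
have cf e : continuous (fun t => f (chart e t)).
  by apply: continuous_gmap; exact: continuous_chart.
pose kf : gmap R X Y := collapse R Y \o f.
pose phi v := nearest (kf (Vtx v)).
have /choice[U UP] e := path_strip (@cf e).
have /choice[HS HSP] : forall e, exists HS : (R * R -> |Y|) * (R -> R),
  [/\ walk (phi (esrc e)) (U e) (phi (etgt e)), continuous HS.1, continuous HS.2,
      [/\ HS.2 0 = 0 & HS.2 1 = (size (U e))%:R] &
      [/\ forall t, 0 <= t <= 1 -> HS.1 (t, 0) = kf (chart e t),
          forall t, 0 <= t <= 1 -> HS.1 (t, 1) = wpath (phi (esrc e)) (U e) (HS.2 t),
          forall s, HS.1 (0, s) = track (kf (Vtx (esrc e))) s &
          forall s, HS.1 (1, s) = track (kf (Vtx (etgt e))) s]].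
  move=> e; have [H [sg]] := UP e; rewrite (chart_le0 e (lexx 0)) (chart_ge1 e (lexx 1)).
  move=> [h1 h2 h3 [h4 h5 _] [h6 h7 h8 h9]].
  by exists (H, sg); split.
have w : valid phi U by move=> e; have [] := HSP e.
have c : clock U (fun e => (HS e).2).
  by move=> e; have [_ _ ? [? ?] _] := HSP e; split=> //; [lra|lra].
have [g r] := runs_exists w c; have [gv ge] := r.
exists phi, U, g; split => //; last by exists (fun e => (HS e).2).
apply: (homotopic_trans (homotopic_collapse f)).
apply: (@graph_homotopic _ _ _ kf g (fun v => track (kf (Vtx v))) (fun e => (HS e).1)).
- by move=> v; exact: continuous_track.
- by move=> e; have [] := HSP e.
- by move=> e s _; have [_ _ _ _ []] := HSP e.
- by move=> e s _; have [_ _ _ _ []] := HSP e.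
- by move=> v; rewrite track0.
- move=> v; rewrite gv /phi; case: (kf (Vtx v)) => //= e u.
  rewrite subrr mul0r mul1r add0r /rnd; case: ifPn => _.
    by rewrite chart_le0.
  by rewrite chart_ge1.
- by move=> e t t01; have [_ _ _ _ [->]] := HSP e.
- by move=> e t t01; have [_ _ _ _ [_ ->]] := HSP e; rewrite ?ge.
Qed.

End Cellular.

(** * Holonomy of loops *)

Section Grid.
Variables (Y : complex1) (N : nat) (hh vv : nat -> nat -> seq (dart Y)).
Hypothesis cell : forall i j, (i < N)%N -> (j < N)%N ->
  freeq (hh i j ++ vv i.+1 j) (vv i j ++ hh i j.+1).

Definition grid_row n j := flatten [seq hh i j | i <- iota 0 n].
Definition grid_col n := flatten [seq vv 0%N j | j <- iota 0 n].

Lemma freeq_row n j : (n <= N)%N -> (j < N)%N ->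
  freeq (grid_row n j ++ vv n j) (vv 0%N j ++ grid_row n j.+1).
Proof.
move=> + jN; elim: n => [_|n IH nN].
  by rewrite /grid_row /= cats0; exact: freeq_refl.
rewrite /grid_row -addn1 iotaD !map_cat !flatten_cat /= add0n !cats0 addn1.
rewrite -catA; apply: (@freeq_trans _ (grid_row n j ++ vv n j ++ hh n j.+1)).
  by apply: freeq_cat; [exact: freeq_refl | exact: cell].
rewrite !catA; apply: freeq_cat; last exact: freeq_refl.
by apply: IH; exact: ltnW.
Qed.

Hypothesis wrap : forall j, vv N j = vv 0%N j.

(** The left and the right side of the grid carry the same word because the rows are loops.
    Commuting the row past one side after another shows that the first and the last row are
    conjugate. *)
Lemma freeq_grid n : (n <= N)%N ->
  freeq (grid_row N 0 ++ grid_col n) (grid_col n ++ grid_row N n).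
Proof.
elim: n => [_|n IH nN].
  by rewrite /grid_col /= cats0; exact: freeq_refl.
rewrite /grid_col -addn1 iotaD !map_cat !flatten_cat /= add0n !cats0 addn1.
rewrite -/(grid_col n) !catA.
apply: (@freeq_trans _ (grid_col n ++ grid_row N n ++ vv 0%N n)).
  rewrite catA; apply: freeq_cat; last exact: freeq_refl.
  by apply: IH; exact: ltnW.
rewrite -catA; apply: freeq_cat; first exact: freeq_refl.
by rewrite -{1}wrap; exact: freeq_row.
Qed.

End Grid.

Section Holonomy.
Variables (R : realType) (Y : complex1).
Local Notation "|Y|" := (realization R Y).
Implicit Types (e : edge Y) (d : dart Y) (x y z : |Y|).

Definition crossing e (a b : bool) : seq (dart Y) :=
  if a then (if b then [::] else [:: (e, false)])
  else (if b then [:: (e, true)] else [::]).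

(* The word of a short path from x to y: it crosses the midpoint of an edge or
   it does not. *)
Definition hol x y : seq (dart Y) :=
  match x, y with
  | Inn e u, Inn e' u' =>
      if (e == e') && (`|val u - val u'| < 3^-1)
      then crossing e (val u < 2^-1) (val u' < 2^-1) else [::]
  | _, _ => [::]
  end.

(** At an end of the edge [hol] is empty by definition. So is the crossing, because a point within
    1/3 of that end lies on its side of the midpoint. *)
Lemma hol_chart e (a b : R) : 0 <= a <= 1 -> 0 <= b <= 1 -> `|a - b| < 3^-1 ->
  hol (chart e a) (chart e b) = crossing e (a < 2^-1) (b < 2^-1).
Proof.
move=> /andP[a0 a1] /andP[b0 b1] ab; move: (ab).
rewrite ltr_distlC => /andP[h1 h2].
have side (t : R) : ~~ (0 < t < 1) -> 0 <= t -> t <= 1 -> t = 0 \/ t = 1.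
  move=> t01 t0 t1; have [->|tn0] := eqVneq t 0; first by left.
  have [->|tn1] := eqVneq t 1; first by right.
  by move: t01; rewrite !lt_neqAle eq_sym tn0 t0 tn1 t1.
have lt12 (t : R) : t < 3^-1 -> (t < 2^-1) = true by move=> ?; lra.
have lt21 (t : R) : 2 / 3 < t -> (t < 2^-1) = false by move=> ?; lra.
case: (boolP (0 < a < 1)) => [a01|/side[//|//|a00|a11]].
- case: (boolP (0 < b < 1)) => [b01|/side[//|//|b00|b11]].
  + by rewrite (chart_inn e a01) (chart_inn e b01) /= eqxx ab.
  + rewrite b00 (chart_le0 e (lexx 0)) [LHS](_ : _ = [::]); last by case: (chart e a).
    by rewrite !lt12 //; lra.
  + rewrite b11 (chart_ge1 e (lexx 1)) [LHS](_ : _ = [::]); last by case: (chart e a).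
    by rewrite !lt21 //; lra.
- rewrite a00 (chart_le0 e (lexx 0)) [LHS](_ : _ = [::])//.
  by rewrite !lt12//; lra.
- rewrite a11 (chart_ge1 e (lexx 1)) [LHS](_ : _ = [::])//.
  by rewrite !lt21//; lra.
Qed.

Definition hol_trivial (S : set |Y|) := forall x y z, S x -> S y -> S z ->
  freeq (hol x y ++ hol y z) (hol x z).

Lemma crossing_trans e a b c :
  freeq (crossing e a b ++ crossing e b c) (crossing e a c).
Proof.
case: a; case: b; case: c => /=; try exact: freeq_refl.
- exact: (freeq_cancel (e, false)).
- exact: (freeq_cancel (e, true)).
Qed.

(** Near a vertex every [hol] is empty: points of edges lie in the outer thirds there, and two of
    them on one edge at distance below 1/3 are at the same end. Inside an edge the radius 1/6 keeps
    distances below 1/3, so that only the sides of the midpoint count. *)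
Lemma hol_trivial_nbhs x : exists2 U, nbhs x U & hol_trivial U.
Proof.
case: x => [v|e p].
  exists [set x | collapse R Y x = Vtx v]; first exact: collapse_star.
  have side e (u : {t : R | 0 < t < 1}) : collapse R Y (Inn e u) = Vtx v ->
      sval u <= 3^-1 \/ 2 / 3 <= sval u.
    have : 0 < sval u < 1 by case: u.
    rewrite Inn_chart /=; move: (sval u) => t t01.
    rewrite collapse_chart; last by case/andP: t01 => ? ?; rewrite !ltW.
    case: (leP t (3^-1)) => [|h1]; first by left.
    case: (leP (2 / 3) t) => [|h2]; first by right.
    have h : 0 < 3 * t + - 1 < 1 by apply/andP; split; lra.
    rewrite /squeeze clamp_id; last by case/andP: h => ? ?; rewrite !ltW.
    by rewrite (chart_inn e h).
  have nilE x y : collapse R Y x = Vtx v -> collapse R Y y = Vtx v -> hol x y = [::].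
    case: x => // e u; case: y => // e' u' /side hx /side hy /=.
    case: ifPn => // /andP[_]; rewrite ltr_distlC => /andP[h1 h2].
    move: (sval u) (sval u') hx hy h1 h2 => a b hx hy h1 h2.
    rewrite /crossing; case: (ltP a 2^-1) => h3; case: (ltP b 2^-1) => h4 //.
      by exfalso; case: hx; case: hy; lra.
    by exfalso; case: hx; case: hy; lra.
  move=> x y z hx hy hz; rewrite !nilE//; exact: freeq_refl.
exists [set x : |Y| | in_edge e x /\ ball (val p) (6^-1 : R) (param x)].
  apply: open_nbhs_nbhs; split.
    by apply: open_in_edge; exact: ball_open.
  by split=> //; exact: ballxx.
have bb (a b : R) : ball (val p) (6^-1 : R) a -> ball (val p) (6^-1 : R) b -> `|a - b| < 3^-1.
  rewrite /ball /= !ltr_distlC => /andP[h1 h2] /andP[h3 h4].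
  by apply/andP; split; lra.
move=> [v1|e1 u1] [v2|e2 u2] [v3|e3 u3] /= [] // -> h1 [] // -> h2 [] // -> h3.
by rewrite eqxx !bb//; exact: crossing_trans.
Qed.

(** With an even number of steps, each shorter than 1/3, the midpoint is a sample point, and exactly
    one step changes sides. *)
Lemma hol_block d m : (1 < m)%N ->
  flatten [seq hol (dchart d (i%:R / m.*2%:R)) (dchart d (i.+1%:R / m.*2%:R))
          | i <- iota 0 m.*2] = [:: d].
Proof.
move=> m1; set M := m.*2; have M0 : 0 < M%:R :> R by rewrite ltr0n /M; lia.
(* The midpoint counts as part of the upper half: going up, the step that ends there crosses; going
   down, the step that starts there does. *)
pose k := if d.2 then m else m.-1.
have kM : (k < M)%N by rewrite /k /M; case: d.2; lia.
have E i : (i < M)%N -> hol (dchart d (i%:R / M%:R)) (dchart d (i.+1%:R / M%:R)) =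
    if i == k then [:: d] else [::].
  move=> iM; have i01 j : (j <= M)%N -> 0 <= (j%:R / M%:R : R) <= 1.
    move=> jM; apply/andP; split; first by rewrite divr_ge0 ?ler0n.
    by rewrite ler_pdivrMr// mul1r ler_nat.
  have step : i.+1%:R / M%:R = i%:R / M%:R + M%:R^-1 :> R by rewrite -natr1 mulrDl mul1r.
  have Minv : M%:R^-1 < 3^-1 :> R.
    by rewrite ltf_pV2 ?posrE// ltr_nat /M; lia.
  have Minv0 : 0 < M%:R^-1 :> R by rewrite invr_gt0.
  have half j : (j%:R / M%:R < 2^-1 :> R) = (j < m)%N.
    rewrite ltr_pdivrMr// -(ltr_nat R) /M -muln2 natrM.
    by rewrite mulrCA mulVf ?mulr1.
  have half' j : (1 - j%:R / M%:R < 2^-1 :> R) = (m < j)%N.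
    rewrite ltrBlDr -ltrBlDl (_ : 1 - 2^-1 = 2^-1 :> R); last by lra.
    rewrite ltr_pdivlMr// -(ltr_nat R) /M -muln2 natrM.
    by rewrite mulrCA mulVf ?mulr1.
  have dist : `|i%:R / M%:R - i.+1%:R / M%:R| < 3^-1 :> R.
    by rewrite step opprD addrA subrr sub0r normrN gtr0_norm.
  have /andP[l0 l1] := i01 i (ltnW iM); have /andP[r0 r1] := i01 i.+1 iM.
  rewrite /dchart /k {k kM}; case: d => e [] /=.
    rewrite hol_chart.
    - by rewrite !half' /crossing; case: eqP => [->|ne]; case: ifPn => ?; case: ifPn => ? //; lia.
    - by apply/andP; split; lra.
    - by apply/andP; split; lra.
    - have subE (x y : R) : 1 - x - (1 - y) = y - x by ring.
      by rewrite subE distrC.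
  rewrite hol_chart//; [|by rewrite l0|by rewrite r0].
  by rewrite !half /crossing; case: eqP => [->|ne]; case: ifPn => ?; case: ifPn => ? //; lia.
have -> : [seq hol (dchart d (i%:R / M%:R)) (dchart d (i.+1%:R / M%:R)) | i <- iota 0 M]
   = [seq if i == k then [:: d] else [::] | i <- iota 0 M].
  by apply/eq_in_map => i; rewrite mem_iota add0n => /= iM; exact: E.
have zero (s : seq nat) : k \notin s ->
    flatten [seq if i == k then [:: d] else [::] | i <- s] = [::].
  elim: s => //= i s IH; rewrite inE negb_or eq_sym => /andP[/negPf -> ks].
  exact: IH.
rewrite -(subnKC kM) -addn1 -addnA iotaD map_cat flatten_cat zero; last first.
  by rewrite mem_iota add0n ltnn.
rewrite add0n /= eqxx /= zero//.
by rewrite mem_iota; lia.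
Qed.

Lemma wpath_cons (v w : vertex Y) d u (t : R) : walk (dtgt d) u w -> 0 <= t ->
  wpath v (d :: u) (1 + t) = wpath (dtgt d) u t.
Proof.
move=> wu t0 /=; rewrite gerDl; case: ifPn => h.
  have -> : t = 0 by apply/eqP; rewrite eq_le h t0.
  by rewrite addr0 dchart_ge1// (wpath_le0 wu).
by rewrite addrAC subrr add0r.
Qed.

Lemma hol_wpath (x : vertex Y) u (y : vertex Y) m : (1 < m)%N -> walk x u y ->
  flatten [seq hol (wpath x u (i%:R / m.*2%:R)) (wpath x u (i.+1%:R / m.*2%:R))
          | i <- iota 0 (size u * m.*2)] = u.
Proof.
move=> m1; set M := m.*2; have M0 : 0 < M%:R :> R by rewrite ltr0n /M; lia.
elim: u x => [//|d u IH] x /andP[_ w].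
rewrite [size _]/= mulSn iotaD map_cat flatten_cat add0n.
rewrite -[in RHS](cat1s d u); congr (_ ++ _).
  rewrite -(hol_block d m1) -/M; congr flatten; apply/eq_in_map => i.
  rewrite mem_iota add0n => /= iM.
  by rewrite !ler_pdivrMr// !mul1r !ler_nat iM (ltnW iM).
rewrite -[RHS](IH _ w) -[X in iota X _]addn0 iotaDl -map_comp.
congr flatten; apply/eq_map => i; rewrite /comp -addnS !natrD !mulrDl divff ?gt_eqF//.
have h j : 0 <= j%:R / M%:R :> R by rewrite divr_ge0 ?ler0n.
by rewrite !(wpath_cons x w)//; exact: h.
Qed.

(** A Lebesgue number for the unit square. It serves all finer meshes, so the mesh can be chosen
    later with suitable divisors. *)
Lemma hol_trivial_grid (F : R * R -> |Y|) : continuous F ->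
  exists N0, forall n, (N0 <= n)%N -> forall p : R * R, 0 <= p.1 <= 1 -> 0 <= p.2 <= 1 ->
  hol_trivial [set F q | q in [set q | `|p.1 - q.1| <= n.+1%:R^-1 /\
                                      `|p.2 - q.2| <= n.+1%:R^-1]].
Proof.
move=> cF; have := compact_setX (@segment_compact R 0 1) (@segment_compact R 0 1).
move=> /compact_near_coveringP/(_ _ \oo (fun n p =>
  hol_trivial [set F q | q in [set q | `|p.1 - q.1| <= n.+1%:R^-1 /\
                                      `|p.2 - q.2| <= n.+1%:R^-1]])) /=.
move=> /(_ _)[|N _ h].
  move=> p _; have [U FU triv] := hol_trivial_nbhs (F p).
  have [[A B] /= [/nbhs_ballP[r1 /= r10 rA] /nbhs_ballP[r2 /= r20 rB]] AB] := cF p _ FU.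
  pose r := Num.min r1 r2 / 2.
  have r0 : 0 < r by rewrite divr_gt0// lt_min r10.
  have rr1 : r + r <= r1 by rewrite -splitr ge_min lexx.
  have rr2 : r + r <= r2 by rewrite -splitr ge_min lexx orbT.
  exists (ball p r, [set n : nat | n.+1%:R^-1 < r]) => /=.
    by split; [exact: nbhsx_ballx | exact: (near_infty_natSinv_lt (PosNum r0))].
  move=> [q n] /= [[q1 q2] nr].
  have near_p (a b c s : R) : s + s <= c -> ball a s b ->
      forall a', `|b - a'| <= n.+1%:R^-1 -> n.+1%:R^-1 < s -> ball a c a'.
    move=> sc ab a' ba' ns; have ba's := le_lt_trans ba' ns.
    by apply: (le_ball sc); apply: ball_triangle ab _; exact: ba's.
  have sub y : [set F q' | q' in [set q' | `|q.1 - q'.1| <= n.+1%:R^-1 /\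
                                      `|q.2 - q'.2| <= n.+1%:R^-1]] y -> U y.
    move=> [q' [h1 h2] <-]; apply: AB; split => /=.
      by apply: rA; exact: near_p rr1 q1 _ h1 nr.
    by apply: rB; exact: near_p rr2 q2 _ h2 nr.
  by move=> x y z /sub hx /sub hy /sub hz; exact: triv.
exists N => n Nn p p1 p2; apply: (h n Nn); split; rewrite /= in_itv//.
Qed.

End Holonomy.

Section Loops.
Variables (R : realType) (Y : complex1).

Lemma loop_weight (f g : gmap R (circles 1) Y) phi om psi chi (k : edge Y -> nat) :
  valid phi om -> valid psi chi -> follows f phi om -> follows g psi chi ->
  homotopic f g -> cycle (@nobt Y) (chi ord0) ->
  (weight k (chi ord0) <= weight k (om ord0))%N.
Proof.
move=> wo wc ff gg fg cyc.
(* Both maps are first reparametrized by unit clocks, so that equally spaced samples divide each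
   letter evenly. *)
have [f' rf] := runs_exists wo (unit_clockP R om).
have [g' rg] := runs_exists wc (unit_clockP R chi).
have ff' : homotopic f f'.
  by apply: follows_homotopic wo ff _; exists (unit_clock om) => //; exact: unit_clockP.
have gg' : homotopic g g'.
  by apply: follows_homotopic wc gg _; exists (unit_clock chi) => //; exact: unit_clockP.
have /homotopicP[F [cF F0 F1]] : homotopic f' g'.
  by apply: homotopic_trans (homotopic_sym ff') (homotopic_trans fg gg').
pose o : edge (circles 1) := ord0.
pose FF (p : R * R) := F (chart o p.1, p.2).
have cFF : continuous FF.
  apply: (continuous_o cF); apply: continuous_pair; last by cont.
  by apply: (continuous_o (@continuous_chart R (circles 1) o)); cont.
have [N0 hN0] := hol_trivial_grid cFF.
pose u := om ord0; pose v := chi ord0.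
pose a := maxn 1 (size u); pose b := maxn 1 (size v).
(* A multiple of both word lengths (replaced by 1 for an empty word) by an even number at least 4,
   as [hol_wpath] requires for both rows, and large enough for [hN0]. *)
pose N := (a * b * (N0 + 2).*2)%N.
have a0 : (0 < a)%N by rewrite /a; lia.
have b0 : (0 < b)%N by rewrite /b; lia.
have NN0 : (N0 < N)%N by rewrite /N; nia.
have N_gt0 : (0 < N)%N by lia.
have NR : 0 < N%:R :> R by rewrite ltr0n.
pose pt (i j : nat) := FF (i%:R / N%:R, j%:R / N%:R).
pose hh i j := hol (pt i j) (pt i.+1 j).
pose vv i j := hol (pt i j) (pt i j.+1).
have cell i j : (i < N)%N -> (j < N)%N ->
    freeq (hh i j ++ vv i.+1 j) (vv i j ++ hh i j.+1).
  move=> iN jN; have ij01 l : (l < N)%N -> 0 <= (l%:R / N%:R : R) <= 1.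
    move=> lN; apply/andP; split; first by rewrite divr_ge0 ?ler0n.
    by rewrite ler_pdivrMr// mul1r ler_nat ltnW.
  have N0N : (N0 <= N.-1)%N by lia.
  have := hN0 _ N0N (i%:R / N%:R, j%:R / N%:R) (ij01 _ iN) (ij01 _ jN).
  rewrite prednK//= => triv.
  have dist l l' : (l' = l \/ l' = l.+1) -> `|l%:R / N%:R - l'%:R / N%:R| <= N%:R^-1 :> R.
    case=> ->; first by rewrite subrr normr0 invr_ge0 ltW.
    rewrite -natr1 mulrDl mul1r opprD addrA subrr sub0r normrN gtr0_norm//.
    by rewrite invr_gt0.
  have S i' j' : (i' = i \/ i' = i.+1) -> (j' = j \/ j' = j.+1) ->
    [set FF q | q in [set q | `|i%:R / N%:R - q.1| <= N%:R^-1 /\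
                             `|j%:R / N%:R - q.2| <= N%:R^-1]] (pt i' j').
    by move=> hi hj; exists (i'%:R / N%:R, j'%:R / N%:R) => //=; split; exact: dist.
  (* Both ways around the cell equal the holonomy of its diagonal. *)
  apply: (@freeq_trans _ (hol (pt i j) (pt i.+1 j.+1))).
    by apply: triv; apply: S; auto.
  by apply: freeq_sym; apply: triv; apply: S; auto.
have wrap j : vv N j = vv 0%N j.
  rewrite /vv /pt /FF /= divff ?gt_eqF// mul0r.
  by rewrite (chart_ge1 _ (lexx 1)) (chart_le0 _ (lexx 0)).
have row (w : seq (dart Y)) (x : vertex Y) m (j : nat) : (1 < m)%N -> walk x w x ->
    (forall t : R, 0 <= t <= 1 -> FF (t, j%:R / N%:R) = wpath x w ((size w)%:R * t)) ->
    (size w != 0 -> N = size w * m.*2)%N -> grid_row hh N j = w.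
  move=> m1 ww FE NE; rewrite /grid_row /hh /pt.
  have t01 l : (l <= N)%N -> 0 <= (l%:R / N%:R : R) <= 1.
    move=> lN; apply/andP; split; first by rewrite divr_ge0 ?ler0n.
    by rewrite ler_pdivrMr// mul1r ler_nat.
  have FEl l : (l <= N)%N -> FF (l%:R / N%:R, j%:R / N%:R) =
      wpath x w ((size w)%:R * (l%:R / N%:R)).
    by move=> lN; apply: FE; exact: t01.
  have [w0|w0] := eqVneq (size w) 0%N.
    have : forall l, l \in iota 0 N -> (l < N)%N by move=> l; rewrite mem_iota.
    elim: (iota 0 N) => [|l s IH] lN; first by rewrite (size0nil w0).
    have lN1 : (l < N)%N by apply: lN; rewrite inE eqxx.
    rewrite [LHS]/= (FEl l (ltnW lN1)) (FEl l.+1 lN1) (size0nil w0).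
    rewrite -[RHS](size0nil w0).
    by apply: IH => l' ls; apply: lN; rewrite inE ls orbT.
  rewrite -[RHS](hol_wpath R m1 ww) -NE//; congr flatten.
  apply/eq_in_map => l; rewrite mem_iota add0n => lN.
  rewrite (FEl l (ltnW lN)) (FEl l.+1 lN).
  have M0 : m.*2%:R != 0 :> R by rewrite pnatr_eq0; lia.
  have sE (q : nat) : (size w)%:R * (q%:R / N%:R) = q%:R / m.*2%:R :> R.
    rewrite NE// natrM; field.
    by rewrite M0 pnatr_eq0.
  by rewrite !sE.
have row0 : grid_row hh N 0 = u.
  apply: (row _ (phi ord0) (b * (N0 + 2))%N); first by nia.
  - exact: (wo ord0).
  - move=> t t01; rewrite mul0r /FF /= F0.
    by have [_ ->] := rf.
  - by rewrite -/u => u0; rewrite /N /a; nia.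
have rowN : grid_row hh N N = v.
  apply: (row _ (psi ord0) (a * (N0 + 2))%N); first by nia.
  - exact: (wc ord0).
  - move=> t t01; rewrite divff ?gt_eqF// /FF /= F1.
    by have [_ ->] := rg.
  - by rewrite -/v => v0; rewrite /N /b; nia.
have := freeq_grid cell wrap (leqnn N); rewrite row0 rowN.
by move/conj_weight; apply.
Qed.

End Loops.

(** * Taut representatives *)

Lemma path_andb (T : Type) (P Q : rel T) x s :
  path (fun a b => P a b && Q a b) x s = path P x s && path Q x s.
Proof.
by elim: s x => //= y s IH x; rewrite IH; case: (P x y); case: (Q x y); rewrite ?andbF.
Qed.

Section CyclicWords.
Variable Y : complex1.
Implicit Types (d : dart Y) (u v w : seq (dart Y)) (x y : vertex Y).

Lemma reduced_cycleE w : reduced_cycle w =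
  cycle (fun a b : dart Y => dtgt a == dsrc b) w && cycle (@nobt Y) w.
Proof. by case: w => //= d w; rewrite /reduced_cycle /= path_andb. Qed.

Lemma walk_path x d u y :
  walk x (d :: u) y = [&& dsrc d == x, path (fun a b => dtgt a == dsrc b) d u
                        & dtgt (last d u) == y].
Proof.
elim: u x d => [|d' u IH] x d //=; rewrite -/(walk (dtgt d) (d' :: u) y) IH.
by rewrite eq_sym -!andbA; congr andb; rewrite eq_sym.
Qed.

Lemma reduced_cycle_walk d u : reduced_cycle (d :: u) -> walk (dsrc d) (d :: u) (dsrc d).
Proof.
rewrite reduced_cycleE => /andP[+ _]; rewrite walk_path eqxx /=.
by rewrite rcons_path.
Qed.

Lemma walk_reduced_cycle x u : walk x u x -> cycle (@nobt Y) u -> reduced_cycle u.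
Proof.
case: u => // d u; rewrite reduced_cycleE walk_path => /and3P[/eqP <- h1 h2] ->.
by rewrite andbT /= rcons_path h1.
Qed.

Lemma reducedP u : reduced u \/ exists a d b, u = a ++ d :: drev d :: b.
Proof.
elim: u => [|d u [IH|[a [d' [b ->]]]]]; first by left.
  case: u IH => [|d' u] IH; first by left.
  have [dd|dd] := eqVneq d' (drev d).
    by right; exists [::], d, u; rewrite dd.
  by left; rewrite /reduced /= /nobt dd.
by right; exists (d :: a), d', b.
Qed.

Lemma cycle_nobtP u : reduced u -> cycle (@nobt Y) u \/
  exists d v, u = d :: rcons v (drev d).
Proof.
case: u => [|d u]; first by left.
case: (lastP u) => [_|v d' red].
  by left; rewrite /= /nobt andbT eq_sym drev_neq.
have [dd|dd] := eqVneq d (drev d'); last first.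
  left; rewrite /= -cats1 cat_path /= last_rcons andbT /nobt dd andbT.
  exact: red.
by right; exists d, v; rewrite dd drevK.
Qed.

Variable R : realType.

Lemma wpath_nth d0 x u y (i : nat) (s : R) : walk x u y -> (i < size u)%N ->
  0 <= s <= 1 -> wpath x u (i%:R + s) = dchart (nth d0 u i) s.
Proof.
move=> + + /andP[s0 s1]; elim: u x i => //= d u IH x [|i] /andP[dx w] iu.
  by rewrite add0r s1.
rewrite -[LHS]/(wpath x (d :: u) (i.+1%:R + s)).
rewrite -natr1 [_ + 1]addrC -addrA (wpath_cons x w) ?IH//.
by rewrite addr_ge0.
Qed.

End CyclicWords.

Section Loops.
Variables (R : realType) (Y : complex1).
Implicit Types (c d : gmap R (circles 1) Y) (w : seq (dart Y)).
Local Notation o := (ord0 : edge (circles 1)).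

Definition loop c w := exists x : vertex Y,
  walk x w x /\ @follows R (circles 1) Y c (fun _ => x) (fun _ => w).

Lemma loop_exists x w : walk x w x -> exists c,
  @follows R (circles 1) Y c (fun _ => x) (fun _ => w) /\ runs_along c ord0 w.
Proof.
move=> wx; have wv : @valid (circles 1) Y (fun _ => x) (fun _ => w) by [].
have [c r] := runs_exists wv (@unit_clockP R (circles 1) Y (fun _ => w)).
exists c; split.
  by exists (@unit_clock R (circles 1) Y (fun _ => w)) => //; exact: unit_clockP.
have [cv ce] := r; case: w wx wv r ce => [|d u] wx wv r ce.
  exists x => t; rewrite -chart_clamp.
  by have := ce o (clamp t) (clamp01 t).
rewrite /runs_along => k s s01.
have n0 : 0 < (size (d :: u))%:R :> R by rewrite ltr0n.
have /andP[s0 s1] := s01.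
have := ce o ((k%:R + s) / (size (d :: u))%:R); rewrite /unit_clock.
have -> : (size (d :: u))%:R * ((k%:R + s) / (size (d :: u))%:R) = k%:R + s :> R.
  by rewrite mulrCA divff ?mulr1// gt_eqF.
move=> ->.
  by rewrite (wpath_nth d wx)// (tnth_nth d).
apply/andP; split; first by rewrite divr_ge0 ?addr_ge0.
rewrite ler_pdivrMr// mul1r (@le_trans _ _ (k.+1%:R))//.
  by rewrite -natr1 lerD2l.
by rewrite ler_nat.
Qed.

Lemma nat_floor (n : nat) (t : R) : (0 < n)%N -> 0 <= t <= n%:R ->
  exists2 k : nat, (k < n)%N & 0 <= t - k%:R <= 1.
Proof.
case: n => // n _; elim: n => [|n IH] /andP[t0 tn].
  by exists 0%N => //; rewrite subr0 t0.
have [h|h] := leP t n.+1%:R.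
  have [|k kn hk] := IH; first by rewrite t0.
  by exists k => //; exact: leqW.
exists n.+1 => //; rewrite subr_ge0 ltW//=.
by rewrite lerBlDl natr1.
Qed.

Lemma runs_along_loop c w : reduced_cycle w -> runs_along c ord0 w -> loop c w.
Proof.
have cvE : c (Vtx (ord0 : vertex (circles 1))) = c (chart o 0) by rewrite chart_le0.
case: w => [_ [v h]|d u red h].
  exists v; split; first by rewrite /= eqxx.
  exists (@unit_clock R (circles 1) Y (fun _ => [::])); first exact: unit_clockP.
  split=> [i|e t _] /=; last by rewrite [e]ord1 h.
  by rewrite [i]ord1 cvE h.
have wx := reduced_cycle_walk red.
have n0 : 0 < (size (d :: u))%:R :> R by rewrite ltr0n.
have run (t : R) : 0 <= t <= 1 ->
    c (chart o t) = wpath (dsrc d) (d :: u) ((size (d :: u))%:R * t).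
  move=> /andP[t0 t1].
  have [|k kn hk] := @nat_floor (size (d :: u)) ((size (d :: u))%:R * t) isT.
    by rewrite mulr_ge0// ger_pMr.
  have := h (Ordinal kn) _ hk; rewrite (tnth_nth d) /= -(wpath_nth d wx kn hk).
  by rewrite addrC subrK mulrAC divff ?mul1r ?gt_eqF.
exists (dsrc d); split => //.
exists (@unit_clock R (circles 1) Y (fun _ => d :: u)); first exact: unit_clockP.
split=> [i|e t t01]; last by rewrite [e]ord1 run.
by rewrite [i]ord1 cvE run ?lexx ?ler01// mulr0 (wpath_le0 wx).
Qed.

Lemma loop_le c c' w w' (k : edge Y -> nat) : loop c w -> loop c' w' ->
  homotopic c c' -> cycle (@nobt Y) w' -> (weight k w' <= weight k w)%N.
Proof.
move=> [x [wx fx]] [x' [wx' fx']] cc' cyc.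
have v : @valid (circles 1) Y (fun _ => x) (fun _ => w) by [].
have v' : @valid (circles 1) Y (fun _ => x') (fun _ => w') by [].
exact: loop_weight v v' fx fx' cc' cyc.
Qed.

(** A word of least length among those of maps homotopic to [c] is cyclically reduced: a backtrack
    could be cancelled, and one at the base point can first be moved into the word. *)
Lemma taut_exists c : exists w d,
  [/\ homotopic c d, reduced_cycle w & runs_along d ord0 w].
Proof.
pose P n := `[< exists w d, [/\ homotopic c d, loop d w & size w = n] >].
have exP : exists n, P n.
  have [phi [om [g [v cg fg]]]] := cellular c.
  exists (size (om o)); apply/asboolP; exists (om o), g; split => //.
  exists (phi ord0); split; first exact: (v o).
  have [rho rc [gv ge]] := fg; exists rho.
    by move=> i; have := rc i; rewrite [i]ord1.
  by split=> [i|i t t01]; [rewrite [i]ord1 gv | rewrite [i]ord1 ge].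
have [n /asboolP[w [d [cd lw wn]]] nmin] := ex_minnP exP.
have cancel_contra w' : cancel w w' -> False.
  move=> cw; have [x [wx fx]] := lw.
  have v : @valid (circles 1) Y (fun _ => x) (fun _ => w) by [].
  have [g [dg fg]] := follows_cancel v (fun _ => or_intror cw) fx.
  have : P (size w').
    apply/asboolP; exists w', g; split => //.
      exact: homotopic_trans cd dg.
    by exists x; split => //; exact: walk_cancel cw wx.
  move=> /nmin; rewrite -wn; move: cw => [a [e [b [-> ->]]]].
  by rewrite !size_cat /=; lia.
have red : reduced w.
  case: (reducedP w) => // -[a [e [b E]]]; exfalso.
  by apply: (cancel_contra (a ++ b)); exists a, e, b.
have cyc : cycle (@nobt Y) w.
  case: (cycle_nobtP red) => // -[e [u wE]]; exfalso.
  have [x [wx fx]] := lw.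
  have v : @valid (circles 1) Y (fun _ => x) (fun _ => w) by [].
  have ex : dsrc e = x by move: wx; rewrite wE /= => /andP[/eqP].
  (* Pushing the base point along the first letter e turns e u e^-1 into e^-1 e u e^-1 e, and two
     cancellations leave u. *)
  have [g [dg fg]] := @follows_move R (circles 1) Y d (fun _ => x) (fun _ => w) ord0 e v ex fx.
  have v1 := fun e' : edge (circles 1) =>
    @walk_move (circles 1) Y (fun _ => x) (fun _ => w) ord0 e e' v ex.
  have c1 (e' : edge (circles 1)) :
      cancel (@pre (circles 1) Y ord0 e e' ++ w ++ @post (circles 1) Y ord0 e e')
        (rcons u (drev e) ++ [:: e]).
    have eE : (e' == ord0) by apply/eqP; exact: ord1.
    rewrite /pre /post /= eE.
    by exists [::], (drev e), (rcons u (drev e) ++ [:: e]); rewrite wE drevK.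
  have c2 : cancel (rcons u (drev e) ++ [:: e]) u.
    by exists u, (drev e), [::]; rewrite -cats1 -catA drevK cats0.
  have [g2 [gg2 fg2]] := @follows_cancel R (circles 1) Y g _ _
    (fun _ => rcons u (drev e) ++ [:: e]) v1 (fun e' => or_intror (c1 e')) fg.
  have v2 : @valid (circles 1) Y [eta (fun _ : vertex (circles 1) => x) with ord0 |-> dtgt e]
      (fun _ : edge (circles 1) => rcons u (drev e) ++ [:: e]).
    by move=> e'; apply: walk_cancel (c1 e') (v1 e').
  have [g3 [gg3 fg3]] := @follows_cancel R (circles 1) Y g2 _ _ (fun _ => u) v2
    (fun _ => or_intror c2) fg2.
  have : P (size u).
    apply/asboolP; exists u, g3; split => //.
      exact: homotopic_trans cd (homotopic_trans dg (homotopic_trans gg2 gg3)).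
    exists (dtgt e); split.
      by have := walk_cancel c2 (v2 o).
    have [rho rc [gv ge]] := fg3; exists rho => //.
    split=> [i|i t t01]; first by rewrite [i]ord1 gv.
    by rewrite ge//= [i]ord1.
  by move=> /nmin; rewrite -wn wE /= size_rcons; lia.
have [x [wx fx]] := lw.
have [d' [ld' rd']] := loop_exists wx.
exists w, d'; split => //.
  apply: homotopic_trans cd _.
  by apply: follows_homotopic fx ld'.
exact: walk_reduced_cycle wx cyc.
Qed.

End Loops.

Section Crossings.
Variables (R : realType) (Y : complex1).
Implicit Types (c d : gmap R (circles 1) Y) (w : seq (dart Y)).

Definition taut_word c : seq (dart Y) := taut_rep (Curve c : curve R Y) (ord0 : 'I_1).

(** [taut_rep] is a choice with a default value; by [taut_exists] the default is never taken. *)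
Lemma taut_wordP c :
  reduced_cycle (taut_word c) /\ exists d, homotopic c d /\ loop d (taut_word c).
Proof.
have [w [d [cd red run]]] := taut_exists c.
have ex : exists ws, taut_words (c := (Curve c : curve R Y)) ws.
  exists [ffun=> w], d; split=> // i.
  by rewrite ffunE [i]ord1.
have [d' [cd' h]] := xgetPex [ffun=> [::]] ex.
have [red' run'] := h (ord0 : 'I_1).
split; first exact: red'.
by exists d'; split=> //; exact: runs_along_loop.
Qed.

Lemma ncrossE c e :
  ncross (Curve c : curve R Y) e = count (fun d : dart Y => d.1 == e) (taut_word c).
Proof. by rewrite /ncross big_ord1. Qed.

Lemma count_weight w e :
  count (fun d : dart Y => d.1 == e) w = weight (fun e' => (e' == e) : nat) w.
Proof. by elim: w => [|d w IH]; rewrite ?weight_nil ?weight_cons//= IH. Qed.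

(** Crossing numbers do not depend on the taut word chosen: two cyclically reduced words of
    homotopic loops bound each other for the weight that counts only [e]. *)
Lemma ncross_loop c w e : loop c w -> reduced_cycle w ->
  ncross (Curve c : curve R Y) e = count (fun d : dart Y => d.1 == e) w.
Proof.
move=> lw red; rewrite ncrossE !count_weight.
have [red' [d [cd ld]]] := taut_wordP c.
move: red red'; rewrite !reduced_cycleE => /andP[_ cyc] /andP[_ cyc'].
apply/eqP; rewrite eqn_leq (loop_le _ lw ld cd cyc')/=.
exact: (loop_le _ ld lw (homotopic_sym cd) cyc).
Qed.

Lemma sum_count (F : edge Y -> R) w :
  \sum_e (count (fun d : dart Y => d.1 == e) w)%:R * F e = \sum_(d <- w) F d.1.
Proof.
elim: w => [|d w IH]; first by rewrite big_nil big1// => e _; rewrite mul0r.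
rewrite big_cons -IH (bigD1 d.1)//= eqxx natrD mulrDl mul1r -addrA.
rewrite [in RHS](bigD1 d.1)//=; congr (_ + (_ + _)).
by apply: eq_bigr => e ne; rewrite eq_sym (negPf ne).
Qed.

End Crossings.

(** * Subdivision of the target *)

Section Subdivision.
Variables (R : realType) (K : complex1) (k : edge K -> nat).
Hypothesis k_gt0 : forall e, (0 < k e)%N.

(** One bound for all edges, so that the pieces are indexed by a fixed ordinal type rather than by
    types depending on the edge. *)
Definition sub_bound := (\sum_e k e)%N.

Definition sub_vertex : finType := (vertex K + edge K * 'I_sub_bound.+2)%type.
Definition sub_edge : finType := (edge K * 'I_sub_bound.+1)%type.

Definition sub_point (e : edge K) (i : nat) : sub_vertex :=
  if i == 0%N then inl (esrc e) else
  if i == k e then inl (etgt e) else inr (e, inord i).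

(* The edge e is cut into the k e edges (e, i) with i < k e; the edges (e, i)
   with i >= k e are junk, which the map [unsub] below collapses to a point. *)
Definition subdivision : complex1 := @Complex1 sub_vertex sub_edge
  (fun a => sub_point a.1 a.2) (fun a => sub_point a.1 a.2.+1).

Lemma sub_bound_ge e : (k e <= sub_bound)%N.
Proof. by rewrite /sub_bound (bigD1 e)//= leq_addr. Qed.

Definition unsub_vertex (v : sub_vertex) : realization R K :=
  match v with inl v => Vtx v | inr (e, i) => chart e (i%:R / (k e)%:R) end.

Let k_gt0R e : 0 < (k e)%:R :> R.
Proof. by rewrite ltr0n. Qed.

Lemma unsub_point e i : (i <= sub_bound.+1)%N ->
  unsub_vertex (sub_point e i) = chart e (i%:R / (k e)%:R).
Proof.
move=> iM; rewrite /sub_point; case: eqP => [->|_].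
  by rewrite mul0r chart_le0.
case: eqP => [->|_] /=; first by rewrite divff ?chart_ge1// gt_eqF.
by rewrite inordK.
Qed.

Lemma unsub_exists : exists th : gmap R subdivision K,
  (forall v, th (Vtx v) = unsub_vertex v) /\
  forall a t, th (chart a t) = chart a.1 ((a.2%:R + clamp t) / (k a.1)%:R).
Proof.
pose p (a : edge subdivision) (t : R) : realization R K :=
  chart a.1 ((a.2%:R + t) / (k a.1)%:R).
have p0 a : p a 0 = unsub_vertex (esrc a).
  by rewrite /p addr0 /= unsub_point// ltnW.
have p1 a : p a 1 = unsub_vertex (etgt a).
  by rewrite /p natr1 /= unsub_point.
have cp a : continuous (p a).
  by apply: (continuous_o (@continuous_chart R K a.1)); cont.
have cth := @continuous_graph_fun R subdivision _ unsub_vertex p p0 p1 cp.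
exists (mkcts cth : gmap R subdivision K); split=> // a t.
exact: (graph_fun_chart p0 p1 a t).
Qed.

Definition unsub : gmap R subdivision K := projT1 (cid unsub_exists).

Lemma unsub_chart (a : edge subdivision) t :
  unsub (chart a t) = chart a.1 ((a.2%:R + clamp t) / (k a.1)%:R).
Proof. exact: (projT2 (cid unsub_exists)).2. Qed.

Lemma unsub_vtx v : unsub (Vtx v) = unsub_vertex v.
Proof. exact: (projT2 (cid unsub_exists)).1. Qed.

Definition sub_dart e (i : nat) : dart subdivision := ((e, inord i), false).
Definition sub_word e := [seq sub_dart e i | i <- iota 0 (k e)].

Lemma size_sub_word e : size (sub_word e) = k e.
Proof. by rewrite size_map size_iota. Qed.

Lemma walk_sub_word e : @walk subdivision (sub_point e 0) (sub_word e) (sub_point e (k e)).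
Proof.
have walk_seg n i : (i + n <= sub_bound)%N -> @walk subdivision (sub_point e i)
    [seq sub_dart e j | j <- iota i n] (sub_point e (i + n)).
  elim: n i => [|n IH] i h; first by rewrite addn0 /=.
  rewrite /= /dsrc /dtgt /= inordK; last by lia.
  by rewrite eqxx addnS -addSn IH//; lia.
by have := walk_seg (k e) 0%N; rewrite add0n; apply; exact: sub_bound_ge.
Qed.

Definition sub_embed (v : vertex K) : vertex subdivision := inl v.

Lemma valid_sub_word : valid sub_embed sub_word.
Proof.
move=> e; have := walk_sub_word e; rewrite /sub_point eqxx.
by rewrite gtn_eqF ?k_gt0// eqxx.
Qed.

Lemma sub_exists : exists s : gmap R K subdivision,
  follows s sub_embed sub_word /\ forall x, unsub (s x) = x.
Proof.
have w := valid_sub_word.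
have [s r] := runs_exists w (unit_clockP R sub_word).
exists s; split; first by exists (unit_clock sub_word) => //; exact: unit_clockP.
have [sv se] := r; elim/realization_ind => [v|e t /andP[t0 t1]].
  by rewrite sv unsub_vtx.
have t01 : 0 <= t <= 1 by rewrite !ltW.
rewrite se// /unit_clock size_sub_word.
have ke := k_gt0R e.
have [|j jk hj] := @nat_floor R (k e) ((k e)%:R * t) (k_gt0 e).
  apply/andP; split; first by apply: mulr_ge0; rewrite ?ler0n// ltW.
  by rewrite ger_pMr ?k_gt0R// ltW.
have -> : (k e)%:R * t = j%:R + ((k e)%:R * t - j%:R) by ring.
rewrite (wpath_nth (sub_dart e 0) (w e)) ?size_sub_word//.
rewrite (nth_map 0%N) ?size_iota// nth_iota// add0n /dchart /= unsub_chart /=.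
rewrite clamp_id// inordK; last by have := sub_bound_ge e; lia.
by congr chart; field; rewrite gt_eqF.
Qed.

End Subdivision.

(** * Energy of a configuration *)

Section Chains.
Variables (R : realType) (G : complex1) (F : edge G -> R -> R).
Implicit Types (x y z : realization R G).

Lemma chain_cat x y z p q : chain x y p -> chain y z q -> chain x z (p ++ q).
Proof.
elim: p x => [|[[e s] t] p IH] x /=; first by move=> ->.
by move=> [s01 t01 xE /IH h] /h.
Qed.

Lemma chain_length_cat p q :
  chain_length F (p ++ q) = chain_length F p + chain_length F q.
Proof. by rewrite /chain_length big_cat. Qed.

Lemma chain_length_ge0 p : 0 <= chain_length F p.
Proof. by apply: sumr_ge0 => a _; exact: normr_ge0. Qed.

(** An upper bound on the distance with a chain as witness. Such bounds add up under concatenation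
    without any handling of infima. *)
Definition linked x y (r : R) :=
  exists2 p, chain x y p & chain_length F p <= r.

Lemma linked_refl x : linked x x 0.
Proof. by exists [::] => //; rewrite /chain_length big_nil. Qed.

Lemma linked_trans y x z r s : linked x y r -> linked y z s -> linked x z (r + s).
Proof.
move=> [p xy pr] [q yz qs]; exists (p ++ q); first exact: chain_cat xy yz.
by rewrite chain_length_cat lerD.
Qed.

Lemma linked_le x y r s : r <= s -> linked x y r -> linked x y s.
Proof. by move=> rs [p xy pr]; exists p => //; exact: le_trans pr rs. Qed.

Lemma linked_edge e (s t : R) : 0 <= s <= 1 -> 0 <= t <= 1 ->
  linked (chart e s) (chart e t) `|F e t - F e s|.
Proof.
move=> s01 t01; exists [:: (e, s, t)] => //.
by rewrite /chain_length big_seq1.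
Qed.

Lemma gdist_le x y r : linked x y r -> gdist F x y <= r.
Proof.
move=> [p xy pr]; apply: le_trans pr; apply: ge_inf; last by exists p.
by exists 0 => _ [q _ <-]; exact: chain_length_ge0.
Qed.

Lemma gdist_ge0 x y : 0 <= gdist F x y.
Proof.
rewrite /gdist; set S := [set _ | _ in _].
have [->|/set0P S0] := eqVneq S set0; first by rewrite inf0.
by apply: lb_le_inf => // _ [q _ <-]; exact: chain_length_ge0.
Qed.

(** A lower bound on [gdist] needs a nonempty set of chains, since the infimum of the empty set is
    0. *)
Lemma connected_chain x y : gconnected G -> exists p, chain x y p.
Proof.
move=> /existsP[u0 /forallP conn].
have chain_edge e s t : 0 <= s <= 1 -> 0 <= t <= 1 ->
    exists p, chain (chart e s : realization R G) (chart e t) p.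
  by move=> s01 t01; exists [:: (e, s, t)].
have i0 : 0 <= (0 : R) <= 1 by rewrite lexx ler01.
have i1 : 0 <= (1 : R) <= 1 by rewrite lexx ler01.
have vtx_chain v : (exists p, chain (Vtx u0 : realization R G) (Vtx v) p) /\
    exists p, chain (Vtx v : realization R G) (Vtx u0) p.
  have /connectP[s + ->] := conn v.
  elim/last_ind: s => [|s w IH]; first by split; exists [::].
  rewrite rcons_path last_rcons => /andP[/IH[[p hp] [q hq]]].
  move=> /existsP[e /orP[]] /andP[/eqP e1 /eqP e2].
    have [p1 hp1] := chain_edge e 0 1 i0 i1; have [q1 hq1] := chain_edge e 1 0 i1 i0.
    move: hp1 hq1; rewrite (chart_le0 e (lexx 0)) (chart_ge1 e (lexx 1)) e1 e2.
    by split; [exists (p ++ p1); exact: chain_cat hp _|exists (q1 ++ q); exact: chain_cat hq].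
  have [p1 hp1] := chain_edge e 1 0 i1 i0; have [q1 hq1] := chain_edge e 0 1 i0 i1.
  move: hp1 hq1; rewrite (chart_le0 e (lexx 0)) (chart_ge1 e (lexx 1)) e1 e2.
  by split; [exists (p ++ p1); exact: chain_cat hp _|exists (q1 ++ q); exact: chain_cat hq].
have pt_chain z : (exists p, chain (Vtx u0 : realization R G) z p) /\
    exists p, chain z (Vtx u0 : realization R G) p.
  elim/realization_ind: z => // e t /andP[t0 t1].
  have t01 : 0 <= t <= 1 by rewrite !ltW.
  have [[p hp] [q hq]] := vtx_chain (esrc e).
  have [p1 hp1] := chain_edge e 0 t i0 t01; have [q1 hq1] := chain_edge e t 0 t01 i0.
  move: hp1 hq1; rewrite (chart_le0 e (lexx 0)).
  by split; [exists (p ++ p1); exact: chain_cat hp _|exists (q1 ++ q); exact: chain_cat hq].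
have [_ [p hp]] := pt_chain x; have [[q hq] _] := pt_chain y.
by exists (p ++ q); exact: chain_cat hp hq.
Qed.

End Chains.

Section LatticeLength.
Variables (R : realType) (K : lengthGraph R) (k : edge K -> nat) (h : R).
Hypothesis h_ge0 : 0 <= h.
Hypothesis k_gt0 : forall e, (0 < k e)%N.
Hypothesis len_le : forall e, elen e <= h * (k e)%:R.
Let th := unsub R k_gt0.
Local Notation linked := (linked (@lcoord R K)).

Lemma clamp_dist (a b : R) : `|clamp a - clamp b| <= `|a - b|.
Proof.
wlog ab : a b / a <= b.
  move=> H; case: (leP a b) => [/H//|/ltW /H]; by rewrite distrC [in leRHS]distrC.
have cE (t : R) : clamp t = if t <= 0 then 0 else if 1 <= t then 1 else t.
  case: ifPn => [/clamp_le0 //|]; rewrite -ltNge => t0.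
  by case: ifPn => [/clamp_ge1 //|]; rewrite -ltNge => t1; rewrite clamp_id// !ltW.
rewrite [leRHS]ler0_norm ?subr_le0// ler_norml !cE.
case: (leP a 0) => a0; case: (leP 1 a) => a1; case: (leP b 0) => b0;
  case: (leP 1 b) => b1; apply/andP; split; lra.
Qed.

Lemma linked_chart e (a b : R) :
  linked (chart e a) (chart e b) (elen e * `|a - b|).
Proof.
rewrite -(chart_clamp e a) -(chart_clamp e b).
apply: linked_le (linked_edge _ _ (clamp01 _) (clamp01 _)).
rewrite /lcoord -mulrBr normrM (ger0_norm (elen_ge0 e)) distrC.
by rewrite ler_wpM2l ?elen_ge0// clamp_dist.
Qed.

(** A piece of the edge [e] has length [elen e] / k(e), which is at most the mesh [h]. *)
Lemma linked_dart (d : dart (subdivision k)) (a b : R) :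
  linked (th (dchart d a)) (th (dchart d b)) (h * `|a - b|).
Proof.
rewrite /dchart; pose t (c : R) := if d.2 then 1 - c else c.
have -> : `|a - b| = `|t a - t b|.
  rewrite /t; case: d.2 => //; rewrite distrC; congr (`|_|); ring.
rewrite -/(t a) -/(t b) /th !unsub_chart; set e := d.1.1.
apply: linked_le (linked_chart _ _ _).
have ke : 0 < (k e)%:R :> R by rewrite ltr0n.
rewrite -mulrBl normrM [X in _ * (_ * X)]gtr0_norm ?invr_gt0//.
rewrite opprD addrACA subrr add0r mulrCA mulrC.
apply: ler_pM; rewrite ?normr_ge0//.
- by rewrite divr_ge0 ?elen_ge0// ltW.
- by rewrite ler_pdivrMr.
- exact: clamp_dist.
Qed.

Lemma linked_wpath x (u : seq (dart (subdivision k))) y (a b : R) : walk x u y ->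
  linked (th (wpath x u a)) (th (wpath x u b)) (h * `|a - b|).
Proof.
elim: u x a b => [|d u IH] x a b /=.
  move=> _; apply: linked_le (linked_refl _ _).
  by rewrite mulr_ge0 ?normr_ge0.
move=> /andP[_ w].
have mid (c c' : R) : c <= 1 -> 1 < c' ->
    `|c - 1| + `|0 - (c' - 1)| = `|c - c'| /\ `|c' - 1 - 0| + `|1 - c| = `|c' - c|.
  move=> c1 c1'; split.
    by rewrite !ler0_norm; lra.
  by rewrite !ger0_norm; lra.
case: ifPn => [a1|]; case: ifPn => [b1|]; rewrite -?ltNge.
- by move=> *; exact: linked_dart.
- move=> b1; have [<- _] := mid _ _ a1 b1; rewrite mulrDr.
  apply: linked_trans (linked_dart d a 1) _.
  by rewrite dchart_ge1// -(wpath_le0 w (lexx 0)); exact: IH.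
- move=> a1; have [_ <-] := mid _ _ b1 a1; rewrite mulrDr.
  apply: (@linked_trans _ _ _ (th (Vtx (dtgt d)))).
    by rewrite -(wpath_le0 w (lexx 0)); exact: IH.
  by rewrite -(dchart_ge1 d (lexx 1)); exact: linked_dart.
- move=> b1 a1; rewrite (_ : a - b = a - 1 - (b - 1)); last by ring.
  exact: IH.
Qed.

End LatticeLength.

(** * The coordinate of an elastic edge *)

Section Coordinate.
Variables (R : realType) (G : elasticGraph R) (e : edge G).
Local Notation mu := (emeas e).

Let I01 (t : R) : set R := `[0%R, 1%R]%classic `&` `]-oo, t]%classic.

Let measurable_I01 t : measurable (I01 t).
Proof. by apply: measurableI; exact: measurable_itv. Qed.

(** Agrees with [ecoord] on [0, 1] and is constant outside, hence continuous on the whole line, as a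
    clock has to be. *)
Definition cumul (t : R) : R := fine (mu (I01 t)).

Let mu_fin (A : set R) : measurable A -> A `<=` `[0%R, 1%R]%classic -> mu A \is a fin_num.
Proof.
move=> mA sub; rewrite ge0_fin_numE//; apply: le_lt_trans (emeas_fin e).
by apply: le_measure; rewrite ?inE//; exact: measurable_itv.
Qed.

Let mu_I01_fin t : mu (I01 t) \is a fin_num.
Proof. by apply: mu_fin => // x []. Qed.

(** Absolute continuity excludes atoms. *)
Let mu_set1 t : mu [set t] = 0%E.
Proof.
have /null_content_dominatesP dom := @emeas_ac R G e.
by apply: dom; [exact: measurable_set1 | exact: lebesgue_measure_set1].
Qed.

Lemma cumul_ecoord t : 0 <= t <= 1 -> cumul t = ecoord e t.
Proof.
move=> /andP[t0 t1]; rewrite /cumul /ecoord; congr (fine (mu _)).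
apply/seteqP; split=> x /=; rewrite /I01 /= !in_itv /=.
  by move=> [/andP[-> _] ->].
by move=> /andP[x0 xt]; rewrite x0 xt (le_trans xt).
Qed.

Lemma cumul0 : cumul 0 = 0.
Proof.
rewrite cumul_ecoord ?lexx ?ler01// /ecoord.
by rewrite set_itv1 mu_set1.
Qed.

Lemma cumul_le s t : s <= t -> cumul s <= cumul t.
Proof.
move=> st; apply: fine_le => //; apply: le_measure; rewrite ?inE//.
by apply: setIS => x /=; rewrite !in_itv /= => /le_trans; apply.
Qed.

Lemma alpha_gt0 : 0 < alpha e.
Proof.
rewrite /alpha -cumul_ecoord ?lexx ?ler01//.
rewrite /cumul fine_gt0//.
rewrite -ge0_fin_numE ?mu_I01_fin// andbT.
apply: lt_le_trans (@emeas_pos _ G e 0 1 (lexx 0) ltr01 (lexx 1)) _.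
apply: le_measure; rewrite ?inE//.
move=> x; rewrite /I01 /= !in_itv /= => /andP[x0 x1].
by rewrite !ltW.
Qed.

Let cvg_right t : (fun n => cumul (t + n.+1%:R^-1)) @ \oo --> cumul t.
Proof.
have -> : cumul t = fine (mu (\bigcap_n I01 (t + n.+1%:R^-1))).
  congr (fine (mu _)); apply/seteqP; split=> x.
    move=> [x01 xt] n _; split=> //; move: xt; rewrite /= !in_itv /=.
    by move=> /le_trans; apply; rewrite lerDl.
  move=> h; split; first by have [] := h 0%N I.
  rewrite /= in_itv /=; rewrite leNgt; apply/negP => tx.
  have xt0 : 0 < x - t by rewrite subr_gt0.
  have [n _ /(_ n (leqnn n))] := near_infty_natSinv_lt (PosNum xt0).
  rewrite /= ltrBrDl => hn.
  by have [_] := h n I; rewrite /= in_itv /= leNgt hn.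
apply: fine_cvg; rewrite fineK; last first.
  by apply: mu_fin; [exact: bigcap_measurable | move=> x /(_ 0%N I)[]].
apply: nonincreasing_cvg_mu.
- by rewrite -ge0_fin_numE// mu_I01_fin.
- by move=> n; exact: measurable_I01.
- exact: bigcap_measurable.
- move=> m n mn; apply/subsetPset => x [x01 xt]; split=> //; move: xt.
  rewrite /= !in_itv /= => /le_trans; apply.
  by rewrite lerD2l lef_pV2 ?posrE ?ltr0n// ler_nat.
Qed.

(** Continuity from below yields the measure of the part of [0, 1] strictly left of [t]; the missing
    point is null. *)
Let cvg_left t : (fun n => cumul (t - n.+1%:R^-1)) @ \oo --> cumul t.
Proof.
have -> : cumul t = fine (mu (\bigcup_n I01 (t - n.+1%:R^-1))).
  set U := \bigcup_n _; have mU : measurable U by exact: bigcup_measurable.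
  have U1 : mu (U `|` [set t]) = mu U.
    have m1 : measurable [set t] by exact: measurable_set1.
    apply: (proj1 (null_setU mu m1)) => //.
    by apply/measure0_null_setP => //; exact: mu_set1.
  have subU : I01 t `<=` U `|` [set t].
    move=> x [x01]; rewrite /= in_itv /= le_eqVlt => /orP[/eqP ->|xt]; first by right.
    left; have xt0 : 0 < t - x by rewrite subr_gt0.
    have [n _ /(_ n (leqnn n))] := near_infty_natSinv_lt (PosNum xt0).
    rewrite /= => hn; exists n => //; split=> //.
    by rewrite /= in_itv /= lerBrDl -lerBrDr ltW.
  have Usub : U `<=` I01 t.
    move=> x [n _ [x01 xt]]; split=> //; move: xt; rewrite /= !in_itv /=.
    by move=> /le_trans; apply; rewrite gerBl.
  congr fine; apply/eqP; rewrite eq_le -{1}U1.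
  by apply/andP; split; apply: le_measure; rewrite ?inE//; exact: measurableU.
apply: fine_cvg; rewrite fineK; last first.
  by apply: mu_fin; [exact: bigcup_measurable | move=> x [n _ []]].
apply: nondecreasing_cvg_mu.
- by move=> n; exact: measurable_I01.
- exact: bigcup_measurable.
- move=> m n mn; apply/subsetPset => x [x01 xt]; split=> //; move: xt.
  rewrite /= !in_itv /= => /le_trans; apply.
  by rewrite lerD2l lerN2 lef_pV2 ?posrE ?ltr0n// ler_nat.
Qed.

(** For a monotone function one sequence from each side suffices. *)
Lemma continuous_cumul : continuous cumul.
Proof.
move=> t; apply/cvgrPdist_le => eps eps0.
have /cvgrPdist_le/(_ eps eps0)[n _ /(_ n (leqnn n)) /= hr] := @cvg_right t.
have /cvgrPdist_le/(_ eps eps0)[m _ /(_ m (leqnn m)) /= hl] := @cvg_left t.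
have d0 : 0 < Num.min (n.+1%:R^-1) (m.+1%:R^-1) :> R.
  by rewrite lt_min !invr_gt0 !ltr0n.
exists (Num.min (n.+1%:R^-1) (m.+1%:R^-1)) => //= s.
rewrite /ball_ /= ltr_distlC => /andP[s1 s2].
have sr : cumul s <= cumul (t + n.+1%:R^-1).
  by apply: cumul_le; rewrite (le_trans (ltW s2))// lerD2l ge_min lexx.
have sl : cumul (t - m.+1%:R^-1) <= cumul s.
  by apply: cumul_le; rewrite (le_trans _ (ltW s1))// lerD2l lerN2 ge_min lexx orbT.
move: hr hl; rewrite !ler_distl => /andP[h1 h2] /andP[h3 h4].
by apply/andP; split; lra.
Qed.

End Coordinate.

(* No measurability is needed, since the integral of a nonnegative function is
   a supremum over the simple functions below it. *)
Lemma integral_le_cst d (T : measurableType d) (R : realType)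
    (mu : {measure set T -> \bar R}) (D : set T) (f : T -> \bar R) (c : R) :
  measurable D -> 0 <= c -> (forall x, D x -> (0 <= f x)%E) ->
  (forall x, D x -> (f x <= c%:E)%E) ->
  (\int[mu]_(x in D) f x <= c%:E * mu D)%E.
Proof.
move=> mD c0 f0 fc; rewrite -(integral_cst mu mD).
rewrite [X in (X <= _)%E]ge0_integralE// ge0_integralE; last by move=> x _; rewrite lee_fin.
apply: ereal_sup_le => _ [h hf <-]; exists h => // x.
apply: le_trans (hf x) _; rewrite /patch; case: ifPn => // /set_mem Dx.
exact: fc.
Qed.

(** * Energy of a map running along words *)

Section DirichletBound.
Variables (R : realType) (G : elasticGraph R) (K : lengthGraph R).
Variables (k : edge K -> nat) (h : R).
Hypothesis h_ge0 : 0 <= h.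
Hypothesis k_gt0 : forall e, (0 < k e)%N.
Hypothesis len_le : forall e, elen e <= h * (k e)%:R.
Variables (phi : vertex G -> vertex (subdivision k)) (om : edge G -> seq (dart (subdivision k))).
Hypothesis w : valid phi om.

(** Constant speed in the coordinate of [e]: an edge whose image has length L then contributes at
    most L ^ 2 / alpha. *)
Definition arc_clock (e : edge G) (t : R) : R :=
  (size (om e))%:R * (cumul e t / alpha e).

Lemma arc_clockP : clock om arc_clock.
Proof.
move=> e; rewrite /arc_clock; split.
- cont; exact: continuous_cumul.
- by rewrite cumul0 mul0r mulr0.
- by rewrite cumul_ecoord ?lexx ?ler01// divff ?mulr1// gt_eqF// alpha_gt0.
Qed.

Variable g : gmap R G (subdivision k).
Hypothesis r : runs g phi om arc_clock.
Let f : gmap R G K := unsub R k_gt0 \o g.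
Let slope (e : edge G) : R := h * (size (om e))%:R / alpha e.

Let slope_ge0 e : 0 <= slope e.
Proof. by rewrite /slope divr_ge0 ?mulr_ge0// ltW// alpha_gt0. Qed.

Lemma linked_slope e (s t : R) : 0 <= s <= 1 -> 0 <= t <= 1 ->
  linked (@lcoord R K) (f (chart e s)) (f (chart e t))
    (slope e * `|ecoord e s - ecoord e t|).
Proof.
move=> s01 t01; have [_ ge] := r; rewrite /f /= !ge//.
apply: linked_le (linked_wpath h_ge0 k_gt0 len_le _ _ (w e)).
rewrite /arc_clock !cumul_ecoord// -mulrBr -mulrBl normrM normrM.
rewrite (ger0_norm (ler0n _ _)) (gtr0_norm (_ : 0 < (alpha e)^-1)).
  by rewrite /slope -!mulrA [`|_| * _]mulrC.
by rewrite invr_gt0 alpha_gt0.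
Qed.

Lemma lipschitz_unsub : lipschitz_map f.
Proof.
pose C := 1 + \sum_e slope e; have C0 : 0 < C by rewrite ltr_pwDl// sumr_ge0.
have sC e : slope e <= C.
  by rewrite /C (bigD1 e)//= addrCA lerDl addr_ge0// sumr_ge0.
exists C => x y; rewrite mulrC -ler_pdivrMr//.
rewrite /edist /gdist; apply: lb_le_inf.
  have [p hp] := @connected_chain R G x y (egraph_connected G).
  by exists (chain_length (@ecoord R G) p); exists p.
move=> _ [p hp <-]; rewrite ler_pdivrMr// mulrC; apply: gdist_le.
elim: p x hp => [|[[e s] t] p IH] x /=.
  move=> ->; apply: linked_le (linked_refl _ _).
  by rewrite /chain_length big_nil mulr0.
move=> [s01 t01 -> /IH hl].
rewrite /chain_length big_cons mulrDr; apply: linked_trans hl.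
apply: linked_le (linked_slope e s01 t01).
by rewrite distrC ler_wpM2r.
Qed.

Lemma speed_ge0 e t : (0 <= speed f e t)%E.
Proof.
apply: le_ereal_inf_tmp => _ [V tV <-].
have [s Vs] : exists s, V s.
  by apply: (@filter_ex _ (t^')).
apply: le_ereal_sup_tmp; eexists; first by exists s.
by rewrite lee_fin divr_ge0// gdist_ge0.
Qed.

Lemma speed_le e t : 0 <= t <= 1 -> (speed f e t <= (slope e)%:E)%E.
Proof.
(* A neighbourhood of 0 or 1 also contains parameters outside [0, 1]. There the chart is clamped to
   the same end, so the two image points coincide. *)
move=> /andP[t0 t1]; pose V := [set s : R | 0 <= s <= 1 \/
                                chart e s = chart e t :> realization R G].
have tV : (t^') V.
  apply: nbhs_dnbhs.
  have [t00|tn0] := eqVneq t 0.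
    have : nbhs t [set s : R | s < 1]
      by apply: open_nbhs_nbhs; split; [exact: open_lt|rewrite /= t00].
    apply: filterS => s /= s1; have [s0|s0] := leP s 0.
      by right; rewrite t00 !chart_le0.
    by left; rewrite !ltW.
  have [t11|tn1] := eqVneq t 1.
    have : nbhs t [set s : R | 0 < s]
      by apply: open_nbhs_nbhs; split; [exact: open_gt|rewrite /= t11].
    apply: filterS => s /= s0; have [s1|s1] := leP 1 s.
      by right; rewrite t11 !chart_ge1.
    by left; rewrite !ltW.
  have : nbhs t `]0, 1[%classic.
    apply: open_nbhs_nbhs; split; first exact: interval_open.
    by rewrite /= in_itv /= !lt_neqAle eq_sym tn0 t0 tn1 t1.
  by apply: filterS => s /=; rewrite in_itv /= => /andP[s0 s1]; left; rewrite !ltW.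
apply: ge_ereal_inf; eexists; first by exists V; [exact: tV|reflexivity].
apply: ge_ereal_sup => _ [s Vs <-]; rewrite lee_fin.
(* Where the coordinates agree the quotient is 0, as division by 0 gives 0. *)
have [d0|d0] := eqVneq `|ecoord e s - ecoord e t| 0.
  by rewrite d0 invr0 mulr0.
rewrite ler_pdivrMr; last by rewrite lt_neqAle eq_sym d0 normr_ge0.
apply: gdist_le; case: Vs => [s01|->]; last first.
  by apply: linked_le (linked_refl _ _); rewrite mulr_ge0.
by apply: linked_slope; rewrite ?t0.
Qed.

Lemma Dir_unsub_le :
  (Dir f <= (\sum_e (h * (size (om e))%:R) ^+ 2 / alpha e)%:E)%E.
Proof.
rewrite /Dir -sumEFin; apply: lee_sum => e _.
apply: (@le_trans _ _ ((slope e ^+ 2)%:E * emeas e `[0%R, 1%R]%classic)%E).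
  apply: integral_le_cst; [exact: measurable_itv|exact: sqr_ge0| |].
    by move=> t _; apply: expe_ge0; exact: speed_ge0.
  move=> t; rewrite /= in_itv /= => /(speed_le e) st.
  have := speed_ge0 e t; move: st; case: (speed f e t) => [x| |] xs x0; [|by []|by []].
  by rewrite -EFinM lee_fin -expr2 ler_pXn2r// ?nnegrE.
have a0 := alpha_gt0 e.
have -> : emeas e `[0%R, 1%R]%classic = (alpha e)%:E.
  rewrite /alpha /ecoord fineK// ge0_fin_numE//; exact: emeas_fin.
rewrite -EFinM lee_fin /slope -subr_ge0 [X in 0 <= X](_ : _ = 0)//.
by field; rewrite gt_eqF.
Qed.

End DirichletBound.

(** * Configurations of least energy *)

Section PushWords.
Variable Y : complex1.
Implicit Types (d : dart Y) (u v x : seq (dart Y)).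

Lemma dpush_cancel d x : dpush d x = d :: x \/ cancel (d :: x) (dpush d x).
Proof.
case: x => [|a y] /=; first by left.
case: eqP => [->|_]; last by left.
by right; exists [::], d, y.
Qed.

Lemma cancel_catr u u' v : cancel u u' -> cancel (u ++ v) (u' ++ v).
Proof. by move=> [a [d [b [-> ->]]]]; exists a, d, (b ++ v); rewrite -!catA. Qed.

Lemma winv_cat u v : winv (u ++ v) = winv v ++ winv u.
Proof. by rewrite /winv rev_cat map_cat. Qed.

Lemma cancel_winv u u' : cancel u u' -> cancel (winv u) (winv u').
Proof.
move=> [a [d [b [-> ->]]]]; exists (winv b), d, (winv a); split; last exact: winv_cat.
by rewrite winv_cat !winv_cons drevK -!cats1 -!catA.
Qed.

Lemma size_dpush_le d x : (size (dpush d x) <= (size x).+1)%N.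
Proof. by case: x => [|a y] //=; case: ifP => _ /=; rewrite ?leqnn// ltnW. Qed.

Lemma size_dpush_head d x : ohead x = Some (drev d) -> size x = (size (dpush d x)).+1.
Proof. by case: x => [|a y] //= [->]; rewrite eqxx. Qed.

Lemma reduced_winv x : reduced x -> reduced (winv x).
Proof.
rewrite /reduced /winv map_rev rev_sorted sorted_map; apply: sub_sorted => a b.
by rewrite /relpre /= nobt_drev.
Qed.

Lemma ohead_winv d x : ohead (winv (rcons x d)) = Some (drev d).
Proof. by rewrite winv_rcons. Qed.

End PushWords.

Section Turns.
Variables (X Y : complex1) (om : edge X -> seq (dart Y)).

(** A legal turn, as for train tracks: the image of [b] does not set out along the way on which the
    image of [a] arrived. *)
Definition turn (a b : dart X) : bool := (dtgt a == dsrc b) &&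
  (ohead (dimage om b) != ohead (dimage om (drev a))).

Lemma turn_reduced_cycle w : cycle turn w -> reduced_cycle w.
Proof.
apply: sub_cycle => a b /andP[ab ne]; rewrite ab /=.
by apply: contraNneq ne => ->.
Qed.

Hypothesis red : forall e, reduced (om e).

Lemma reduced_dimage a : reduced (dimage om a).
Proof. by rewrite /dimage; case: a.2 => //; exact: reduced_winv. Qed.

(** Legal turns exclude cancellation between neighbours. The images must be nonempty, as otherwise
    letters could meet across an empty one. *)
Lemma reduced_wimage a s : all (fun a : dart X => dimage om a != [::]) (a :: s) ->
  path turn a s -> reduced (wimage om (a :: s)).
Proof.
elim: s a => [|b s IH] a.
  by move=> _ _; rewrite /wimage /= cats0; exact: reduced_dimage.
move=> /= /andP[a0 bs] /andP[/andP[_ ab] bps].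
have := IH b bs bps; move: bs => /= /andP[b0 _].
rewrite -[wimage om [:: a, b & s]]/(dimage om a ++ wimage om (b :: s)).
rewrite -[wimage om (b :: s)]/(dimage om b ++ wimage om s).
move: ab; rewrite dimage_drev; have := reduced_dimage a.
case/lastP: (dimage om a) a0 => // u x _; rewrite ohead_winv.
case: (dimage om b) b0 => // y v _ redx /= xy redy.
rewrite /reduced; case: u redx => [|z u] /= redx.
  by rewrite redy andbT; apply: contraNneq xy => ->.
rewrite cat_path redx /= last_rcons redy andbT /nobt.
by apply: contraNneq xy => ->.
Qed.

Lemma cycle_wimage w : all (fun a : dart X => dimage om a != [::]) w ->
  cycle turn w -> cycle (@nobt Y) (wimage om w).
Proof.
case: w => [//|a s] ne cyc.
(* The cycle is closed up by repeating its first dart; the first letter of that copy accounts for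
   the seam. *)
have := @reduced_wimage a (rcons s a); rewrite -rcons_cons all_rcons ne.
have a0 : dimage om a != [::] by move: ne => /= /andP[].
rewrite a0 => /(_ isT cyc).
rewrite -cats1 /wimage map_cat flatten_cat /= cats0.
case: (dimage om a) a0 => // d u _; rewrite /reduced /=.
rewrite cat_path /= => /andP[h1 /andP[h2 _]].
by rewrite rcons_path h1.
Qed.

End Turns.

Lemma last_iota i m : last i (iota i.+1 m) = (i + m)%N.
Proof. by elim: m i => [|m IH] i /=; rewrite ?addn0// IH addSnnS. Qed.

(** The base exceeds the number of edges: lowering the exponent of [e0] from n + 1 outweighs all the
    edges whose new exponents are at most n. *)
Lemma energy_lt (E : finType) (x x' : E -> nat) (e0 : E) (B := #|E|.+2) :
  (x' e0 < x e0)%N -> (forall e, (x' e <= x e)%N \/ (x' e < x e0)%N) ->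
  (\sum_e B ^ x' e < \sum_e B ^ x e)%N.
Proof.
move=> h0 h; have B0 : (0 < B)%N by [].
case X : (x e0) h0 h => [//|n] h0 h.
have le_n m : (m < n.+1)%N -> (B ^ m <= B ^ n)%N by move=> mn; rewrite leq_pexp2l.
apply: (@leq_ltn_trans (\sum_(e | e != e0) B ^ x e + #|E| * B ^ n)%N).
  rewrite -sum_nat_const [X in (_ <= X + _)%N]big_mkcond -big_split /=; apply: leq_sum => e _.
  have [->|ne] := eqVneq e e0; first by rewrite add0n le_n.
  case: (h e) => [he|/le_n he]; last by rewrite (leq_trans he) ?leq_addl.
  by rewrite (leq_trans _ (leq_addr _ _))// leq_pexp2l.
rewrite [X in (_ < X)%N](bigD1 e0)//= X addnC ltn_add2r expnS ltn_mul2r expn_gt0.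
by rewrite B0 /= /B ltnS leqnSn.
Qed.

Section MinimalConfiguration.
Variables (R : realType) (X Y : complex1) (f : gmap R X Y).
Variables (c : edge X -> nat) (Q : nat).
Hypothesis c_gt0 : forall e, (0 < c e)%N.
Hypothesis Q_ge : forall e, (2 * c e <= Q)%N.

Let B := #|edge X|.+2.
(** Integer weights [c], proportional to the inverses of the rounded m, make the energy a natural
    number, so a minimum exists. *)
Let energy (om : edge X -> seq (dart Y)) := (\sum_e B ^ (c e * size (om e)))%N.

Definition configuration phi om := valid phi om /\
  exists g : gmap R X Y, homotopic f g /\ follows g phi om.

Definition minimal_configuration phi om := configuration phi om /\
  forall phi' om', configuration phi' om' -> (energy om <= energy om')%N.

Lemma minimal_exists : exists phi om, minimal_configuration phi om.
Proof.
pose P n := `[< exists phi om, configuration phi om /\ energy om = n >].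
have exP : exists n, P n.
  have [phi [om [g [v fg gf]]]] := cellular f.
  by exists (energy om); apply/asboolP; exists phi, om; split=> //; split=> //; exists g.
have [n /asboolP[phi [om [cfg <-]]] nmin] := ex_minnP exP.
exists phi, om; split=> // phi' om' cfg'; apply: nmin.
by apply/asboolP; exists phi', om'.
Qed.

Lemma configuration_cancel phi om om' : configuration phi om ->
  (forall e, om' e = om e \/ cancel (om e) (om' e)) -> configuration phi om'.
Proof.
move=> [v [g [fg gf]]] h; have [g' [gg' g'f]] := follows_cancel v h gf.
split; last by exists g'; split=> //; exact: homotopic_trans fg gg'.
by move=> e; case: (h e) => [->|cc]; [exact: v | exact: walk_cancel cc (v e)].
Qed.

Variables (phi : vertex X -> vertex Y) (om : edge X -> seq (dart Y)).
Hypothesis mincfg : minimal_configuration phi om.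

Lemma minimal_reduced e : reduced (om e).
Proof.
have [cfg min] := mincfg.
case: (reducedP (om e)) => // -[a [d [b E]]]; exfalso.
pose om' e' := if e' == e then a ++ b else om e'.
have cfg' : configuration phi om'.
  apply: configuration_cancel cfg _ => e'; rewrite /om'.
  by case: eqP => [->|_]; [right; exists a, d, b | left].
have := min _ _ cfg'; rewrite leqNgt => /negP; apply.
apply: (@energy_lt _ _ _ e).
  rewrite /om' eqxx E !size_cat /= ltn_mul2l c_gt0; lia.
move=> e'; left; rewrite /om'; case: eqP => [->|//].
by rewrite E !size_cat /= leq_mul2l; apply/orP; right; lia.
Qed.

Definition exponent (a : dart X) := (c a.1 * size (om a.1))%N.

(* Otherwise all the darts at dtgt a with a large exponent start in the same
   direction, and moving the image of dtgt a in that direction decreases the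
   energy. *)
Lemma minimal_turn a : (Q < exponent a)%N ->
  exists b, turn om a b /\ (exponent a <= exponent b + Q)%N.
Proof.
move=> Qa; have [[v [g [fg gf]]] min] := mincfg; pose p := dtgt a.
(* A large exponent forces a nonempty image, so there is a first letter [d] along which to move. *)
have : (0 < size (dimage om (drev a)))%N.
  by rewrite size_dimage; move: Qa; rewrite /exponent /=; case: (size _); lia.
have := walk_dimage v (drev a); rewrite dsrc_drev.
case E : (dimage om (drev a)) => [//|d u] /= /andP[/eqP dp _] _.
apply: contrapT => noturn.
have aligned b : dsrc b = p -> (exponent a <= exponent b + Q)%N ->
    ohead (dimage om b) = Some d.
  move=> bp ab; apply: contrapT => ne; apply: noturn; exists b; split => //.
  by rewrite /turn bp eqxx E /=; apply/eqP.
have [g1 [gg1 g1f]] := follows_move v dp gf.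
pose phi1 : vertex X -> vertex Y := [eta phi with p |-> dtgt d].
have cfg1 : configuration phi1 (fun e => pre p d e ++ om e ++ post p d e).
  split; first by move=> e; exact: walk_move.
  by exists g1; split => //; exact: homotopic_trans fg gg1.
pose l e := if esrc e == p then dpush (drev d) (om e) else om e.
pose om2 e := if etgt e == p then winv (dpush (drev d) (winv (l e))) else l e.
have cfg2 : configuration phi1 (fun e => l e ++ post p d e).
  apply: configuration_cancel cfg1 _ => e; rewrite /pre /l.
  case: eqP => _ /=; last by left.
  by case: (dpush_cancel (drev d) (om e)) => [->|/cancel_catr cc]; [left|right; exact: cc].
have cfg3 : configuration phi1 om2.
  apply: configuration_cancel cfg2 _ => e; rewrite /post /om2.
  case: eqP => _ /=; last by left; rewrite cats0.
  have -> : l e ++ [:: d] = winv (drev d :: winv (l e)).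
    by rewrite winv_cons winvK drevK cats1.
  by case: (dpush_cancel (drev d) (winv (l e))) => [->|/cancel_winv cc]; [left|right; exact: cc].
have := min _ _ cfg3; rewrite leqNgt => /negP; apply.
have sz_le e : (size (om2 e) <= (size (om e)).+2)%N.
  have h1 : (size (l e) <= (size (om e)).+1)%N.
    by rewrite /l; case: ifP => _; rewrite ?size_dpush_le ?leqnSn.
  rewrite /om2; case: ifP => _; last exact: leqW.
  by rewrite size_winv (leq_trans (size_dpush_le _ _))// size_winv.
have sz_lt e : (esrc e = p -> ohead (om e) = Some d) ->
    (etgt e = p -> ohead (winv (om e)) = Some d) ->
    (size (om2 e) + ((esrc e == p) || (etgt e == p)) <= size (om e))%N.
  rewrite /om2 /l => hs ht; case: eqP => tp; case: eqP => sp; rewrite ?size_winv /=.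
  - have := hs sp; have := ht tp; case: (om e) => [//|d' y] h [E']; rewrite E' in h *.
    rewrite /= drevK eqxx; move: h; rewrite winv_cons.
    case E2 : (winv y) => [|d2 y2] /=.
      by case=> /eqP; rewrite (negPf (drev_neq d)).
    case=> d2d; rewrite d2d ?drevK eqxx -(size_winv y) E2 /=; lia.
  - rewrite addn1 -(@size_dpush_head _ (drev d)) ?size_winv// drevK; exact: ht.
  - rewrite addn1 -(@size_dpush_head _ (drev d))// drevK; exact: hs.
  - by rewrite addn0.
(* Either all ends of [e] at [p] start with [d], so that the move shortens [e] there, or the
   exponent of [e] is more than [Q] below that of [a]. *)
have ends e : (esrc e = p -> ohead (om e) = Some d) /\
    (etgt e = p -> ohead (winv (om e)) = Some d) \/
    (c e * size (om e) + Q < exponent a)%N.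
  case: (leqP (exponent a) (c e * size (om e) + Q)) => h; last by right.
  left; split => ep; first by apply: (aligned (e, false)).
  exact: (aligned (e, true)).
apply: (@energy_lt _ _ _ a.1).
  case: (ends a.1) => [[hs ht]|]; last by rewrite /exponent; lia.
  rewrite ltn_mul2l c_gt0 /=; have := sz_lt a.1 hs ht.
  have -> : (esrc a.1 == p) || (etgt a.1 == p).
    by rewrite /p /dtgt; case: a.2; rewrite eqxx ?orbT.
  by rewrite addn1.
move=> e; case: (ends e) => [[hs ht]|h].
  by left; rewrite leq_mul2l (leq_trans _ (sz_lt e hs ht)) ?orbT// leq_addr.
(* Such an edge gains at most two letters, that is at most 2 c(e) <= Q in the exponent, and stays
   below [a]. *)
right; apply: leq_ltn_trans h; have := sz_le e; have := Q_ge e.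
by move=> h1 h2; rewrite (leq_trans (leq_mul (leqnn (c e)) h2))//; lia.
Qed.

(** Iterating [minimal_turn] n times costs at most n Q, so an exponent above n Q never drops too low
    to continue. Among the n + 1 darts visited two coincide. *)
Lemma minimal_cycle a0 (n := #|{: dart X}|) : (n * Q < exponent a0)%N ->
  exists w, [/\ w != [::], (size w <= n)%N, cycle (turn om) w &
    forall b, b \in w -> (exponent a0 <= exponent b + n * Q)%N].
Proof.
move=> big.
have /choice[next nextP] : forall a, exists b, (Q < exponent a)%N ->
    turn om a b /\ (exponent a <= exponent b + Q)%N.
  move=> a; case: (ltnP Q (exponent a)) => [/minimal_turn[b hb]|_]; first by exists b.
  by exists a.
pose x i := iter i next a0.
have exp_x i : (i <= n)%N -> (exponent a0 <= exponent (x i) + i * Q)%N.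
  elim: i => [|i IH] iN; first by rewrite addn0.
  have h1 := IH (ltnW iN).
  have [|_ h2] := nextP (x i); first by nia.
  by rewrite /x iterS -/(x i); nia.
have turn_x i : (i < n)%N -> turn om (x i) (x i.+1).
  move=> iN; have h1 := exp_x i (ltnW iN).
  by have [] := nextP (x i); first by nia.
have : ~~ uniq (traject next a0 n.+1).
  apply/negP => /card_uniqP; rewrite size_traject => h.
  by have := max_card (mem (traject next a0 n.+1)); rewrite h ltnn.
move=> /(uniqPn a0)[i [j [ij]]]; rewrite size_traject => jn.
rewrite !nth_traject//; last exact: ltn_trans jn.
rewrite -/(x i) -/(x j) => xij.
exists [seq x l | l <- iota i (j - i)]; split.
- by rewrite -size_eq0 size_map size_iota subn_eq0 -ltnNge.
- by rewrite size_map size_iota; lia.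
- have path_x m : (i + m < n)%N -> path (turn om) (x i) [seq x l | l <- iota i.+1 m].
    elim: m => // m IH h; rewrite -[m.+1]addn1 iotaD map_cat cat_path IH; last by lia.
    rewrite /= andbT (last_map x) last_iota.
    by apply: turn_x; lia.
  have -> : (j - i = (j - i).-1.+1)%N by lia.
  rewrite /= xij.
  rewrite rcons_path -xij path_x; last by lia.
  rewrite (last_map x) last_iota (_ : i + (j - i).-1 = j.-1)%N; last by lia.
  rewrite xij (_ : x j = x j.-1.+1); last by rewrite prednK//; lia.
  by apply: turn_x; lia.
- move=> b /mapP[l]; rewrite mem_iota => lj ->.
  have ln : (l <= n)%N by lia.
  by rewrite (leq_trans (exp_x l ln))// leq_add2l leq_mul2r ln orbT.
Qed.

End MinimalConfiguration.

(** * Stretching bounds and the main theorem *)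

Lemma ler_sum_seq (R : realType) (T : eqType) (s : seq T) (F H : T -> R) :
  (forall a, a \in s -> F a <= H a) -> \sum_(a <- s) F a <= \sum_(a <- s) H a.
Proof.
by move=> h; rewrite big_seq [leRHS]big_seq; apply: ler_sum.
Qed.

(** Rounding up to the lattice. The successor keeps the number of pieces positive even when the
    length is 0. *)
Lemma nat_scale (R : realType) (x h : R) : 0 <= x -> 0 < h -> exists k : nat,
  [/\ (0 < k)%N, x <= h * k%:R & h * k%:R <= x + h].
Proof.
move=> x0 h0; exists (Num.truncn (x / h)).+1; split=> //.
  by rewrite mulrC -ler_pdivrMr// ltW// truncnS_gt.
rewrite -natr1 mulrDr mulr1 lerD2r mulrC -ler_pdivlMr//.
by rewrite truncn_le// divr_ge0// ltW.
Qed.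

Section Words.
Variables (R : realType) (Y Z : complex1).

Lemma size_wimage (chi : edge Y -> seq (dart Z)) (w : seq (dart Y)) :
  size (wimage chi w) = (\sum_(a <- w) size (chi a.1))%N.
Proof.
elim: w => [|a w IH]; first by rewrite big_nil.
by rewrite big_cons -IH /wimage /= size_cat size_dimage.
Qed.

Lemma weight1 (u : seq (dart Z)) : weight (fun _ => 1%N) u = size u.
Proof. by rewrite /weight sum1_size. Qed.

Lemma loop_comp (c : gmap R (circles 1) Y) (g : gmap R Y Z) psi chi w :
  valid psi chi -> follows g psi chi -> loop c w ->
  loop (g \o c : gmap R (circles 1) Z) (wimage chi w).
Proof.
move=> v gf [x [wx cf]]; exists (psi x); split; first exact: walk_wimage v _ _ _ wx.
have vx : @valid (circles 1) Y (fun _ => x) (fun _ => w) by [].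
exact: (follows_comp vx v cf gf).
Qed.

End Words.

Section Stretch.
Variables (R : realType) (G : elasticGraph R) (K : lengthGraph R) (f : gmap R G K).

Definition taut_length (c : gmap R (circles 1) G) : R :=
  \sum_(d <- taut_word (f \o c : gmap R (circles 1) K)) elen d.1.

Definition simple_cycle (w : seq (dart G)) :=
  [&& w != [::], (size w <= #|{: dart G}|)%N & reduced_cycle w].

(* Otherwise the configuration of least energy on a fine lattice has a legal
   cycle w whose m-length is exceeded by a factor of about 1 + eps, and whose image
   is taut. *)
Lemma stretch_bound (cw : seq (dart G) -> gmap R (circles 1) G) (m : edge G -> R) :
  (forall w, simple_cycle w -> loop (cw w) w) ->
  (forall e, 0 < m e) ->
  (forall w, simple_cycle w -> taut_length (cw w) <= \sum_(a <- w) m a.1) ->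
  forall eps : R, 0 < eps -> exists g : gmap R G K,
    [/\ homotopic f g, lipschitz_map g &
        (Dir g <= (\sum_e ((1 + eps) * m e + eps) ^+ 2 / alpha e)%:E)%E].
Proof.
move=> cwP m0 lm eps eps0.
pose n := #|{: dart G}|.
(* Bounds the number of letters of the taut image of every cycle. Rounding up the edges of [K] costs
   at most [h] per letter, hence [h * S] in all. *)
pose S : R := (\sum_(w : n.-bseq (dart G))
  size (taut_word (f \o cw w : gmap R (circles 1) K)))%N%:R.
have sizeS w : simple_cycle w ->
    (size (taut_word (f \o cw w : gmap R (circles 1) K)))%:R <= S.
  move=> /and3P[_ wn _]; rewrite ler_nat (bigD1 (Bseq wn))//=.
  exact: leq_addr.
pose A : R := \sum_e (m e)^-1.
have A0 : 0 <= A by apply: sumr_ge0 => e _; rewrite invr_ge0 ltW.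
have mA e : (m e)^-1 <= A.
  by rewrite /A (bigD1 e)//= lerDl sumr_ge0// => e' _; rewrite invr_ge0 ltW.
(* A positive lower bound of all [m e], and so of the m-length of any nonempty cycle. *)
pose nu := (1 + A)^-1; have nu0 : 0 < nu by rewrite invr_gt0; lra.
have nu_m e : nu <= m e.
  by rewrite /nu invf_ple ?posrE//; have := mA e; lra.
have S0 : 0 <= S by exact: ler0n.
have nR0 : 0 <= n%:R :> R by exact: ler0n.
have nA0 : 0 <= n%:R * A by rewrite mulr_ge0.
(* The first bound absorbs the rounding of m in the final estimate, the second gives n Q <= (eps /
   2) P, and the third makes the rounding error [h * S] smaller than (eps / 2) nu. *)
pose h := Num.min (eps / (1 + eps))
  (Num.min (eps / (4 * (n%:R * A) + 1)) (eps * nu / (2 * (S + 1)))).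
have h0 : 0 < h.
  by rewrite !lt_min !divr_gt0 ?mulr_gt0//; lra.
have h1 : h * (1 + eps) <= eps.
  by rewrite -ler_pdivlMr; [rewrite ge_min lexx | lra].
have h2 : h * (4 * (n%:R * A) + 1) <= eps.
  by rewrite -ler_pdivlMr; [rewrite /h !ge_min lexx ?orbT | lra].
have h3 : h * (2 * (S + 1)) <= eps * nu.
  by rewrite -ler_pdivlMr; [rewrite /h !ge_min lexx ?orbT | lra].
have /choice[k kP] : forall e : edge K, exists k : nat,
    [/\ (0 < k)%N, elen e <= h * k%:R & h * k%:R <= elen e + h].
  by move=> e; apply: nat_scale => //; exact: elen_ge0.
have k_gt0 e : (0 < k e)%N by have [] := kP e.
have len_le e : elen e <= h * (k e)%:R by have [] := kP e.
have /choice[mm mmP] : forall e : edge G, exists k : nat,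
    [/\ (0 < k)%N, m e <= h * k%:R & h * k%:R <= m e + h].
  by move=> e; apply: nat_scale => //; exact: ltW.
have mm_gt0 e : (0 < mm e)%N by have [] := mmP e.
have mm_gt0R e : 0 < (mm e)%:R :> R by rewrite ltr0n.
(* The product over the other edges is the integer P / mm(e). *)
pose c (e : edge G) := (\prod_(e' | e' != e) mm e')%N.
pose P := (\prod_e mm e)%N.
have cP e : (c e * mm e = P)%N by rewrite /P (bigD1 e)//= mulnC.
have c_gt0 e : (0 < c e)%N by apply: prodn_gt0.
have P0 : 0 < P%:R :> R by rewrite ltr0n; apply: prodn_gt0.
have cPR e : (c e)%:R = P%:R / (mm e)%:R :> R.
  by rewrite -(cP e) natrM mulfK// gt_eqF.
pose Q := (2 * \sum_e c e)%N.
have Q_ge e : (2 * c e <= Q)%N by rewrite /Q leq_mul2l /= (bigD1 e)//= leq_addr.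
(* As mm(e) >= m(e) / h, the sum of the c(e) is at most P h A, so the loss over a cycle is small
   against [P]. *)
have nQ : n%:R * Q%:R <= eps / 2 * P%:R :> R.
  have -> : Q%:R = 2 * \sum_e P%:R / (mm e)%:R :> R.
    by rewrite /Q natrM natr_sum; congr (_ * _); apply: eq_bigr => e _; exact: cPR.
  have : \sum_e P%:R / (mm e)%:R <= P%:R * (h * A) :> R.
    rewrite /A !big_distrr /=; apply: ler_sum => e _.
    rewrite ler_pM2l// -[leRHS]invrK lef_pV2 ?posrE ?invr_gt0 ?divr_gt0//.
    rewrite invfM invrK mulrC ler_pdivrMr//; have [_ + _] := mmP e.
    by rewrite mulrC.
  set Z := \sum_e _ => hZ.
  have : n%:R * (2 * Z) <= n%:R * (2 * (P%:R * (h * A))).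
    by rewrite ler_wpM2l// ler_pM2l.
  move=> /le_trans; apply.
  rewrite [leLHS](_ : _ = P%:R * (2 * (h * (n%:R * A)))); last by ring.
  by rewrite mulrC ler_pM2r//; lra.
have [s [sf sE]] := sub_exists R k_gt0.
have sub_valid := valid_sub_word k_gt0.
have [phi [om mincfg]] := minimal_exists (s \o f : gmap R G (subdivision k)) c.
have [[v [g [fg gf]]] _] := mincfg.
have om_le e : (size (om e))%:R <= (1 + eps) * (mm e)%:R :> R.
  rewrite leNgt; apply/negP => big.
  have X0 : (1 + eps) * P%:R < (exponent c om (e, false))%:R :> R.
    rewrite /exponent /= natrM cPR mulrAC ltr_pdivlMr// mulrAC.
    by rewrite mulrC ltr_pM2l.
  have [|w [w0 wn cyc wexp]] := minimal_cycle c_gt0 Q_ge mincfg (a0 := (e, false)).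
    rewrite -(ltr_nat R) natrM; apply: le_lt_trans nQ (lt_trans _ X0).
    by rewrite ltr_pM2r//; lra.
  have sw : simple_cycle w by rewrite /simple_cycle w0 wn (turn_reduced_cycle cyc).
  have long a : a \in w -> (1 + eps / 2) * m a.1 <= h * (size (om a.1))%:R.
    move=> aw; have := wexp a aw; rewrite -(ler_nat R) natrD natrM => wa.
    have : (1 + eps / 2) * P%:R <= (exponent c om a)%:R :> R by lra.
    rewrite /exponent natrM cPR => Pa.
    have q0 : 0 < P%:R / (mm a.1)%:R :> R by rewrite divr_gt0.
    have La : (1 + eps / 2) * (mm a.1)%:R <= (size (om a.1))%:R :> R.
      rewrite -(ler_pM2r q0) [leRHS]mulrC [leLHS](_ : _ = (1 + eps / 2) * P%:R)//.
      by field; rewrite gt_eqF.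
    apply: (@le_trans _ _ ((1 + eps / 2) * (h * (mm a.1)%:R))).
      by rewrite ler_pM2l; [have [] := mmP a.1 | lra].
    by rewrite mulrCA ler_pM2l.
  have lw := lm w sw; set M := \sum_(a <- w) _ in lw.
  pose ws := taut_word (f \o cw w : gmap R (circles 1) K).
  have M_ge : nu <= M.
    rewrite /M; case: (w) w0 => // a u _; rewrite big_cons.
    by rewrite (le_trans (nu_m a.1))// lerDl sumr_ge0// => b _; rewrite ltW.
  have low : (1 + eps / 2) * M <= h * (size (wimage om w))%:R.
    rewrite size_wimage natr_sum !big_distrr /=.
    by apply: ler_sum_seq => a; exact: long.
  have high : h * (size (wimage (sub_word k) ws))%:R <= M + h * S.
    apply: (@le_trans _ _ (taut_length (cw w) + h * (size ws)%:R)).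
      rewrite size_wimage natr_sum big_distrr /= /taut_length -/ws.
      rewrite [X in _ <= _ + X](_ : _ = \sum_(d <- ws) h); last first.
        by rewrite big_const_seq count_predT iter_addr_0 mulr_natr.
      rewrite -big_split /=; apply: ler_sum => d _.
      by rewrite size_sub_word; have [] := kP d.1.
    by rewrite lerD// ler_pM2l// sizeS.
  (* The image of the legal cycle [w] is cyclically reduced, hence no longer than the word obtained
     by subdividing the taut word of its image in [K]. *)
  have ineq : (size (wimage om w) <= size (wimage (sub_word k) ws))%N.
    have [_ [d [fd ld]]] := taut_wordP (f \o cw w : gmap R (circles 1) K).
    have l1 := loop_comp v gf (cwP w sw).
    have l2 := loop_comp sub_valid sf ld.
    rewrite -!(weight1 (wimage _ _)); apply: (loop_le _ l2 l1).
      apply: (@homotopic_trans _ _ _ (s \o (f \o cw w : gmap R (circles 1) K) :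
          gmap R (circles 1) (subdivision k))).
        by apply: homotopic_comp; [exact: homotopic_sym | exact: eq_homotopic].
      apply: (@homotopic_trans _ _ _ ((s \o f : gmap R G (subdivision k)) \o cw w :
          gmap R (circles 1) (subdivision k))).
        exact: eq_homotopic.
      by apply: homotopic_comp; [exact: eq_homotopic | exact: fg].
    apply: cycle_wimage => //; first by move=> e'; exact: minimal_reduced mincfg e'.
    apply/allP => a aw; rewrite -size_eq0 size_dimage -lt0n -(ltr_nat R).
    have := long a aw; have := m0 a.1 => ma la.
    have : 0 < h * (size (om a.1))%:R by apply: lt_le_trans la; rewrite mulr_gt0//; lra.
    by rewrite pmulr_rgt0.
  have : h * (size (wimage om w))%:R <= h * (size (wimage (sub_word k) ws))%:R.
    by rewrite ler_pM2l// ler_nat.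
  have : eps * nu <= eps * M by rewrite ler_pM2l.
  nra.
have [g1 r1] := runs_exists v (@arc_clockP R G K k om).
pose g2 : gmap R G K := unsub R k_gt0 \o g1.
exists g2; split.
- apply: (@homotopic_trans _ _ _
    (unsub R k_gt0 \o (s \o f : gmap R G (subdivision k)) : gmap R G K)).
    by apply: eq_homotopic => x /=; rewrite sE.
  apply: homotopic_comp; last exact: eq_homotopic.
  apply: homotopic_trans fg _; apply: follows_homotopic v gf _.
  by exists (arc_clock om) => //; exact: arc_clockP.
- exact: (lipschitz_unsub (ltW h0) k_gt0 len_le v r1).
- apply: le_trans (Dir_unsub_le (ltW h0) k_gt0 len_le v r1) _.
  rewrite lee_fin; apply: ler_sum => e _.
  rewrite ler_pM2r ?invr_gt0 ?alpha_gt0//.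
  rewrite ler_pXn2r// ?nnegrE.
  + have [_ _ mh] := mmP e.
    have e1 : 0 < 1 + eps by lra.
    have : h * (size (om e))%:R <= h * ((1 + eps) * (mm e)%:R) by rewrite ler_pM2l.
    rewrite mulrCA => /le_trans; apply.
    have : (1 + eps) * (h * (mm e)%:R) <= (1 + eps) * (m e + h) by rewrite ler_pM2l.
    lra.
  + by rewrite mulr_ge0// ltW.
  + by have := m0 e; nra.
Qed.

End Stretch.

Lemma sum_sqr_limit (R : realType) (E : finType) (al m : E -> R) (x : R) :
  (forall e, 0 < al e) -> (forall e, 0 < m e) ->
  (forall eps, 0 < eps -> x <= \sum_e ((1 + eps) * m e + eps) ^+ 2 / al e) ->
  x <= \sum_e m e ^+ 2 / al e.
Proof.
move=> al0 m0 h; rewrite leNgt; apply/negP; set T := \sum_e _ => Tx.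
(* With x = m + 1 and eps <= 1, the square of m + eps x is at most m ^ 2 + 3 eps x ^ 2. *)
pose B := \sum_e 3 * (m e + 1) ^+ 2 / al e.
have B0 : 0 <= B.
  apply: sumr_ge0 => e _; apply: divr_ge0; last exact: ltW.
  by apply: mulr_ge0 => //; exact: sqr_ge0.
pose eps := Num.min 1 ((x - T) / (2 * (B + 1))).
have eps0 : 0 < eps by rewrite lt_min ltr01 divr_gt0 ?subr_gt0//; lra.
have eps1 : eps <= 1 by rewrite ge_min lexx.
have epsB : eps * (2 * (B + 1)) <= x - T.
  by rewrite -ler_pdivlMr; [rewrite ge_min lexx orbT | lra].
have : \sum_e ((1 + eps) * m e + eps) ^+ 2 / al e <= T + eps * B.
  rewrite /T /B big_distrr -big_split /=; apply: ler_sum => e _.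
  have me := m0 e; have ae := al0 e.
  rewrite [leRHS](_ : _ = (m e ^+ 2 + eps * (3 * (m e + 1) ^+ 2)) / al e); last first.
    by field; rewrite gt_eqF.
  rewrite ler_pM2r ?invr_gt0// -subr_ge0.
  rewrite [X in 0 <= X](_ : _ = eps * ((m e + 1) * 2 + (1 - eps) * (m e + 1) ^+ 2));
    last by ring.
  apply: mulr_ge0; first exact: ltW.
  by apply: addr_ge0; apply: mulr_ge0; rewrite ?sqr_ge0//; lra.
have := h eps eps0; nra.
Qed.

Section Weighted.
Variables (R : realType) (G : elasticGraph R) (K : lengthGraph R) (f : gmap R G K).
Variable cw : seq (dart G) -> gmap R (circles 1) G.
Hypothesis cwP : forall w, simple_cycle w -> loop (cw w) w.

Definition cycle_index : finType :=
  {w : #|{: dart G}|.-bseq (dart G) | simple_cycle w}.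
Implicit Types (i : cycle_index) (C : seq ({posnum R} * cycle_index)).

Definition crossings i (e : edge G) : nat :=
  count (fun d : dart G => d.1 == e) (val (val i)).

Definition weighted C : wcurve R G :=
  [seq (a.1, Curve (cw (val (val a.2)))) | a <- C].

Lemma EL_weighted C : EL (weighted C) = wEL (@alpha R G) crossings C.
Proof.
rewrite /EL /wEL; apply: eq_bigr => e _; congr (_ ^+ 2 * _).
rewrite /wncross /wcount big_map; apply: eq_bigr => -[t [w sw]] _ /=.
by rewrite (ncross_loop e (cwP sw))//; case/and3P: sw.
Qed.

Lemma length_weighted C :
  curve_length (push f (weighted C)) = wlen (fun i => taut_length f (cw (val (val i)))) C.
Proof.
rewrite /curve_length /wlen /wncross /push /weighted -map_comp.
under eq_bigr do rewrite big_map big_distrl /=.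
rewrite exchange_big /=; apply: eq_bigr => -[t [w sw]] _ /=.
rewrite /taut_length -sum_count big_distrr /=; apply: eq_bigr => e _.
by rewrite -mulrA -ncrossE.
Qed.

End Weighted.

(** The first conjunct rules out curves with EL = 0, for which the inequality is trivial, unless the
    energy of the class is 0. *)
Theorem proposition5p13 (R : realType) (G : elasticGraph R) (K : lengthGraph R)
    (f : gmap R G K) (hf : harmonic_map f) :
  exists C : nat -> wcurve R G,
    ((0 < DirClass f)%E -> forall i : nat, 0 < EL (C i)) /\
    forall eps : R, 0 < eps -> exists i : nat,
      ((1 - eps)%:E * DirClass f * (EL (C i))%:E
         <= ((curve_length (push f (C i))) ^+ 2)%:E)%E.
Proof.
have [D0|D0] := boolP (0 < DirClass f)%E; last first.
  exists (fun=> [::]); split=> [h|eps _]; first by case/negP: D0.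
  exists 0%N; have -> : EL ([::] : wcurve R G) = 0.
    by rewrite /EL big1// => e _; rewrite /wncross big_nil expr0n mul0r.
  by rewrite mule0 lee_fin sqr_ge0.
have /choice[cw cwP] : forall w : seq (dart G), exists c : gmap R (circles 1) G,
    simple_cycle w -> loop c w.
  move=> w; have [sw|nw] := boolP (simple_cycle w); last first.
    have [v _] := existsP (egraph_connected G).
    have vv : walk v [::] v by rewrite /=.
    by have [c _] := @loop_exists R G v [::] vv; exists c.
  have /and3P[w0 _ red] := sw; case: w w0 red {sw} => // d u _ red.
  have [c [cf _]] := loop_exists R (reduced_cycle_walk red).
  by exists c => _; exists (dsrc d); split=> //; exact: reduced_cycle_walk.
pose I := cycle_index G.
pose l (i : I) := taut_length f (cw (val (val i))).
have l0 i : 0 <= l i by apply: sumr_ge0 => d _; exact: elen_ge0.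
have sumE (i : I) (m : edge G -> R) :
    \sum_e m e * (crossings i e)%:R = \sum_(a <- val (val i)) m a.1.
  by rewrite -sum_count; apply: eq_bigr => e _; rewrite mulrC.
have size_ge1 (i : I) : 1 <= \sum_e (crossings i e)%:R :> R.
  have := sumE i (fun=> 1); under eq_bigr do rewrite mul1r; move=> ->.
  case: i => -[w wn] /= /and3P[w0 _ _]; case: w w0 {wn} => // a u _.
  by rewrite big_cons lerDl sumr_ge0.
have Dle (m : edge G -> R) : (forall e, 0 < m e) ->
    (forall i : I, l i <= \sum_e m e * (crossings i e)%:R) -> forall eps, 0 < eps ->
    (DirClass f <= (\sum_e ((1 + eps) * m e + eps) ^+ 2 / alpha e)%:E)%E.
  move=> m0 lm eps eps0.
  have lm' w : simple_cycle w -> taut_length f (cw w) <= \sum_(a <- w) m a.1.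
    move=> sw; have /and3P[_ wn _] := sw.
    by have := lm (exist _ (Bseq wn) sw : I); rewrite sumE.
  have [g [fg lg Dg]] := stretch_bound cwP m0 lm' eps0.
  by apply: le_trans Dg; apply: ereal_inf_lbound; exists g.
(* A constant m above all [l i] is admissible because each cycle makes at least one crossing; its
   bound is finite. *)
have Dfin : DirClass f \is a fin_num.
  pose L := 1 + \sum_i l i; have L0 : 0 < L by rewrite ltr_pwDl// sumr_ge0.
  rewrite ge0_fin_numE ?ltW//.
  apply: le_lt_trans (@Dle (fun=> L) (fun=> L0) _ 1 ltr01) (ltry _).
  move=> i; rewrite -big_distrr /=; apply: (@le_trans _ _ L).
    by rewrite /L (bigD1 i)//= addrCA lerDl addr_ge0// sumr_ge0.
  by rewrite ler_peMr// ltW.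
have DE := fineK Dfin; set D := fine _ in DE.
have D0' : 0 < D by rewrite -lte_fin DE.
have D_le (m : edge G -> R) : (forall e, 0 < m e) ->
    (forall i : I, l i <= \sum_e m e * (crossings i e)%:R) ->
    D <= \sum_e m e ^+ 2 / alpha e.
  move=> m0 lm; apply: sum_sqr_limit => // [e|eps eps0]; first exact: alpha_gt0.
  by have := Dle m m0 lm eps eps0; rewrite -DE lee_fin.
(* The i-th curve realizes the estimate with 1 / (i + 1) in place of eps. *)
have /choice[C CP] : forall i : nat, exists C : seq ({posnum R} * I),
    0 < wEL (@alpha R G) (@crossings R G) C /\
    (1 - i.+1%:R^-1) * D * wEL (@alpha R G) (@crossings R G) C <= wlen l C ^+ 2.
  move=> i; apply: (duality (@alpha_gt0 R G) l0 size_ge1 D_le) => //.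
exists (fun i => weighted cw (C i)); split=> [_ i|eps eps0].
  by rewrite (EL_weighted cwP); have [] := CP i.
have [i _ /(_ i (leqnn i)) /= ie] := near_infty_natSinv_lt (PosNum eps0).
exists i; have [EL0 h] := CP i.
rewrite (EL_weighted cwP) length_weighted -DE -!EFinM lee_fin.
apply: le_trans h; rewrite ler_pM2r// ler_pM2r// lerD2l lerN2.
exact: ltW.
Qed.
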